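(* Let $p>1$. Let $F=u+iv$ be analytic in the unit disk $\mathbb{D}$, and suppose that $$u\ge 0,\qquad |v|\le B$$ almost everywhere on $\mathbb{T}$, where $B$ is a constant. Assume in addition that $$\int_{\mathbb{T}} v\,dm=0.$$ Then $$\int_{\mathbb{T}}|v|^p\,dm\le A_p\,B^{p-1}\int_{\mathbb{T}}u\,dm,$$ where $$A_p=p\int_0^1\frac{t^{p-1}}{\sin(\pi t/2)}\,dt.$$ The constant $A_p$ is best possible.
   Context: $\mathbb{D}$ is the open unit disk in the complex plane. $\mathbb{T}=\mathbb{R}/2\pi\mathbb{Z}$ is identified with the unit circle via $x\mapsto e^{ix}$ and is equipped with normalized Haar measure $dm(x)=dx/(2\pi)$. The functions $u$ and $v$ are the real and imaginary parts of $F$; on $\mathbb{T}$, $u$ and $v$ denote their radial boundary values. ''Best possible'' means that the inequality fails in general if $A_p$ is replaced by any smaller constant.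
   Formalization: F is additionally assumed to lie in the Smirnov class N^+ (with radial limits a.e.); for merely analytic F the claim fails, e.g. F = d - sinh((1+z)/(1-z)), where u = d and v = -sin(cot(x/2)) on T, with d > 0 arbitrarily small. *)

(* Defs.v *)
From HB Require Import structures.
From mathcomp Require Import all_boot all_order all_algebra.
From mathcomp Require Import complex.
From mathcomp Require Import all_classical all_reals all_analysis.

Set Implicit Arguments.
Unset Strict Implicit.
Unset Printing Implicit Defensive.

Import Order.TTheory GRing.Theory Num.Theory.
Import numFieldNormedType.Exports.

Local Open Scope classical_set_scope.
Local Open Scope ring_scope.
Local Open Scope complex_scope.

Lemma inv_2pi_ge0 (R : realType) : 0 <= (2 * pi : R)^-1.
Proof. by rewrite invr_ge0 mulr_ge0 // pi_ge0. Qed.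

(* The circle R / 2piZ is represented by its fundamental domain [0, 2pi[;
   the measure lives on R and vanishes outside of that interval. *)
Definition circle_measure (R : realType) :
    {measure set (measurableTypeR R) -> \bar R} :=
  mscale (NngNum (inv_2pi_ge0 R))
    (mrestr (@lebesgue_measure R) (measurable_itv `[0, (2 * pi : R)[)).

Definition expi (R : realType) (x : R) : R[i] := cos x +i* sin x.

(* Complex differentiability: R[i]^o is R[i] as a normed module over itself, so
   the increment in [derivable] is complex.  The modulus of z is an element of
   R[i], ordered so that [`|z| < 1] has its usual meaning. *)
Definition analytic_in_disk (R : realType) (F : R[i] -> R[i]) : Prop :=
  forall z : R[i], `|z| < 1 -> derivable (F : R[i]^o -> R[i]^o) z 1.

Definition along_radius (R : realType) (F : R[i] -> R[i]) (x r : R) : R[i]^o :=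
  F (r%:C * expi x).

Definition has_radial_limits (R : realType) (F : R[i] -> R[i]) : Prop :=
  {ae @circle_measure R, forall x : R, cvg (along_radius F x r @[r --> 1^'-])}.

(* [lim] has an arbitrary value at the x where there is no radial limit. *)
Definition boundary_value (R : realType) (F : R[i] -> R[i]) (x : R) : R[i] :=
  lim (along_radius F x r @[r --> 1^'-]).

Definition bdry_re (R : realType) (F : R[i] -> R[i]) (x : R) : R :=
  complex.Re (boundary_value F x).

Definition bdry_im (R : realType) (F : R[i] -> R[i]) (x : R) : R :=
  complex.Im (boundary_value F x).

Definition log_plus_norm (R : realType) (z : R[i]) : R :=
  ln (Num.max 1 (Normc.normc z)).

Definition nevanlinna (R : realType) (F : R[i] -> R[i]) : Prop :=
  analytic_in_disk F /\
  exists M : R, forall r : R, 0 <= r < 1 ->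
    (\int[@circle_measure R]_x (log_plus_norm (along_radius F x r))%:E
       <= M%:E)%E.

(* The Smirnov class N^+ (Duren, Theory of H^p spaces, section 2.5).  It
   contains every Hardy space H^q, q > 0, and every analytic function whose
   real part is nonnegative in the disk.  For functions that are merely
   analytic, or even of class N, inequalities between boundary values say
   nothing about the interior: F(z) = d - sinh ((1 + z) / (1 - z)), d > 0, has
   boundary values u = d, v(x) = - sin (cot (x / 2)), so that the mean of v is
   0 and the mean of u is arbitrarily small while v does not depend on d.

   The a.e. existence of radial limits holds throughout N by Fatou's theorem;
   it is recorded because the boundary values occur in the definition. *)
Definition smirnov (R : realType) (F : R[i] -> R[i]) : Prop :=
  [/\ nevanlinna F,
      has_radial_limits F &
      (\int[@circle_measure R]_x
          (log_plus_norm (along_radius F x r))%:E)%E @[r --> (1 : R)^'-]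
        --> (\int[@circle_measure R]_x
              (log_plus_norm (boundary_value F x))%:E)%E].

Definition half_strip_data (R : realType) (B : R) (F : R[i] -> R[i]) : Prop :=
  [/\ smirnov F,
      {ae @circle_measure R, forall x : R, 0 <= bdry_re F x},
      {ae @circle_measure R, forall x : R, `|bdry_im F x| <= B} &
      (\int[@circle_measure R]_x (bdry_im F x)%:E = 0)%E].

(* The integral of u >= 0 is extended-real: it may be +oo. *)
Definition Lp_estimate (R : realType) (p C B : R) (F : R[i] -> R[i]) : Prop :=
  (\int[@circle_measure R]_x (`|bdry_im F x| `^ p)%:E
     <= (C * B `^ (p - 1))%:E * \int[@circle_measure R]_x (bdry_re F x)%:E)%E.

Definition A_const (R : realType) (p : R) : R :=
  p * (\int[@lebesgue_measure R]_(t in `[0%R, 1%R])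
         (t `^ (p - 1) / sin (pi * t / 2)))%R.

(* Main.v *)
(** For F in N^+ with integrable boundary values, F(0) is the mean of F on the
    circle: the inequality log|f(0)| <= mean of log max(c, |f|), applied to
    f = 1 + F/N, gives this for N -> oo.  The same mean value property for
    difference quotients of F shows that every half plane containing the boundary
    values contains F(D).  Hence F maps the disk into the half strip u >= 0,
    |v| <= B, and F(0) = a is the mean of u.

    Normalise B = 1 and move F slightly into the interior.  Put
    X = sinh(pi a / 2) and let G(z) = (2/pi) arsinh(X (1 + z) / (1 - z)) be the
    conformal map onto the half strip with G(0) = a.  Then F = G o omega with
    Z = sinh(pi F / 2), omega = (Z - X) / (Z + X) and omega(0) = 0, so
    Littlewood subordination bounds the p-th mean of v by that of Im G.  The
    level sets of |Im G| on the circle are arcs, and the latter mean equals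
    int_0^1 p t^(p-1) (2/pi) arctan(X / sin(pi t / 2)) dt.  It is at most A_p a,
    because arctan(sinh(b) / s) <= b / s for b >= 0 and 0 < s <= 1.

    Conversely the dilates G(rho z), rho -> 1, show that any constant C in the
    inequality bounds this integral by C a; dividing by a and letting a -> 0
    gives A_p <= C. *)

Require Import Defs.
From HB Require Import structures.
From mathcomp Require Import all_boot all_order all_algebra.
From mathcomp Require Import complex.
From mathcomp Require Import all_classical all_reals all_analysis.
From mathcomp Require Import measurable_realfun.
From mathcomp Require Import ring lra.
Set Implicit Arguments.
Unset Strict Implicit.
Unset Printing Implicit Defensive.

Import Order.TTheory GRing.Theory Num.Theory.
Import numFieldNormedType.Exports.
Import Normc.

Local Open Scope classical_set_scope.
Local Open Scope ring_scope.
Local Open Scope complex_scope.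

Local Notation Re := complex.Re.
Local Notation Im := complex.Im.

(** The constant is sharp because arctan(sinh(b) / s) and b / s are tangent at b = 0, so that
    nothing is lost as a -> 0. Logarithms enter because membership in N^+ controls F on the circles
    |z| = r only through log+|F|: the limit r -> 1 is taken for N log|1 + F/N|, and N -> oo
    afterwards recovers Re F. The difference quotients (F(w) - F(z)) / (w - z) are a priori only
    continuous at w = z. The mean value property is therefore proved for functions that may fail to
    be differentiable at the origin and on one circle: by Goursat's theorem the circle means are
    constant on either side of that radius, and they are continuous across it. This takes the place
    of removable singularities, Cauchy's formula and power series. Subordination rests on Poisson's
    formula, obtained from the same difference quotients, on the convexity of |x|^p and on Tonelli's
    theorem; the key fact is that the Poisson kernel at omega(r e^{it}) has mean 1 over t when
    omega(0) = 0. *)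

Lemma normc_ge0 (R : realType) (z : R[i]) : 0 <= normc z.
Proof. by case: z => a b; rewrite sqrtr_ge0. Qed.

Lemma normC_normc (R : realType) (z : R[i]) : `|z| = (normc z)%:C.
Proof. by case: z. Qed.

Lemma normc_triangle (R : realType) (z w : R[i]) : normc (z + w) <= normc z + normc w.
Proof.
have := ler_normD z w; rewrite !normC_normc -rmorphD /=.
by rewrite lecR.
Qed.

Lemma normcN (R : realType) (z : R[i]) : normc (- z) = normc z.
Proof. by apply: (@complexI R); rewrite -!normC_normc normrN. Qed.

Lemma normcB (R : realType) (z w : R[i]) : normc (z - w) = normc (w - z).
Proof. by rewrite -normcN opprB. Qed.

Lemma normc_Re (R : realType) (z : R[i]) : `|Re z| <= normc z.
Proof.
case: z => a b /=; rewrite -sqrtr_sqr ler_sqrt ?lerDl ?sqr_ge0 //.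
by rewrite addr_ge0 ?sqr_ge0.
Qed.

Lemma normc_Im (R : realType) (z : R[i]) : `|Im z| <= normc z.
Proof.
case: z => a b /=; rewrite -sqrtr_sqr ler_sqrt ?lerDr ?sqr_ge0 //.
by rewrite addr_ge0 ?sqr_ge0.
Qed.

Lemma normc_real (R : realType) (x : R) : normc x%:C = `|x|.
Proof. by rewrite /= expr0n /= addr0 sqrtr_sqr. Qed.

Lemma normc_le (R : realType) (z : R[i]) : normc z <= `|Re z| + `|Im z|.
Proof.
rewrite {1}(complexE z); apply: (le_trans (normc_triangle _ _)).
by rewrite normcM !normc_real /= expr0n /= add0r expr1n sqrtr1 mul1r.
Qed.

Lemma normc_eq0 (R : realType) (z : R[i]) : (normc z == 0) = (z == 0).
Proof.
apply/eqP/eqP => [|->]; first exact: eq0_normc.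
exact: normc0.
Qed.

Lemma normc_gt0 (R : realType) (z : R[i]) : (0 < normc z) = (z != 0).
Proof. by rewrite lt_def normc_eq0 normc_ge0 andbT. Qed.

Lemma sqr_normcE (R : realType) (z : R[i]) : normc z ^+ 2 = Re z ^+ 2 + Im z ^+ 2.
Proof. by case: z => a b /=; rewrite sqr_sqrtr // addr_ge0 ?sqr_ge0. Qed.

Lemma cReB (R : realType) (z w : R[i]) : Re (z - w) = Re z - Re w.
Proof. by case: z; case: w. Qed.
Lemma cImB (R : realType) (z w : R[i]) : Im (z - w) = Im z - Im w.
Proof. by case: z; case: w. Qed.
Lemma cReD (R : realType) (z w : R[i]) : Re (z + w) = Re z + Re w.
Proof. by case: z; case: w. Qed.
Lemma cImD (R : realType) (z w : R[i]) : Im (z + w) = Im z + Im w.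
Proof. by case: z; case: w. Qed.
Lemma cReM (R : realType) (z w : R[i]) : Re (z * w) = Re z * Re w - Im z * Im w.
Proof. by case: z; case: w. Qed.
Lemma cImM (R : realType) (z w : R[i]) : Im (z * w) = Re z * Im w + Im z * Re w.
Proof. by case: z; case: w. Qed.

(** * Complex differentiability *)

Section Cvg.
Context (R : realType).
Local Notation C := (R[i] : numFieldType).

(** The norm of [R[i]^o] is [R[i]]-valued, so epsilon in [cvgrPdist_lt] is a complex number;
    positivity forces it to be real, which brings back real epsilons. *)
Lemma cvgCP (T : Type) (F : set_system T) (FF : Filter F) (f : T -> R[i]^o) (l : R[i]^o) :
  f @ F --> l <-> forall e : R, 0 < e -> \forall t \near F, normc (f t - l) < e.
Proof.
split => [/cvgrPdist_lt h e e0|h].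
  have : 0 < e%:C by rewrite (ltcR 0 e).
  move=> /h; apply: filterS => t; rewrite normC_normc ltcR.
  by rewrite normcB.
apply/cvgrPdist_lt => e; case: e => e e'.
rewrite (ltcE 0) /= => /andP[/eqP -> e0].
have := h e e0; apply: filterS => t; rewrite normC_normc ltcR.
by rewrite normcB.
Qed.

Lemma cvg_Re (T : Type) (F : set_system T) (FF : Filter F) (f : T -> R[i]^o) (l : R[i]^o) :
  f @ F --> l -> (fun t => Re (f t)) @ F --> Re l.
Proof.
move=> /cvgCP h; apply/cvgrPdist_lt => e e0.
have := h e e0; apply: filterS => t; apply: le_lt_trans.
rewrite distrC.
have -> : Re (f t) - Re l = Re (f t - l) by case: (f t) => ? ?; case: (l).
exact: normc_Re.
Qed.

Lemma cvg_Im (T : Type) (F : set_system T) (FF : Filter F) (f : T -> R[i]^o) (l : R[i]^o) :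
  f @ F --> l -> (fun t => Im (f t)) @ F --> Im l.
Proof.
move=> /cvgCP h; apply/cvgrPdist_lt => e e0.
have := h e e0; apply: filterS => t; apply: le_lt_trans.
rewrite distrC.
have -> : Im (f t) - Im l = Im (f t - l) by case: (f t) => ? ?; case: (l).
exact: normc_Im.
Qed.

Lemma cvg_complex (T : Type) (F : set_system T) (FF : Filter F) (a b : T -> R) (la lb : R) :
  a @ F --> la -> b @ F --> lb ->
  (fun t => (a t +i* b t) : R[i]^o) @ F --> (la +i* lb : R[i]^o).
Proof.
move=> /cvgrPdist_lt ha /cvgrPdist_lt hb; apply/cvgCP => e e0.
have e20 : 0 < e / 2 by rewrite divr_gt0.
have := hb _ e20; have := ha _ e20; apply: filterS2 => t h1 h2.
apply: (le_lt_trans (normc_le _)); rewrite /=.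
by rewrite (splitr e); apply: ltrD; rewrite distrC.
Qed.

Lemma cvg_normc (T : Type) (F : set_system T) (FF : Filter F) (f : T -> R[i]^o) (l : R[i]^o) :
  f @ F --> l -> (fun t => normc (f t)) @ F --> normc l.
Proof.
move=> /cvgCP h; apply/cvgrPdist_lt => e e0.
have := h e e0; apply: filterS => t; apply: le_lt_trans.
have h1 : normc l <= normc (f t) + normc (f t - l).
  rewrite normcB; apply: le_trans (normc_triangle _ _); by rewrite addrC subrK.
have h2 : normc (f t) <= normc (l) + normc (f t - l).
  by apply: le_trans (normc_triangle _ _); rewrite addrC subrK.
by rewrite ler_norml; apply/andP; split; lra.
Qed.

Lemma cvgZC (T : Type) (F : set_system T) (FF : Filter F) (f g : T -> R[i]^o) (l m : R[i]^o) :
  f @ F --> l -> g @ F --> m -> (fun t => (f t * g t : R[i]^o)) @ F --> (l * m : R[i]^o).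
Proof. move=> h1 h2; exact: (cvgM h1 h2). Qed.

Lemma cvgC_cst (T : Type) (F : set_system T) (FF : Filter F) (l : R[i]^o) :
  (fun t => l) @ F --> l.
Proof. exact: cvg_cst. Qed.

Lemma cvgC_V (T : Type) (F : set_system T) (FF : ProperFilter F) (f : T -> R[i]^o) (l : R[i]^o) :
  l != 0 -> f @ F --> l -> (fun t => ((f t)^-1 : R[i]^o)) @ F --> (l^-1 : R[i]^o).
Proof. by move=> l0 h; apply: (@cvgV _ _ F _ f l l0 h). Qed.

End Cvg.

Section Cdiff.
Context (R : realType).
Implicit Types (f g : R[i] -> R[i]) (z w : R[i]).

Definition ccont f z := forall e : R, 0 < e ->
  \forall w \near (z : R[i]^o), normc (f w - f z) < e.

Lemma ccontE f z : ccont f z <->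
  (f : R[i]^o -> R[i]^o) @ (z : R[i]^o) --> (f z : R[i]^o).
Proof.
by have := (@cvgCP R R[i]^o (nbhs (z : R[i]^o)) _ (f : R[i]^o -> R[i]^o) (f z : R[i]^o)) => -[h1 h2]; split.
Qed.

(* Caratheodory's form of complex differentiability: the rules for products,
   compositions and inverse functions need no quotients. *)
Definition cdiff f z := exists2 phi : R[i] -> R[i],
  (forall w, f w - f z = phi w * (w - z)) & ccont phi z.

Lemma ccont_cst c z : ccont (fun=> c) z.
Proof. by move=> e e0; apply: (@filterE _ (nbhs (z : R[i]^o))) => w; rewrite subrr normc0. Qed.
Lemma ccont_id z : ccont id z.
Proof. by apply/ccontE; exact: cvg_id. Qed.
Lemma ccontD f g z : ccont f z -> ccont g z -> ccont (fun w => f w + g w) z.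
Proof.
move=> /ccontE cf /ccontE cg; apply/ccontE.
exact: (@cvgD R[i] R[i]^o R[i]^o _ _ (f : R[i]^o -> R[i]^o) g _ _ cf cg).
Qed.
Lemma ccontN f z : ccont f z -> ccont (fun w => - f w) z.
Proof.
move=> /ccontE cf; apply/ccontE.
exact: (@cvgN R[i] R[i]^o R[i]^o _ _ (f : R[i]^o -> R[i]^o) _ cf).
Qed.
Lemma ccontB f g z : ccont f z -> ccont g z -> ccont (fun w => f w - g w) z.
Proof. by move=> cf cg; apply: ccontD => //; exact: ccontN. Qed.
Lemma ccontM f g z : ccont f z -> ccont g z -> ccont (fun w => f w * g w) z.
Proof. by move=> /ccontE cf /ccontE cg; apply/ccontE; exact: (cvgZC _ cf cg). Qed.
Lemma ccontV f z : f z != 0 -> ccont f z -> ccont (fun w => (f w)^-1) z.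
Proof. by move=> f0 /ccontE cf; apply/ccontE; exact: (cvgC_V _ f0 cf). Qed.
Lemma ccont_comp f g z : ccont g z -> ccont f (g z) -> ccont (fun w => f (g w)) z.
Proof. by move=> /ccontE cg cf e /cf h; exact: (cg _ h). Qed.

(** Serves to enter and leave [analytic_in_disk]; all calculus in between is done with [cdiff]. *)
Lemma derivable_cdiff f z : derivable (f : R[i]^o -> R[i]^o) z 1 <-> cdiff f z.
Proof.
split => [df|[phi hphi cphi]].
- move/cvg_ex : df => [/= l df'].
  exists (fun w => if w == z then l else (f w - f z) / (w - z)).
    move=> w; case: eqP => [->|/eqP wz]; first by rewrite !subrr mulr0.
    by rewrite divfK // subr_eq0.
  move/cvgCP : df' => df'; move=> e e0; rewrite eqxx.
  have := df' e e0; rewrite /dnbhs !near_withinE => h.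
  have cz : (fun w : R[i]^o => w - z : R[i]^o) w @[w --> (z : R[i]^o)] --> (0 : R[i]^o).
    rewrite -[X in _ --> X](subrr z); by have /ccontE := (ccontB (@ccont_id z) (@ccont_cst z z)).
  have := cz _ h; apply: (@filterS _ (nbhs (z:R[i]^o))) => {h} w /= h.
  case: ifPn => [_|wz]; first by rewrite subrr normc0.
  have := h; rewrite subr_eq0 => /(_ wz).
  by rewrite /GRing.scale /= mulr1 subrK mulrC.
- apply/cvg_ex; exists (phi z); apply/cvgCP => e e0.
  rewrite /dnbhs near_withinE.
  move: cphi => /(_ e e0) h.
  have cz : (fun w : R[i]^o => w + z : R[i]^o) w @[w --> (0 : R[i]^o)] --> (z : R[i]^o).
    rewrite -[X in _ --> X](add0r z); by have /ccontE := (ccontD (@ccont_id 0) (@ccont_cst z 0)).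
  have := cz _ h; apply: (@filterS _ (nbhs (0:R[i]^o))) => {h} w /= h w0.
  by rewrite hphi /GRing.scale /= mulr1 addrK mulrC mulfK.
Qed.

Lemma cdiff_cont f z : cdiff f z -> ccont f z.
Proof.
case=> phi hphi cphi.
have -> : f = (fun w => f z + phi w * (w - z)).
  by apply/funext => w; rewrite -hphi addrC subrK.
apply: ccontD; first exact: ccont_cst.
apply: ccontM => //; apply: ccontB; [exact: ccont_id|exact: ccont_cst].
Qed.

Lemma ccont_near f g z : (\forall w \near (z : R[i]^o), f w = g w) ->
  ccont g z -> ccont f z.
Proof.
move=> h cg.
have h0 : f z = g z by exact: (nbhs_singleton h).
move=> e /cg; rewrite h0.
by apply: filterS2 h => w ->.
Qed.

Lemma ccont_neq0 f z : ccont f z -> f z != 0 ->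
  \forall w \near (z : R[i]^o), f w != 0.
Proof.
move=> cf; rewrite -normc_gt0 => f0.
have := cf _ f0; apply: filterS => w; apply: contraTneq => ->.
by rewrite sub0r normcN ltxx.
Qed.

(** Caratheodory's identity is demanded at every w, so the slope of g serves only near z; elsewhere
    the plain difference quotient of f takes over. *)
Lemma cdiff_near f g z : (\forall w \near (z : R[i]^o), f w = g w) ->
  cdiff g z -> cdiff f z.
Proof.
move=> h [phi hphi cphi].
have h0 : f z = g z by exact: (nbhs_singleton h).
exists (fun w => if w == z then phi z else (f w - f z) / (w - z)).
  move=> w; case: eqP => [->|/eqP wz]; first by rewrite !subrr mulr0.
  by rewrite divfK // subr_eq0.
apply: ccont_near cphi; apply: filterS h => w /= fg.
case: eqP => [->//|/eqP wz].
by rewrite fg h0 hphi mulfK // subr_eq0.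
Qed.

Lemma cdiff_cst c z : cdiff (fun=> c) z.
Proof. exists (fun=> 0); [by move=> w; rewrite subrr mul0r|exact: ccont_cst]. Qed.

Lemma cdiff_id z : cdiff id z.
Proof. exists (fun=> 1); [by move=> w; rewrite mul1r|exact: ccont_cst]. Qed.

Lemma cdiffD f g z : cdiff f z -> cdiff g z -> cdiff (fun w => f w + g w) z.
Proof.
move=> [a ha ca] [b hb cb]; exists (fun w => a w + b w); last exact: ccontD.
by move=> w; rewrite mulrDl -ha -hb opprD addrACA.
Qed.

Lemma cdiffM f g z : cdiff f z -> cdiff g z -> cdiff (fun w => f w * g w) z.
Proof.
move=> df dg; have cf := cdiff_cont df; move: df dg => [a ha ca] [b hb cb].
exists (fun w => f w * b w + a w * g z).
  by move=> w; rewrite mulrDl -mulrA -hb mulrAC -ha; ring.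
by apply: ccontD; [exact: ccontM|apply: ccontM => //; exact: ccont_cst].
Qed.

Lemma cdiffN f z : cdiff f z -> cdiff (fun w => - f w) z.
Proof.
move=> [a ha ca]; exists (fun w => - a w); last exact: ccontN.
by move=> w; rewrite mulNr -ha; ring.
Qed.

Lemma cdiffB f g z : cdiff f z -> cdiff g z -> cdiff (fun w => f w - g w) z.
Proof. by move=> df dg; apply: cdiffD => //; exact: cdiffN. Qed.

Lemma cdiffV f z : f z != 0 -> cdiff f z -> cdiff (fun w => (f w)^-1) z.
Proof.
move=> f0 df; have cf := cdiff_cont df; have nf := ccont_neq0 cf f0.
case: df => a ha ca.
exists (fun w => if w == z then - a z / (f z * f z) else ((f w)^-1 - (f z)^-1) / (w - z)).
  move=> w; case: eqP => [->|/eqP wz]; first by rewrite !subrr mulr0.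
  by rewrite divfK // subr_eq0.
apply: (@ccont_near _ (fun w => - a w / (f w * f z))).
  apply: filterS nf => w fw; case: eqP => [->//|/eqP wz].
  apply: (@mulIf _ (w - z)); first by rewrite subr_eq0.
  rewrite divfK ?subr_eq0 //.
  have -> : - a w / (f w * f z) * (w - z) = - (a w * (w - z)) / (f w * f z) by ring.
  by rewrite -ha; field; rewrite fw f0.
apply: ccontM; first exact: ccontN.
apply: ccontV; first by rewrite mulf_neq0.
by apply: ccontM => //; exact: ccont_cst.
Qed.

Lemma cdiff_comp f g z : cdiff g z -> cdiff f (g z) -> cdiff (fun w => f (g w)) z.
Proof.
move=> dg [a ha ca]; have cg := cdiff_cont dg; case: dg => b hb cb.
exists (fun w => a (g w) * b w).
  by move=> w; rewrite ha hb mulrA.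
apply: ccontM => //; exact: ccont_comp.
Qed.

Lemma cdiff_prod (n : nat) (F : 'I_n -> R[i] -> R[i]) z :
  (forall k, cdiff (F k) z) -> cdiff (fun w => \prod_(k < n) F k w) z.
Proof.
elim: n F => [|n ih] F h.
  have -> : (fun w => \prod_(k < 0) F k w) = (fun=> 1).
    by apply/funext => w; rewrite big_ord0.
  exact: cdiff_cst.
have -> : (fun w => \prod_(k < n.+1) F k w) = (fun w => F ord0 w * \prod_(k < n) F (lift ord0 k) w).
  by apply/funext => w; rewrite big_ord_recl.
by apply: cdiffM => //; apply: ih.
Qed.

Lemma ccont_prod (n : nat) (F : 'I_n -> R[i] -> R[i]) z :
  (forall k, ccont (F k) z) -> ccont (fun w => \prod_(k < n) F k w) z.
Proof.
elim: n F => [|n ih] F h.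
  have -> : (fun w => \prod_(k < 0) F k w) = (fun=> 1).
    by apply/funext => w; rewrite big_ord0.
  exact: ccont_cst.
have -> : (fun w => \prod_(k < n.+1) F k w) = (fun w => F ord0 w * \prod_(k < n) F (lift ord0 k) w).
  by apply/funext => w; rewrite big_ord_recl.
by apply: ccontM => //; apply: ih.
Qed.

(* Cauchy-Riemann: [a] and [b] are the difference quotients in the real and in
   the imaginary direction. *)
Lemma cdiff_CR (f : R[i] -> R[i]) (a b : R[i] -> R[i]) z :
  (forall w, f w - f z = a w * (Re w - Re z)%:C + b w * (Im w - Im z)%:C) ->
  ccont a z -> ccont b z -> b z = 'i * a z -> cdiff f z.
Proof.
move=> hf ca cb hb.
exists (fun w => if w == z then a z else (f w - f z) / (w - z)).
  move=> w; case: eqP => [->|/eqP wz]; first by rewrite !subrr mulr0.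
  by rewrite divfK // subr_eq0.
move=> e e0; rewrite eqxx.
have e20 : 0 < e / 2 by rewrite divr_gt0.
move: cb => /(_ _ e20); move: ca => /(_ _ e20).
apply: filterS2 => w h1 h2.
case: ifPn => [_|wz]; first by rewrite subrr normc0.
have wz0 : 0 < normc (w - z) by rewrite normc_gt0 subr_eq0.
have -> : (f w - f z) / (w - z) - a z =
   ((a w - a z) * (Re w - Re z)%:C + (b w - b z) * (Im w - Im z)%:C) / (w - z).
  apply: (@mulIf _ (w - z)); first by rewrite subr_eq0.
  rewrite mulrBl !divfK ?subr_eq0 // hf hb.
  have -> : a z * (w - z) = a z * (Re w - Re z)%:C + 'i * a z * (Im w - Im z)%:C.
    have -> : w - z = (Re w - Re z)%:C + 'i * (Im w - Im z)%:C.
      by rewrite [LHS]complexE !cReB !cImB.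
    ring.
  ring.
rewrite normcM normcV ltr_pdivrMr //.
apply: (le_lt_trans (normc_triangle _ _)); rewrite !normcM !normc_real.
have -> : Re w - Re z = Re (w - z) by case: (w) => ? ?; case: (z).
have -> : Im w - Im z = Im (w - z) by case: (w) => ? ?; case: (z).
rewrite (splitr e) mulrDl; apply: ler_ltD.
  by apply: ler_pM (ltW h1) (normc_Re _) => //; exact: normc_ge0.
apply: (le_lt_trans (ler_pM _ _ (lexx _) (normc_Im _))) => //; first exact: normc_ge0.
by rewrite ltr_pM2r.
Qed.

Lemma ccontP f z : ccont f z <->
  forall e : R, 0 < e -> exists2 d : R, 0 < d & forall w, normc (w - z) < d -> normc (f w - f z) < e.
Proof.
split => [h e e0|h].
  have /nbhs_normP[d /= d0 hd] := h e e0.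
  have dd : d = (Re d)%:C /\ 0 < Re d.
    move: d0; case: (d) => x y; rewrite ltcE /= => /andP[/eqP -> x0]; by split.
  case: dd => dd d0'; exists (Re d) => // w hw; apply: hd => /=.
  by rewrite distrC dd normC_normc ltcR.
move=> e e0; have [d d0 hd] := h e e0.
apply/nbhs_normP; exists d%:C => /=; first by rewrite (ltcR 0 d).
by move=> w /=; rewrite distrC normC_normc ltcR => /hd.
Qed.

(** The quotient at z is differentiable off z but only continuous at z, which is why the mean value
    lemmas below tolerate an exceptional circle. *)
Lemma cdiff_slope f (R0 : R) z : (forall w, normc w < R0 -> cdiff f w) -> normc z < R0 ->
  exists phi : R[i] -> R[i], [/\ forall w, f w - f z = phi w * (w - z), ccont phi z &
    forall w, normc w < R0 -> w != z -> cdiff phi w].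
Proof.
move=> df z1; have [phi hphi cphi] := df _ z1; exists phi; split=> // w w1 wz.
have nz : \forall u \near (w : R[i]^o), u - z != 0.
  apply: (@ccont_neq0 (fun u => u - z)); last by rewrite subr_eq0.
  by apply: ccontB; [exact: ccont_id|exact: ccont_cst].
apply: (@cdiff_near _ (fun u => (f u - f z) / (u - z))).
  by apply: filterS nz => u uz; rewrite hphi mulfK.
apply: cdiffM; first by apply: cdiffB; [exact: df|exact: cdiff_cst].
apply: cdiffV; first by rewrite subr_eq0.
by apply: cdiffB; [exact: cdiff_id|exact: cdiff_cst].
Qed.

End Cdiff.

(** * Goursat's theorem and the mean value property *)

Section Goursat.
Context (R : realType).
Local Notation mu := (@lebesgue_measure R).

(** Bisection as an induction principle (x, y is the lower left corner, h and k are the sides): a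
    failing rectangle has a failing quarter, and the nested failing quarters shrink to a point,
    where the local hypothesis contradicts failure. It yields Goursat's theorem and also the
    compactness of an interval. *)
Lemma rect_ind (P : R -> R -> R -> R -> Prop) (a c h k : R) :
  0 < h -> 0 < k ->
  (forall x y h k, P x y (h / 2) (k / 2) -> P (x + h / 2) y (h / 2) (k / 2) ->
    P x (y + k / 2) (h / 2) (k / 2) -> P (x + h / 2) (y + k / 2) (h / 2) (k / 2) ->
    P x y h k) ->
  (forall x0 y0, a <= x0 <= a + h -> c <= y0 <= c + k -> exists2 t, 0 < t &
    forall x y n, x <= x0 <= x + h / 2 ^+ n -> y <= y0 <= y + k / 2 ^+ n ->
      h / 2 ^+ n < t -> k / 2 ^+ n < t -> P x y (h / 2 ^+ n) (k / 2 ^+ n)) ->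
  P a c h k.
Proof.
move=> h0 k0 split_ loc; apply: contrapT => nP.
pose hn n := h / 2 ^+ n; pose kn n := k / 2 ^+ n.
pose next (n : nat) (q : R * R) : R * R :=
  let (x, y) := q in let h' := hn n.+1 in let k' := kn n.+1 in
  if ~~ `[< P x y h' k' >] then (x, y)
  else if ~~ `[< P (x + h') y h' k' >] then (x + h', y)
  else if ~~ `[< P x (y + k') h' k' >] then (x, y + k') else (x + h', y + k').
pose fix q n : R * R := if n is m.+1 then next m (q m) else (a, c).
have hnS n : hn n.+1 = hn n / 2 by rewrite /hn exprSr invfM mulrA.
have knS n : kn n.+1 = kn n / 2 by rewrite /kn exprSr invfM mulrA.
have hn0 n : 0 < hn n by rewrite divr_gt0 // exprn_gt0.
have kn0 n : 0 < kn n by rewrite divr_gt0 // exprn_gt0.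
have nPq n : ~ P (q n).1 (q n).2 (hn n) (kn n).
  elim: n => [|n]; first by rewrite /hn /kn !expr0 !divr1.
  rewrite /= /next; case: (q n) => x y /= IH.
  case: asboolP => //= P1; case: asboolP => //= P2; case: asboolP => //= P3 P4.
  by apply: IH; apply: split_; rewrite -hnS -knS.
have q1 n : (q n).1 <= (q n.+1).1 /\ (q n.+1).1 + hn n.+1 <= (q n).1 + hn n.
  rewrite /= /next; case: (q n) => x y /=; have := hn0 n.+1; have := hnS n.
  do 3 (case: ifP => _ /=; first by split; lra).
  by split; lra.
have q2 n : (q n).2 <= (q n.+1).2 /\ (q n.+1).2 + kn n.+1 <= (q n).2 + kn n.
  rewrite /= /next; case: (q n) => x y /=; have := kn0 n.+1; have := knS n.
  do 3 (case: ifP => _ /=; first by split; lra).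
  by split; lra.
(* Nested intervals [u n, u n + l n] share the supremum of their left endpoints. *)
have nest (u : nat -> R) (l : nat -> R) : (forall n, 0 < l n) ->
    (forall n, u n <= u n.+1 /\ u n.+1 + l n.+1 <= u n + l n) ->
    exists z, forall n, u n <= z <= u n + l n.
  move=> l0 ul.
  have mono n m : u n <= u (n + m)%N /\ u (n + m)%N + l (n + m)%N <= u n + l n.
    elim: m => [|m [IH1 IH2]]; first by rewrite addn0.
    by rewrite addnS; have [??] := ul (n + m)%N; split; lra.
  have ub n m : u m <= u n + l n.
    have [nm|/ltnW mn] := leqP n m.
      by have := mono n (m - n)%N; rewrite subnKC // => -[]; have := l0 m; lra.
    by have := mono m (n - m)%N; rewrite subnKC // => -[]; have := l0 n; lra.
  have hs : has_sup (range u).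
    split; first by exists (u 0%N); exists 0%N.
    by exists (u 0%N + l 0%N) => _ [m _ <-].
  exists (sup (range u)) => n; apply/andP; split.
    by apply: sup_upper_bound => //; exists n.
  by apply: sup_le_ub; [exists (u 0%N); exists 0%N|move=> _ [m _ <-]].
have [x0 hx0] := nest _ hn hn0 q1.
have [y0 hy0] := nest _ kn kn0 q2.
have [||t t0 H] := loc x0 y0.
- by have := hx0 0%N; rewrite /hn expr0 divr1.
- by have := hy0 0%N; rewrite /kn expr0 divr1.
have small (l : R) : 0 < l -> exists N, forall n, (N <= n)%N -> l / 2 ^+ n < t.
  move=> l0.
  have : (fun n => l * (2^-1) ^+ n) @ \oo --> l * 0.
    apply: cvgMr; apply: cvg_expr; rewrite ger0_norm ?invr_ge0 // invf_lt1 //; lra.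
  rewrite mulr0 => /cvgrPdist_lt /(_ t t0)[N _ hN]; exists N => n /hN /=.
  by rewrite sub0r normrN exprVn ger0_norm // divr_ge0 ?exprn_ge0 // ltW.
have [N1 hN1] := small h h0; have [N2 hN2] := small k k0.
apply: (nPq (maxn N1 N2)); apply: H; rewrite ?hx0 ?hy0 //.
  exact/hN1/leq_maxl.
exact/hN2/leq_maxr.
Qed.

Lemma Rintegral_itv_split (f : R -> R) (a b c : R) : a <= b -> b <= c ->
  mu.-integrable `[a, c] (EFin \o f) ->
  \int[mu]_(x in `[a, c]) f x = \int[mu]_(x in `[a, b]) f x + \int[mu]_(x in `[b, c]) f x.
Proof.
move=> ab bc itf.
have := @Rintegral_itvB R f (BLeft a) (BRight c) b itf.
rewrite !bnd_simp => /(_ ab bc) H.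
rewrite -(Rintegral_itv_obnd_cbnd (f := f) (r := b)).
  by rewrite -H addrC subrK.
apply: integrableS itf => //; apply: subset_itvr; by rewrite bnd_simp.
Qed.

Lemma itv_integrableS (f : R -> R) (a b c d : R) : a <= c -> d <= b ->
  mu.-integrable `[a, b] (EFin \o f) -> mu.-integrable `[c, d] (EFin \o f).
Proof.
move=> ac db; apply: integrableS => //.
by apply: subset_itv; rewrite bnd_simp.
Qed.

Lemma Rintegral_near_cst (f : R -> R) (a b m e : R) : a <= b ->
  mu.-integrable `[a, b] (EFin \o f) ->
  (forall x, a <= x <= b -> `|f x - m| <= e) ->
  `|\int[mu]_(x in `[a, b]) f x - m * (b - a)| <= e * (b - a).
Proof.
move=> ab itf H.
have cst_int (r : R) : mu.-integrable `[a, b] (EFin \o (fun=> r)).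
  apply: continuous_compact_integrable; first exact: segment_compact.
  by move=> x; exact: cvg_cst.
have cst_val (r : R) : \int[mu]_(x in `[a, b]) r = r * (b - a).
  have := @lebesgue_measure_itv R `[a, b]; rewrite /= lte_fin => e1.
  by rewrite Rintegral_cst // [X in fine X]e1; case: ltP => //= h; rewrite (le_anti (introT andP (conj ab h))) subrr.
rewrite -!cst_val -RintegralB //.
apply: (le_trans (le_normr_Rintegral _ _)) => //.
  exact: (integrableB _ itf (cst_int m)).
apply: le_Rintegral => //.
- have itB : mu.-integrable `[a, b] (EFin \o (fun x => f x - m)).
    exact: (integrableB _ itf (cst_int m)).
  exact: (@integrable_norm _ _ R mu _ _ itB).
Qed.

(** For f = U + iW this is the imaginary part of the counterclockwise integral of f dz around the
    rectangle. *)
Definition flux (U W : R -> R -> R) (a b c d : R) : R :=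
  \int[mu]_(y in `[c, d]) (U b y - U a y) - \int[mu]_(x in `[a, b]) (W x d - W x c).

Lemma itv_dist (x h x0 x' : R) : x <= x0 <= x + h -> x <= x' <= x + h -> `|x' - x0| <= h.
Proof. by move=> /andP[? ?] /andP[? ?]; rewrite ler_norml; apply/andP; split; lra. Qed.

Lemma itv_within (x h' a h x' : R) : a <= x -> x + h' <= a + h -> x <= x' <= x + h' ->
  a <= x' <= a + h.
Proof. by move=> ? ? /andP[? ?]; apply/andP; split; lra. Qed.

Lemma half_le (x h : R) : 0 < h / 2 -> x <= x + h / 2 /\ x + h / 2 <= x + h.
Proof. by move=> ?; split; lra. Qed.

Section Flux.
Context (U W : R -> R -> R) (a h c k : R)
  (iU : forall x, a <= x <= a + h -> mu.-integrable `[c, c + k] (EFin \o U x))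
  (iW : forall y, c <= y <= c + k -> mu.-integrable `[a, a + h] (EFin \o (W ^~ y))).

Let iUB x1 x2 c' d' : a <= x1 <= a + h -> a <= x2 <= a + h ->
  c <= c' -> d' <= c + k ->
  mu.-integrable `[c', d'] (EFin \o (fun y => U x2 y - U x1 y)).
Proof.
move=> h1 h2 h3 h4; apply: (itv_integrableS h3 h4).
by apply: (integrableB _ (iU h2) (iU h1)).
Qed.

Let iWB y1 y2 c' d' : c <= y1 <= c + k -> c <= y2 <= c + k ->
  a <= c' -> d' <= a + h ->
  mu.-integrable `[c', d'] (EFin \o (fun x => W x y2 - W x y1)).
Proof.
move=> h1 h2 h3 h4; apply: (itv_integrableS h3 h4).
by apply: (integrableB _ (iW h2) (iW h1)).
Qed.

Lemma flux_splitx x1 x2 x3 y1 y2 : a <= x1 -> x1 <= x2 -> x2 <= x3 -> x3 <= a + h ->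
  c <= y1 -> y1 <= y2 -> y2 <= c + k ->
  flux U W x1 x3 y1 y2 = flux U W x1 x2 y1 y2 + flux U W x2 x3 y1 y2.
Proof.
move=> h1 h2 h3 h4 h5 h6 h7.
have X1 : a <= x1 <= a + h by apply/andP; split; lra.
have X2 : a <= x2 <= a + h by apply/andP; split; lra.
have X3 : a <= x3 <= a + h by apply/andP; split; lra.
have Y1 : c <= y1 <= c + k by apply/andP; split; lra.
have Y2 : c <= y2 <= c + k by apply/andP; split; lra.
rewrite /flux (@Rintegral_itv_split _ x1 x2 x3) //; last exact: iWB.
have -> : \int[mu]_(y in `[y1, y2]) (U x3 y - U x1 y) =
    \int[mu]_(y in `[y1, y2]) (U x2 y - U x1 y) + \int[mu]_(y in `[y1, y2]) (U x3 y - U x2 y).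
  rewrite -RintegralD //; try exact: iUB.
  by apply: eq_Rintegral => z _; rewrite [RHS]addrC addrA subrK.
by rewrite opprD addrACA.
Qed.

Lemma flux_splity x1 x2 y1 y2 y3 : a <= x1 -> x1 <= x2 -> x2 <= a + h ->
  c <= y1 -> y1 <= y2 -> y2 <= y3 -> y3 <= c + k ->
  flux U W x1 x2 y1 y3 = flux U W x1 x2 y1 y2 + flux U W x1 x2 y2 y3.
Proof.
move=> h1 h2 h3 h4 h5 h6 h7.
have X1 : a <= x1 <= a + h by apply/andP; split; lra.
have X2 : a <= x2 <= a + h by apply/andP; split; lra.
have Y1 : c <= y1 <= c + k by apply/andP; split; lra.
have Y2 : c <= y2 <= c + k by apply/andP; split; lra.
have Y3 : c <= y3 <= c + k by apply/andP; split; lra.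
rewrite /flux (@Rintegral_itv_split _ y1 y2 y3) //; last exact: iUB.
have -> : \int[mu]_(x in `[x1, x2]) (W x y3 - W x y1) =
    \int[mu]_(x in `[x1, x2]) (W x y2 - W x y1) + \int[mu]_(x in `[x1, x2]) (W x y3 - W x y2).
  rewrite -RintegralD //; try exact: iWB.
  by apply: eq_Rintegral => z _; rewrite [RHS]addrC addrA subrK.
by rewrite opprD addrACA.
Qed.

(** [A] is at once the x-slope of U and the y-slope of W, which is the Cauchy-Riemann equation at
    stake. The affine parts then contribute A h' k' to either integral and cancel; the remainders
    are of the order of e (h' + k')^2. *)
Lemma flux_small x h' y k' u0 w0 x0 y0 A B C e : a <= x -> x + h' <= a + h ->
  c <= y -> y + k' <= c + k -> 0 < h' -> 0 < k' -> 0 < e ->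
  (forall x' y', x <= x' <= x + h' -> y <= y' <= y + k' ->
     `|U x' y' - u0 - A * (x' - x0) - B * (y' - y0)| <= e * (h' + k') /\
     `|W x' y' - w0 - C * (x' - x0) - A * (y' - y0)| <= e * (h' + k')) ->
  `|flux U W x (x + h') y (y + k')| <= 4 * (e * (h' + k')) * (h' + k').
Proof.
move=> ax xh cy yk h'0 k'0 e0 nbd.
have xl : x <= x <= x + h' by apply/andP; split; lra.
have xr : x <= x + h' <= x + h' by apply/andP; split; lra.
have yl : y <= y <= y + k' by apply/andP; split; lra.
have yr : y <= y + k' <= y + k' by apply/andP; split; lra.
have yy : y <= y + k' by lra.
have xx : x <= x + h' by lra.
set d := e * (h' + k').
have d0 : 0 <= d by rewrite mulr_ge0 // ltW // addr_gt0.
have F1 : `|\int[mu]_(y in `[y, y + k']) (U (x + h') y - U x y) - A * h' * (y + k' - y)|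
   <= 2 * d * (y + k' - y).
  apply: Rintegral_near_cst => //.
    by apply: iUB => //; [exact: (itv_within ax xh xl)|exact: (itv_within ax xh xr)].
  move=> y' hy'.
  have [+ _] := nbd _ _ xr hy'; have [+ _] := nbd _ _ xl hy'.
  clear nbd; rewrite !ler_norml -/d => /andP[? ?] /andP[? ?]; apply/andP; split; lra.
have F2 : `|\int[mu]_(x in `[x, x + h']) (W x (y + k') - W x y) - A * k' * (x + h' - x)|
   <= 2 * d * (x + h' - x).
  apply: Rintegral_near_cst => //.
    by apply: iWB => //; [exact: (itv_within cy yk yl)|exact: (itv_within cy yk yr)].
  move=> x' hx'.
  have [_ +] := nbd _ _ hx' yr; have [_ +] := nbd _ _ hx' yl.
  clear nbd; rewrite !ler_norml -/d => /andP[? ?] /andP[? ?]; apply/andP; split; lra.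
move: F1 F2; rewrite /flux [y + k' - y]addrC addKr [x + h' - x]addrC addKr.
have G1 : d * h' >= 0 by rewrite mulr_ge0 // ltW.
have G2 : d * k' >= 0 by rewrite mulr_ge0 // ltW.
move: (\int[mu]_(y in _) _) (\int[mu]_(y in _) _) => I J.
rewrite !ler_norml => /andP[? ?] /andP[? ?]; apply/andP; split; lra.
Qed.

Lemma flux_rect : 0 < h -> 0 < k ->
  (forall x0 y0, a <= x0 <= a + h -> c <= y0 <= c + k ->
    exists A B C : R, forall e : R, 0 < e -> exists2 t : R, 0 < t &
    forall x y, a <= x <= a + h -> c <= y <= c + k ->
      `|x - x0| < t -> `|y - y0| < t ->
      `|U x y - U x0 y0 - A * (x - x0) - B * (y - y0)| <= e * (`|x - x0| + `|y - y0|) /\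
      `|W x y - W x0 y0 - C * (x - x0) - A * (y - y0)| <= e * (`|x - x0| + `|y - y0|)) ->
  flux U W a (a + h) c (c + k) = 0.
Proof.
move=> h0 k0 dUW.
apply/eqP; rewrite -normr_le0; apply/ler_addgt0Pl => /= eta eta0; rewrite addr0.
(* The tolerance is distributed in proportion to area, a bound that adds up exactly over the four
   quarters. *)
set e1 := eta / (h * k).
have e10 : 0 < e1 by rewrite divr_gt0 // mulr_gt0.
have -> : eta = e1 * h * k by rewrite /e1 -mulrA divfK // mulf_neq0 // gt_eqF.
pose P x y h' k' := a <= x -> x + h' <= a + h -> c <= y -> y + k' <= c + k ->
  0 < h' -> 0 < k' ->
  `|flux U W x (x + h') y (y + k')| <= e1 * h' * k'.
suff : P a c h k by apply; rewrite ?lexx.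
apply: rect_ind => //.
- clear dUW eta0; clearbody e1; clear eta.
  move=> x y h' k' P1 P2 P3 P4 ax xh cy yk h'0 k'0.
  have h'2 : 0 < h' / 2 by rewrite divr_gt0.
  have k'2 : 0 < k' / 2 by rewrite divr_gt0.
  have [x1 x2] : x <= x + h' / 2 /\ x + h' / 2 <= x + h'.
    exact: half_le.
  have [y1 y2] : y <= y + k' / 2 /\ y + k' / 2 <= y + k'.
    exact: half_le.
  have Ex : x + h' / 2 + h' / 2 = x + h' by rewrite -addrA -splitr.
  have Ey : y + k' / 2 + k' / 2 = y + k' by rewrite -addrA -splitr.
  rewrite (@flux_splitx x (x + h' / 2) (x + h')) //; last exact: le_trans y2.
  have x3 := le_trans x2 xh; have y3 := le_trans y2 yk.
  have x4 := le_trans ax x1; have y4 := le_trans cy y1.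
  rewrite (@flux_splity _ _ y (y + k' / 2) (y + k')) //.
  rewrite (@flux_splity (x + h' / 2) _ y (y + k' / 2) (y + k')) //.
  have Q1 := P1 ax x3 cy y3 h'2 k'2.
  rewrite /P Ex in P2; have Q2 := P2 x4 xh cy y3 h'2 k'2.
  rewrite /P Ey in P3; have Q3 := P3 ax x3 y4 yk h'2 k'2.
  rewrite /P Ex Ey in P4; have Q4 := P4 x4 xh y4 yk h'2 k'2.
  have -> : e1 * h' * k' = (e1 * (h' / 2) * (k' / 2) + e1 * (h' / 2) * (k' / 2))
     + (e1 * (h' / 2) * (k' / 2) + e1 * (h' / 2) * (k' / 2)) by field.
  apply: (le_trans (ler_normD _ _)); apply: lerD;
  by apply: (le_trans (ler_normD _ _)); apply: lerD.
- move=> x0 y0 hx0 hy0.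
  have [A [B [C H]]] := dUW _ _ hx0 hy0.
  (* Bisection preserves the ratio of the sides, so with this e the bound 4 e (h' + k')^2 of
     [flux_small] equals e1 h' k' in every generation. *)
  set e := e1 * h * k / (4 * (h + k) ^+ 2).
  have hk2 : 0 < (h + k) ^+ 2 by rewrite exprn_gt0 // addr_gt0.
  have e0 : 0 < e.
    by rewrite /e divr_gt0 //; [do 2 (apply: mulr_gt0 => //)|apply: mulr_gt0].
  have [t t0 Ht] := H e e0; exists t => // x y n.
  set h' := h / 2 ^+ n; set k' := k / 2 ^+ n.
  move=> xx0 yy0 h't k't ax xh cy yk h'0 k'0.
  have -> : e1 * h' * k' = 4 * (e * (h' + k')) * (h' + k').
    rewrite /e /h' /k'; field.
    by rewrite expf_neq0 ?andbT //= gt_eqF // addr_gt0.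
  apply: (@flux_small x h' y k' (U x0 y0) (W x0 y0) x0 y0 A B C) => // x' y' hx' hy'.
  have n1 := itv_dist xx0 hx'; have n2 := itv_dist yy0 hy'.
  have [E1 E2] := Ht x' y' (itv_within ax xh hx') (itv_within cy yk hy')
    (le_lt_trans n1 h't) (le_lt_trans n2 k't).
  have E3 : e * (`|x' - x0| + `|y' - y0|) <= e * (h' + k').
    by rewrite ler_pM2l // lerD.
  by split; [exact: le_trans E1 E3|exact: le_trans E2 E3].
Qed.

End Flux.
End Goursat.

(** * The normalized measure on the circle *)

Section Circle.
Context (R : realType).
Local Notation mu := (@lebesgue_measure R).
Local Notation circ := (circle_measure R).
Local Notation pi2 := (2 * pi : R).

Lemma pi2_gt0 : 0 < pi2. Proof. by rewrite mulr_gt0 // pi_gt0. Qed.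

Lemma circle_mass : circ setT = 1%E.
Proof.
change (((pi2^-1)%:E * mu (setT `&` `[0%R, pi2[))%E = 1%E).
rewrite setTI.
have := @lebesgue_measure_itv R `[0, pi2[; rewrite /= lte_fin pi2_gt0 => ->.
by rewrite -EFinD subr0 -EFinM mulVf // gt_eqF // pi2_gt0.
Qed.

Lemma circle_off : circ (~` `[0%R, pi2[) = 0%E.
Proof.
change (((pi2^-1)%:E * mu (~` `[0%R, pi2[ `&` `[0%R, pi2[))%E = 0%E).
by rewrite setICl measure0 mule0.
Qed.

Lemma circle_finite : fin_num_fun circ.
Proof.
move=> A mA; rewrite ge0_fin_numE //; apply: (@le_lt_trans _ _ (circ setT)).
  by apply: le_measure; rewrite ?inE.
by rewrite circle_mass ltry.
Qed.

Lemma integral_circle_ge0 (f : measurableTypeR R -> \bar R) : measurable_fun setT f ->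
  (forall x, (0 <= f x)%E) ->
  (\int[circ]_x f x = (pi2^-1)%:E * \int[mu]_(x in `[0%R, pi2]) f x)%E.
Proof.
move=> mf f0.
have mI : measurable (`[0, pi2[ : set (measurableTypeR R)) by [].
have mfI : measurable_fun (`[0, pi2[ : set (measurableTypeR R)) f by exact: measurable_funS mf.
have -> : (\int[circ]_x f x = \int[circ]_(x in `[0%R, pi2[) f x)%E.
  rewrite -(setUv `[0%R, pi2[) ge0_integral_setU //.
  - rewrite [X in (_ + X)%E](_ : _ = 0%E) ?adde0 //.
    apply: null_set_integral; [exact: measurableC| |exact: circle_off].
    exact: measurable_funS mf.
  - exact: measurableC.
  - by rewrite setUv.
  - by apply/disj_setPS; rewrite setICr.
rewrite (@eq_measure_integral _ _ _ _ (mscale (NngNum (inv_2pi_ge0 R)) mu)); last first.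
  move=> A mA AI.
  change (((pi2^-1)%:E * mu (A `&` `[0%R, pi2[))%E = ((pi2^-1)%:E * mu A)%E).
  by rewrite (setIidl AI).
rewrite ge0_integral_mscale //; congr (_ * _)%E.
exact: integral_itv_bndo_bndc.
Qed.

Lemma integral_circle (f : measurableTypeR R -> \bar R) : measurable_fun setT f ->
  (\int[mu]_(x in `[0%R, pi2]) f^\+ x)%E \is a fin_num ->
  (\int[circ]_x f x = (pi2^-1)%:E * \int[mu]_(x in `[0%R, pi2]) f x)%E.
Proof.
move=> mf ff; rewrite !(@integralE _ _ _ _ _ f) !integral_circle_ge0 //.
- rewrite [RHS]muleBr //; exact: fin_num_adde_defr.
- exact: measurable_funeneg.
- exact: measurable_funepos.
Qed.

Lemma Rintegral_circle (g : measurableTypeR R -> R) : measurable_fun setT g ->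
  mu.-integrable `[0, pi2] (EFin \o g) ->
  \int[circ]_x g x = pi2^-1 * \int[mu]_(x in `[0%R, pi2]) g x.
Proof.
move=> mg ig; rewrite /Rintegral integral_circle.
- rewrite fineM //; exact: integrable_fin_num.
- exact/measurable_EFinP.
- exact: integrable_pos_fin_num.
Qed.

Lemma circle_integrable (g : measurableTypeR R -> R) (M : R) : measurable_fun setT g ->
  (forall x, `|g x| <= M) -> circ.-integrable setT (EFin \o g).
Proof.
move=> mg gM; apply: measurable_bounded_integrable => //.
- by rewrite circle_mass ltry.
- exists M; split; first exact: num_real.
  by move=> N MN x _; exact: le_trans (gM x) (ltW MN).
Qed.

End Circle.

Section Carath.
Context (R : realType).

Lemma carath1 (f : R -> R) (x l : R) : is_derive x 1 f l ->
  exists k : R -> R, [/\ forall y, f y - f x = k y * (y - x), k x = l &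
    k @ x --> k x].
Proof.
move=> df.
have : (fun h => h^-1 *: (f (h + x) - f x)) @ 0^' --> l.
  have := @ex_derive _ _ _ _ _ _ _ df; rewrite /derivable.
  move/cvg_ex => [l' hl'].
  have := @derive_val _ _ _ _ _ _ _ df; rewrite /derive => <-.
  have -> : (fun h => h^-1 *: (f (h + x) - f x)) = (fun h : R => h^-1 *: ((f \o shift x) (h *: (1 : R)) - f x)).
    by apply/funext => h; rewrite /= /GRing.scale /= mulr1.
  by apply/cvg_ex; exists l'.
move=> cf.
exists (fun y => if y == x then l else (f y - f x) / (y - x)); split.
- move=> y; case: eqP => [->|/eqP yx]; first by rewrite !subrr mulr0.
  by rewrite divfK // subr_eq0.
- by rewrite eqxx.
- rewrite eqxx; apply/cvgrPdist_lt => e e0.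
  move/cvgrPdist_lt : cf => /(_ e e0); rewrite /dnbhs !near_withinE.
  move=> h.
  have cz : (fun y => y - x) @ x --> (0 : R).
    by rewrite -[X in _ --> X](subrr x); apply: cvgB; [exact: cvg_id|exact: cvg_cst].
  have := cz _ h; apply: (@filterS _ (nbhs x)) => {h} y h.
  case: ifPn => [_|yx]; first by rewrite subrr normr0.
  move: h; rewrite /= subr_eq0 => /(_ yx).
  by rewrite subrK /GRing.scale /= mulrC.
Qed.

End Carath.

(** * The unit circle and the complex exponential *)

Section Expi.
Context (R : realType).

Lemma normc_expi (x : R) : normc (expi x) = 1.
Proof. by rewrite /expi /= cos2Dsin2 sqrtr1. Qed.

Lemma expi0 : expi (0 : R) = 1.
Proof. by rewrite /expi cos0 sin0. Qed.

Lemma expiD (x y : R) : expi (x + y) = expi x * expi y.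
Proof.
by rewrite /expi cosD sinD; simpc; congr (_ +i* _); rewrite addrC.
Qed.

Lemma expi_neq0 (x : R) : expi x != 0.
Proof. by rewrite -normc_gt0 normc_expi. Qed.

Lemma expi_2pi (x : R) : expi (x + 2 * pi) = expi x.
Proof. by rewrite /expi mulr_natl cosD2pi sinD2pi. Qed.

Lemma expi_conj (x : R) : (expi x)^* = (expi x)^-1.
Proof.
apply: (mulfI (expi_neq0 x)); rewrite mulfV ?expi_neq0 // /expi; simpc.
by rewrite -!expr2 cos2Dsin2 addrC mulrC subrr.
Qed.

Lemma normc_circle (r x : R) : normc (r%:C * expi x) = `|r|.
Proof. by rewrite normcM normc_real normc_expi mulr1. Qed.

Lemma cvg_expi (x : R) : (fun y => expi y : R[i]^o) @ x --> (expi x : R[i]^o).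
Proof. by apply: cvg_complex; [exact: continuous_cos|exact: continuous_sin]. Qed.

Lemma polar_cont (f : R[i] -> R[i]) (r0 x0 : R) : ccont f (r0%:C * expi x0) ->
  forall e : R, 0 < e -> exists2 t : R, 0 < t & forall r x : R,
    `|r - r0| < t -> `|x - x0| < t ->
    normc (f (r%:C * expi x) - f (r0%:C * expi x0)) < e.
Proof.
move=> /ccontP cf e e0; have [d d0 hd] := cf e e0.
(* From r e^{ix} - r0 e^{i x0} = (r - r0) e^{ix} + r0 (e^{ix} - e^{i x0}); the added 1 avoids
   division by zero when r0 = 0. *)
have d1 : 0 < d / 2 / (`|r0| + 1) by rewrite !divr_gt0 // ltr_wpDl.
have := @cvg_expi x0 => /cvgCP /(_ _ d1) /nbhs_normP [t t0 ht].
exists (Num.min t (d / 2)); first by rewrite lt_min t0 divr_gt0.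
move=> r x; rewrite !lt_min => /andP[r1 r2] /andP[x1 x2]; apply: hd.
have -> : r%:C * expi x - r0%:C * expi x0 = (r - r0)%:C * expi x + r0%:C * (expi x - expi x0).
  by rewrite rmorphB /=; ring.
apply: (le_lt_trans (normc_triangle _ _)).
rewrite normc_circle normcM normc_real (splitr d); apply: ltr_leD => //.
have h : normc (expi x - expi x0) <= d / 2 / (`|r0| + 1).
  by apply/ltW/ht; rewrite /= distrC.
apply: (le_trans (ler_wpM2l (normr_ge0 _) h)).
rewrite mulrA ler_pdivrMr ?ltr_wpDl //.
by rewrite mulrDr mulr1 mulrC lerDl ltW // divr_gt0.
Qed.

Lemma cont_Re_circle (f : R[i] -> R[i]) (r : R) :
  (forall x, ccont f (r%:C * expi x)) -> continuous (fun x : R => Re (f (r%:C * expi x))).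
Proof.
move=> cf x; apply/cvgrPdist_lt => e e0.
have [t t0 ht] := polar_cont (cf x) e0.
apply/nbhs_normP; exists t => // y /= xy; rewrite distrC -cReB.
by apply: (le_lt_trans (normc_Re _)); apply: ht; rewrite ?subrr ?normr0 // distrC.
Qed.

Lemma cont_Im_circle (f : R[i] -> R[i]) (r : R) :
  (forall x, ccont f (r%:C * expi x)) -> continuous (fun x : R => Im (f (r%:C * expi x))).
Proof.
move=> cf x; apply/cvgrPdist_lt => e e0.
have [t t0 ht] := polar_cont (cf x) e0.
apply/nbhs_normP; exists t => // y /= xy; rewrite distrC -cImB.
by apply: (le_lt_trans (normc_Im _)); apply: ht; rewrite ?subrr ?normr0 // distrC.
Qed.

Definition cexp (z : R[i]) : R[i] := (expR (Re z))%:C * expi (Im z).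

Lemma cvg_ReC (z : R[i]) : (fun w : R[i]^o => Re w) @ (z : R[i]^o) --> Re z.
Proof. exact: (cvg_Re _ (@cvg_id _ (nbhs (z : R[i]^o)))). Qed.
Lemma cvg_ImC (z : R[i]) : (fun w : R[i]^o => Im w) @ (z : R[i]^o) --> Im z.
Proof. exact: (cvg_Im _ (@cvg_id _ (nbhs (z : R[i]^o)))). Qed.

Lemma ccont_Rcomp (k : R -> R) (z : R[i]) : k x @[x --> Re z] --> k (Re z) ->
  ccont (fun w : R[i] => (k (Re w))%:C) z.
Proof.
move=> ck; apply/ccontE.
apply: (@cvg_complex R _ (nbhs (z : R[i]^o)) _ (fun w => k (Re w)) (fun=> 0) _ 0).
  by move=> A /ck h; exact: (@cvg_ReC z _ h).
exact: cvg_cst.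
Qed.

Lemma ccont_Icomp (k l : R -> R) (z : R[i]) : k x @[x --> Im z] --> k (Im z) ->
  l x @[x --> Im z] --> l (Im z) ->
  ccont (fun w : R[i] => k (Im w) +i* l (Im w)) z.
Proof.
move=> ck cl; apply/ccontE.
apply: (@cvg_complex R _ (nbhs (z : R[i]^o)) _ (fun w => k (Im w)) (fun w => l (Im w))).
  by move=> A /ck h; exact: (@cvg_ImC z _ h).
by move=> A /cl h; exact: (@cvg_ImC z _ h).
Qed.

(** The increment splits into a change of the argument at the old modulus and a change of the
    modulus at the new argument; the slopes of [expR], [cos] and [sin] supply the two Cauchy-Riemann
    quotients. *)
Lemma cdiff_cexp z : cdiff cexp z.
Proof.
have [k [hk k0 ck]] := carath1 (is_derive_expR (Re z)).
have [c [hc c0 cc]] := carath1 (is_derive_cos (Im z)).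
have [s [hs s0 cs]] := carath1 (is_derive_sin (Im z)).
apply: (@cdiff_CR R cexp (fun w => (k (Re w))%:C * expi (Im w))
   (fun w => (expR (Re z))%:C * (c (Im w) +i* s (Im w)))).
- move=> w; rewrite /cexp.
  have -> : (k (Re w))%:C * expi (Im w) * (Re w - Re z)%:C = (expR (Re w) - expR (Re z))%:C * expi (Im w).
    by rewrite mulrAC -rmorphM /= -hk.
  have -> : (expR (Re z))%:C * (c (Im w) +i* s (Im w)) * (Im w - Im z)%:C =
     (expR (Re z))%:C * (expi (Im w) - expi (Im z)).
    rewrite -mulrA; congr (_ * _); rewrite /expi; simpc.
    by rewrite -hc -hs.
  by rewrite rmorphB /=; ring.
- apply: ccontM; first exact: ccont_Rcomp.
  by apply: ccont_Icomp; [exact: continuous_cos|exact: continuous_sin].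
- by apply: ccontM; [exact: ccont_cst|exact: ccont_Icomp].
- rewrite k0 c0 s0 mulrCA; congr (_ * _); rewrite /expi; simpc.
  by [].
Qed.

End Expi.

(** * Compactness of an interval and uniform continuity *)

Section Tube.
Context (R : realType).

(** The radii valid near each point are merged by bisection into one that is valid throughout
    [a, b]. *)
Lemma tube (a b : R) (Q : R -> R -> Prop) : a <= b ->
  (forall x0, a <= x0 <= b -> exists2 t : R, 0 < t & forall x s, a <= x <= b ->
     `|x - x0| < t -> `|s| < t -> Q x s) ->
  exists2 t : R, 0 < t & forall x s, a <= x <= b -> `|s| < t -> Q x s.
Proof.
rewrite le_eqVlt => /orP[/eqP <-|ab] loc.
  have [|t t0 ht] := loc a; first by rewrite lexx.
  exists t => // x s hx; apply: ht => //.
  by move: hx; rewrite -eq_le eq_sym => /eqP ->; rewrite subrr normr0.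
(* [rect_ind] is applied to a rectangle of height 1 whose vertical data P ignores; two halves are
   joined by taking the smaller radius. *)
pose P x (y h k : R) := a <= x -> x + h <= b -> exists2 t : R, 0 < t &
  forall x' s, x <= x' <= x + h -> `|s| < t -> Q x' s.
have : P a 0 (b - a) 1.
  apply: (@rect_ind R P) => //; first by rewrite subr_gt0.
  - move=> x y h k P1 P2 _ _ ax xh.
    have [h0|h0] := leP 0 h; last first.
      exists 1 => // x' s /andP[]; lra.
    have [||t1 t10 H1] := P1 => //; first by lra.
    have [||t2 t20 H2] := P2; [by lra..|].
    exists (Num.min t1 t2); first by rewrite lt_min t10.
    move=> x' s /andP[u1 u2]; rewrite lt_min => /andP[s1 s2].
    have [v|/ltW v] := leP x' (x + h / 2).
      by apply: H1 => //; rewrite u1.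
    by apply: H2 => //; rewrite v /=; lra.
  - move=> x0 y0 hx0 hy0.
    have [|t t0 ht] := loc x0; first by lra.
    exists t => // x y n hx _ ht' _ ax xb; exists t => // x' s hx'.
    apply: ht; first by apply/andP; split; lra.
    by apply: le_lt_trans ht'; apply: itv_dist hx'.
by case=> // [|t t0 ht]; [lra|exists t => // x s hx; apply: ht; lra].
Qed.

Lemma unif_cont (a b : R) (f : R -> R) : a <= b -> continuous f ->
  forall e : R, 0 < e -> exists2 t : R, 0 < t & forall x s : R, a <= x <= b -> `|s| < t ->
    `|f (x + s) - f x| < e.
Proof.
move=> ab cf e e0; apply: tube => // x0 _.
have e20 : 0 < e / 2 by rewrite divr_gt0.
have := cf x0 => /cvgrPdist_lt /(_ _ e20) /nbhs_normP [t /= t0 ht].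
exists (t / 2); first by rewrite divr_gt0.
move=> x s _ xt st.
have h1 : `|f x0 - f x| < e / 2 by apply: ht; rewrite /= distrC; move: xt t0; lra.
have h2 : `|f x0 - f (x + s)| < e / 2.
  apply: ht; rewrite /= distrC addrAC (le_lt_trans (ler_normD _ _)) //.
  by rewrite (splitr t) ltrD.
have -> : f (x + s) - f x = (f x0 - f x) - (f x0 - f (x + s)) by ring.
by rewrite (le_lt_trans (ler_normB _ _)) // (splitr e) ltrD.
Qed.

End Tube.

Section MVP.
Context (R : realType).
Local Notation mu := (@lebesgue_measure R).
Local Notation circ := (circle_measure R).
Local Notation pi2 := (2 * pi : R).

Lemma cont_integrable (g : R -> R) (a b : R) : continuous g ->
  mu.-integrable `[a, b] (EFin \o g).
Proof.
move=> cg; apply: continuous_compact_integrable; first exact: segment_compact.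
exact: continuous_subspaceT.
Qed.

Lemma cexpE (r x : R) : 0 < r -> cexp (ln r +i* x) = r%:C * expi x.
Proof. by move=> r0; rewrite /cexp /= lnK. Qed.

(* Goursat's theorem in logarithmic polar coordinates. *)
Lemma circle_integral_eq (f : R[i] -> R[i]) (r1 r2 : R) : 0 < r1 -> r1 < r2 ->
  (forall z, r1 <= normc z <= r2 -> cdiff f z) ->
  \int[mu]_(x in `[0%R, pi2]) Re (f (r1%:C * expi x)) =
  \int[mu]_(x in `[0%R, pi2]) Re (f (r2%:C * expi x)).
Proof.
move=> r10 r12 df.
have r20 := lt_trans r10 r12.
pose g z := f (cexp z).
pose a := ln r1; pose h := ln r2 - ln r1.
have h0 : 0 < h by rewrite subr_gt0 ltr_ln.
have ah : a + h = ln r2 by rewrite /a /h addrC subrK.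
have dg s x : a <= s <= a + h -> cdiff g (s +i* x).
  move=> /andP[s1 s2]; apply: (cdiff_comp (cdiff_cexp _)).
  apply: df; rewrite /cexp normc_circle ger0_norm ?expR_ge0 //=.
  by rewrite -[r1]lnK // -[r2]lnK // !ler_expR s1 -ah s2.
have contU s : a <= s <= a + h -> continuous (fun x => Re (g (s +i* x))).
  move=> hs x; apply/cvgrPdist_lt => e e0.
  have /ccontP /(_ _ e0) [d d0 hd] := cdiff_cont (dg s x hs).
  apply/nbhs_normP; exists d => // y /= xy; rewrite distrC -cReB.
  apply: (le_lt_trans (normc_Re _)); apply: hd.
  by apply: (le_lt_trans (normc_le _)); rewrite /= subrr normr0 add0r distrC.
have contW y s : a <= s <= a + h -> {for s, continuous (fun s => Im (g (s +i* y)))}.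
  move=> hs; apply/cvgrPdist_lt => e e0.
  have /ccontP /(_ _ e0) [d d0 hd] := cdiff_cont (dg s y hs).
  apply/nbhs_normP; exists d => // x /= xy; rewrite distrC -cImB.
  apply: (le_lt_trans (normc_Im _)); apply: hd.
  by apply: (le_lt_trans (normc_le _)); rewrite /= subrr normr0 addr0 distrC.
have := @flux_rect R (fun s x => Re (g (s +i* x))) (fun s x => Im (g (s +i* x))) a h 0 pi2.
rewrite /flux !add0r => F.
have {F} := F _ _ h0 (pi2_gt0 R) _.
(* The two horizontal sides cancel because [cexp] has period 2 pi i; the vertical sides are the
   circles of radii r1 and r2. *)
have -> : \int[mu]_(x in `[a, (a + h)%R]) (Im (g (x +i* pi2)) - Im (g (x +i* 0))) = 0.
  transitivity (\int[mu]_(x in `[a, (a + h)%R]) (0 : R)); last first.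
    by rewrite Rintegral_cst // mul0r.
  apply: eq_Rintegral => x _; rewrite /g /cexp /=.
  by rewrite -[in pi2](add0r pi2) expi_2pi subrr.
rewrite subr0 ah => F.
apply/esym/eqP; rewrite -subr_eq0 -RintegralB //.
- apply/eqP; rewrite -[RHS]F.
  + by apply: eq_Rintegral => x _; rewrite /g !cexpE.
  + by move=> s hs; apply: cont_integrable; apply: contU; rewrite ah.
  + move=> y _; apply: continuous_compact_integrable; first exact: segment_compact.
    apply: continuous_in_subspaceT => s; rewrite inE /= in_itv /= -ah => hs.
    exact: contW.
  + move=> s y; rewrite -ah => hs hy.
    have [phi hphi cphi] := dg s y hs.
    (* Multiplication by the complex slope phi has the real matrix with rows (Re phi, - Im phi) and
       (Im phi, Re phi). *)
    exists (Re (phi (s +i* y))), (- Im (phi (s +i* y))), (Im (phi (s +i* y))) => e e0.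
    have /ccontP /(_ _ e0) [d d0 hd] := cphi.
    exists (d / 2); first by rewrite divr_gt0.
    move=> x' y' _ _ sx yy.
    set z := s +i* y; set w := x' +i* y'.
    have nwz : normc (w - z) <= `|x' - s| + `|y' - y| by apply: le_trans (normc_le _) _.
    have hw : normc (w - z) < d.
      by apply: (le_lt_trans nwz); rewrite (splitr d) ltrD.
    have E : normc (g w - g z - phi z * (w - z)) <= e * (`|x' - s| + `|y' - y|).
      rewrite hphi -mulrBl normcM; apply: ler_pM; rewrite ?normc_ge0 //.
      exact/ltW/hd.
    split.
      apply: le_trans E; apply: le_trans (normc_Re _).
      by rewrite !cReB cReM /= le_eqVlt; apply/orP; left; apply/eqP; congr (`|_|); ring.
    apply: le_trans E; apply: le_trans (normc_Im _).
    by rewrite !cImB cImM /= le_eqVlt; apply/orP; left; apply/eqP; congr (`|_|); ring.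
- by apply: cont_integrable; have := contU (ln r2); rewrite /g; under eq_fun do rewrite cexpE //; apply; rewrite -ah; lra.
- by apply: cont_integrable; have := contU (ln r1); rewrite /g; under eq_fun do rewrite cexpE //; apply; rewrite -/a; lra.
Qed.

End MVP.

Section MeanValue.
Context (R : realType).
Local Notation mu := (@lebesgue_measure R).
Local Notation circ := (circle_measure R).
Local Notation pi2 := (2 * pi : R).

Lemma Rintegral_circle_cont (g : R -> R) : continuous g ->
  \int[circ]_x g x = pi2^-1 * \int[mu]_(x in `[0%R, pi2]) g x.
Proof.
move=> cg; apply: Rintegral_circle; last exact: cont_integrable.
exact: continuous_measurable_fun.
Qed.

Definition disc_cont (f : R[i] -> R[i]) (R0 : R) :=
  forall z, normc z < R0 -> ccont f z.

Lemma disc_cont_circle f R0 r : disc_cont f R0 -> `|r| < R0 ->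
  forall x, ccont f (r%:C * expi x).
Proof. by move=> cf r0 x; apply: cf; rewrite normc_circle. Qed.

Lemma circle_mean_cont f R0 (r0 : R) : disc_cont f R0 -> `|r0| < R0 ->
  forall e : R, 0 < e -> exists2 t : R, 0 < t & forall r, `|r| < R0 -> `|r - r0| < t ->
    `|\int[mu]_(x in `[0%R, pi2]) Re (f (r%:C * expi x))
      - \int[mu]_(x in `[0%R, pi2]) Re (f (r0%:C * expi x))| < e.
Proof.
move=> cf r0R e e0.
have p0 := pi2_gt0 R.
have e1 : 0 < e / 2 / pi2 by rewrite !divr_gt0.
have [|x0 hx0|t t0 ht] := @tube R 0 pi2 (fun x s => `|Re (f ((r0 + s)%:C * expi x)) - Re (f (r0%:C * expi x))| <= e / 2 / pi2).
- exact: ltW.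
- have e2 : 0 < e / 2 / pi2 / 2 by rewrite divr_gt0.
  have [t t0 ht] := polar_cont (disc_cont_circle cf r0R x0) e2.
  exists t => // x s _ hx hs.
  have h1 := ht (r0 + s) x; rewrite [r0 + s]addrC addrK in h1.
  have h2 := ht r0 x; rewrite subrr normr0 in h2.
  rewrite -cReB; apply: (le_trans (normc_Re _)).
  rewrite [r0 + s]addrC.
  have -> : f ((s + r0)%:C * expi x) - f (r0%:C * expi x) =
     (f ((s + r0)%:C * expi x) - f (r0%:C * expi x0)) - (f (r0%:C * expi x) - f (r0%:C * expi x0)) by ring.
  apply: (le_trans (normc_triangle _ _)); rewrite normcN (splitr (e / 2 / pi2)).
  by apply: lerD; apply: ltW; [exact: h1|exact: h2].
exists t => // r rR rt.
have cr := cont_Re_circle (disc_cont_circle cf rR).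
have cr0 := cont_Re_circle (disc_cont_circle cf r0R).
rewrite -RintegralB //; try exact: cont_integrable.
have -> : e = e / 2 / pi2 * (pi2 - 0) + e / 2 by rewrite subr0 divfK ?gt_eqF // -splitr.
rewrite ltr_pwDr ?divr_gt0 //.
have := @Rintegral_near_cst R (fun x => Re (f (r%:C * expi x)) - Re (f (r0%:C * expi x))) 0 pi2 0 (e / 2 / pi2).
rewrite mul0r subr0; apply; first exact: ltW.
  by apply: cont_integrable => x; apply: cvgB; [exact: cr|exact: cr0].
move=> x hx; rewrite subr0.
by have := ht x (r - r0) hx rt; rewrite [r0 + _]addrC subrK.
Qed.

(** The exceptions at 0 and on |z| = rho accommodate difference quotients, for which only continuity
    is known there. Goursat's theorem makes the circle means constant on each side of rho, and their
    continuity in the radius carries the value across rho and down to radius 0. A negative rho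
    stands for no exceptional circle. *)
Lemma mean_value_int f R0 rho r : disc_cont f R0 ->
  (forall z, normc z < R0 -> z != 0 -> normc z != rho -> cdiff f z) ->
  0 <= r < R0 ->
  \int[mu]_(x in `[0%R, pi2]) Re (f (r%:C * expi x)) = pi2 * Re (f 0).
Proof.
move=> cf df hr.
pose M r := \int[mu]_(x in `[0%R, pi2]) Re (f (r%:C * expi x)).
have M0 : M 0 = pi2 * Re (f 0).
  rewrite /M; transitivity (\int[mu]_(x in `[0%R, pi2]) (Re (f 0) : R)).
    by apply: eq_Rintegral => x _; rewrite mul0r.
  rewrite Rintegral_cst //.
  have := @lebesgue_measure_itv R `[0, pi2]; rewrite /= lte_fin pi2_gt0 => e1.
  by rewrite [X in fine X]e1 /= subr0 mulrC.
have const r1 r2 : 0 < r1 -> r1 < r2 -> r2 < R0 -> (rho < r1) || (r2 < rho) -> M r1 = M r2.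
  move=> r10 r12 r2R hrho; apply: circle_integral_eq => // z /andP[z1 z2].
  have z0 : 0 < normc z by exact: lt_le_trans z1.
  apply: df; [exact: le_lt_trans r2R|by rewrite -normc_gt0|].
  case/orP: hrho => h; first by rewrite gt_eqF // (lt_le_trans h).
  by rewrite lt_eqF // (le_lt_trans z2).
have lim r0 c : 0 <= r0 < R0 -> (forall t, 0 < t -> exists r, [/\ 0 <= r < R0, `|r - r0| < t & M r = c]) -> M r0 = c.
  move=> /andP[r00 r0R] H; apply/eqP; rewrite -subr_eq0 -normr_le0; apply/ler_addgt0Pl => e e0.
  have r0R' : `|r0| < R0 by rewrite ger0_norm.
  have [t t0 ht] := circle_mean_cont cf r0R' e0.
  have [r' [/andP[r'0 r'R] r't <-]] := H t t0.
  by rewrite addr0 distrC ltW //; apply: ht => //; rewrite ger0_norm.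
have R00 : 0 < R0 by case/andP: hr; exact: le_lt_trans.
have A r0 : 0 < r0 -> r0 < R0 -> (rho <= 0) || (r0 < rho) -> M 0 = M r0.
  move=> h1 h2 h3; apply: lim; first by rewrite lexx.
  move=> t t0; exists (Num.min t r0 / 2).
  have m0 : 0 < Num.min t r0 by rewrite lt_min t0.
  have [m1 m2] : Num.min t r0 <= t /\ Num.min t r0 <= r0 by rewrite !ge_min !lexx orbT.
  split.
  - by apply/andP; split; lra.
  - by rewrite subr0 gtr0_norm; lra.
  - apply: const => //; [lra|lra|].
    by case/orP: h3 => h3; apply/orP; [left; lra|right].
have [/andP[r0 rR]] := (hr, tt).
rewrite -/(M r) -M0; move: r0; rewrite le_eqVlt => /orP[/eqP <- //|r0].
have [hrho|rho0] := leP rho 0; first by rewrite (A r) // hrho.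
have B : rho < R0 -> M rho = M 0.
  move=> rhoR; apply: lim; first by rewrite ltW.
  move=> t t0; exists (rho - Num.min t rho / 2).
  have m0 : 0 < Num.min t rho by rewrite lt_min t0.
  have [m1 m2] : Num.min t rho <= t /\ Num.min t rho <= rho by rewrite !ge_min !lexx orbT.
  split.
  - by apply/andP; split; lra.
  - by rewrite addrC addKr normrN gtr0_norm; lra.
  - by symmetry; apply: A; [lra|lra|apply/orP; right; lra].
have [rr|rr|rr] := ltgtP r rho.
- by rewrite (A r) // rr orbT.
- rewrite -B; last lra.
  symmetry; apply: lim; first by apply/andP; split; lra.
  move=> t t0; exists (rho + Num.min t (r - rho) / 2).
  have m0 : 0 < Num.min t (r - rho) by rewrite lt_min t0 subr_gt0.
  have [m1 m2] : Num.min t (r - rho) <= t /\ Num.min t (r - rho) <= r - rho by rewrite !ge_min !lexx orbT.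
  split.
  - by apply/andP; split; lra.
  - by rewrite addrC addKr gtr0_norm; lra.
  - by apply: const => //; [lra|lra|apply/orP; left; lra].
- by rewrite rr B // -rr.
Qed.

Lemma mean_value_Re f R0 rho r : disc_cont f R0 ->
  (forall z, normc z < R0 -> z != 0 -> normc z != rho -> cdiff f z) ->
  0 <= r < R0 -> \int[circ]_x Re (f (r%:C * expi x)) = Re (f 0).
Proof.
move=> cf df hr; rewrite Rintegral_circle_cont.
  by rewrite (mean_value_int cf df hr) mulrA mulVf ?mul1r // gt_eqF // pi2_gt0.
apply: cont_Re_circle; apply: (disc_cont_circle cf).
by case/andP: hr => r0 ?; rewrite ger0_norm.
Qed.

Lemma mean_value_Im f R0 rho r : disc_cont f R0 ->
  (forall z, normc z < R0 -> z != 0 -> normc z != rho -> cdiff f z) ->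
  0 <= r < R0 -> \int[circ]_x Im (f (r%:C * expi x)) = Im (f 0).
Proof.
move=> cf df hr.
have E z : Re (z * (0 -i* 1)) = Im z by case: z => a b; simpc.
have -> : Im (f 0) = Re (f 0 * (0 -i* 1)) by rewrite E.
rewrite -(@mean_value_Re (fun z => f z * (0 -i* 1)) R0 rho r) //.
- by apply: eq_Rintegral => x _; rewrite E.
- by move=> z zR; apply: ccontM; [exact: cf|exact: ccont_cst].
- by move=> z h1 h2 h3; apply: cdiffM; [exact: df|exact: cdiff_cst].
Qed.

End MeanValue.

(** * Mean values in the Smirnov class *)

Section LogMean.
Context (R : realType).
Local Notation mu := (@lebesgue_measure R).
Local Notation circ := (circle_measure R).
Local Notation pi2 := (2 * pi : R).

Lemma max_dist (c a b : R) : `|Num.max c a - Num.max c b| <= `|a - b|.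
Proof.
have h1 := ler_norm (a - b); have h2 := ler_norm (b - a); rewrite distrC in h2.
by case: (leP c a) => ?; case: (leP c b) => ?; rewrite ler_norml; apply/andP; split; lra.
Qed.

Lemma cvg_maxr (T : Type) (F : set_system T) (FF : Filter F) (g : T -> R) (c l : R) :
  g @ F --> l -> (fun t => Num.max c (g t)) @ F --> Num.max c l.
Proof.
move=> /cvgrPdist_lt h; apply/cvgrPdist_lt => e e0.
by apply: filterS (h e e0) => t; apply: le_lt_trans (max_dist _ _ _).
Qed.

Lemma normc_dist (z w : R[i]) : `|normc z - normc w| <= normc (z - w).
Proof.
have h1 := normc_triangle w (z - w); have h2 := normc_triangle z (w - z).
rewrite addrC subrK in h1; rewrite addrC subrK normcB in h2.
by rewrite ler_norml; apply/andP; split; lra.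
Qed.

Lemma cvg_normc_circle (f : R[i] -> R[i]) (r : R) :
  (forall x, ccont f (r%:C * expi x)) -> continuous (fun x : R => normc (f (r%:C * expi x))).
Proof.
move=> cf x; apply/cvgrPdist_lt => e e0.
have [t t0 ht] := polar_cont (cf x) e0.
apply/nbhs_normP; exists t => // y /= xy; rewrite distrC.
by apply: (le_lt_trans (normc_dist _ _)); apply: ht; rewrite ?subrr ?normr0 // distrC.
Qed.

(** Uniformity in the base point x over one mesh interval is what counts: [log_mean] needs the same
    n for a whole arc of rotated sample points. *)
Lemma riemann_sum (L : R -> R) : continuous L -> forall e : R, 0 < e ->
  exists N : nat, forall n x, (N <= n)%N -> (0 < n)%N -> 0 <= x <= pi2 / n%:R ->
  `|(n%:R)^-1 * \sum_(k < n) L (x + k%:R * (pi2 / n%:R)) - \int[circ]_x L x| <= e.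
Proof.
move=> cL e e0; have p0 := pi2_gt0 R.
have [t t0 ht] := @unif_cont R 0 pi2 L (ltW p0) cL e e0.
exists (Num.trunc (pi2 / t)).+1 => n x nN n0 /andP[x0 xh].
have nR : 0 < n%:R :> R by rewrite ltr0n.
set h := pi2 / n%:R.
have h0 : 0 < h by rewrite divr_gt0.
have hn : n%:R * h = pi2 by rewrite /h mulrC divfK // gt_eqF.
have ht' : h < t.
  have : pi2 / t < n%:R.
    by apply: (lt_le_trans (truncnS_gt (pi2 / t))); rewrite ler_nat.
  by rewrite ltr_pdivrMr // => ?; rewrite /h ltr_pdivrMr // [t * _]mulrC.
have iL a b : mu.-integrable `[a, b] (EFin \o L) by exact: cont_integrable.
have main k : (k <= n)%N -> `|\int[mu]_(x in `[0%R, (k%:R * h)%R]) L x - \sum_(j < k) L (x + j%:R * h) * h| <= e * (k%:R * h).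
  elim: k => [_|k IH kn].
    by rewrite mul0r big_ord0 subr0 mulr0 set_itv1 Rintegral_set1 normr0.
  have k0 : 0 <= k%:R * h by rewrite mulr_ge0 // ltW.
  have kS : k.+1%:R * h = k%:R * h + h by rewrite -natr1 mulrDl mul1r.
  rewrite (@Rintegral_itv_split _ _ 0 (k%:R * h) (k.+1%:R * h)) //; last by rewrite kS lerDl ltW.
  rewrite big_ord_recr /= opprD addrACA kS [e * _]mulrDr.
  apply: (le_trans (ler_normD _ _)); apply: lerD; first exact/IH/ltnW.
  have := @Rintegral_near_cst R L (k%:R * h) (k%:R * h + h) (L (x + k%:R * h)) e.
  have -> : k%:R * h + h - k%:R * h = h by ring.
  apply => //; first by rewrite lerDl ltW.
  move=> y /andP[y1 y2].
  have khn : k.+1%:R * h <= pi2 by rewrite -hn ler_pM2r // ler_nat.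
  have xk : 0 <= x + k%:R * h <= pi2.
    by rewrite addr_ge0 //= (le_trans _ khn) // kS addrC lerD2l.
  have := ht (x + k%:R * h) (y - (x + k%:R * h)) xk _.
  have -> : x + k%:R * h + (y - (x + k%:R * h)) = y by rewrite addrC subrK.
  move=> H; apply/ltW/H.
  apply: le_lt_trans ht'; rewrite ler_norml; move: xh; rewrite -/h => xh; apply/andP; split; lra.
have := main n (leqnn n); rewrite hn => H.
rewrite Rintegral_circle_cont //.
have -> : n%:R^-1 * \sum_(k < n) L (x + k%:R * h) = pi2^-1 * \sum_(j < n) L (x + j%:R * h) * h.
  rewrite -mulr_suml mulrCA mulrC; congr (_ * _).
  by rewrite /h mulrA mulVf ?mul1r // gt_eqF.
rewrite -mulrBr normrM gtr0_norm ?invr_gt0 //.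
by rewrite mulrC ler_pdivrMr // distrC.
Qed.

Lemma expi_natM (k : nat) (x : R) : expi (k%:R * x) = expi x ^+ k.
Proof.
elim: k => [|k IH]; first by rewrite mul0r expi0 expr0.
by rewrite -natr1 mulrDl mul1r expiD IH exprSr.
Qed.

(* The product of the rotates of f by n-th roots of unity is analytic, with value
   f(0)^n at the origin, so the mean value property bounds |f(0)|^n by the
   maximum of that product on the circle; its logarithm is a Riemann sum. *)
Lemma log_mean f R0 rho (r c : R) : disc_cont f R0 ->
  (forall z, normc z < R0 -> z != 0 -> normc z != rho -> cdiff f z) ->
  0 <= r < R0 -> 0 < c -> 0 < normc (f 0) ->
  ln (normc (f 0)) <= \int[circ]_x ln (Num.max c (normc (f (r%:C * expi x)))).
Proof.
move=> cf df hr c0 f0; have p0 := pi2_gt0 R.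
have rR : `|r| < R0 by case/andP: hr => r0 ?; rewrite ger0_norm.
(* The floor c > 0 keeps the logarithm continuous through zeros of f on the circle. *)
pose L x := ln (Num.max c (normc (f (r%:C * expi x)))).
have m0 x : 0 < Num.max c (normc (f (r%:C * expi x))) by rewrite lt_max c0.
have cL : continuous L.
  move=> x.
  suff cM : (fun x => Num.max c (normc (f (r%:C * expi x)))) @ x --> Num.max c (normc (f (r%:C * expi x))).
    by move=> A /(continuous_ln (m0 x)) hA; exact: (cM _ hA).
  apply: cvg_maxr; apply: cvg_normc_circle; exact: (disc_cont_circle cf rR).
set I := \int[circ]_x _.
apply/ler_addgt0Pr => e e0.
have e20 : 0 < e / 2 by rewrite divr_gt0.
have [N hN] := riemann_sum cL e20.
(* Besides a Riemann error of at most e / 2, this n makes (ln 2) / n at most e / 2: a factor 2 is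
   lost in |P(0)| <= |Re P(0)| + |Im P(0)|. *)
pose n := (maxn N (Num.trunc (ln 2 / (e / 2)))).+1.
have n0 : 0 < n%:R :> R by rewrite ltr0n.
have nN : (N <= n)%N by rewrite /n leqW // leq_maxl.
have n2 : ln 2 <= n%:R * (e / 2).
  rewrite -ler_pdivrMr //; apply/ltW/(lt_le_trans (truncnS_gt (ln 2 / (e / 2)))).
  by rewrite ler_nat /n ltnS leq_maxr.
set h := pi2 / n%:R.
have h0 : 0 < h by rewrite divr_gt0.
have hn : n%:R * h = pi2 by rewrite /h mulrC divfK // gt_eqF.
pose P z := \prod_(k < n) f (expi h ^+ k * z).
have nw k : normc (expi h ^+ k) = 1 by rewrite -expi_natM normc_expi.
have wn : expi h ^+ n = 1.
  by rewrite -expi_natM hn -[pi2]add0r expi_2pi expi0.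
(* Rotation by 2 pi / n permutes the factors, so a bound on P over a single arc propagates around
   the circle. *)
have Prot z : P (expi h * z) = P z.
  rewrite /P /n big_ord_recr [RHS]big_ord_recl /= mulrC; congr (_ * _).
    by rewrite mulrA -exprSr wn mul1r ?expr0 ?mul1r.
  by apply: eq_bigr => k _; rewrite mulrA -exprSr.
have P0 : P 0 = f 0 ^+ n.
  by rewrite /P; under eq_bigr do rewrite mulr0; rewrite prodr_const card_ord.
have normprod (s : nat) (u : nat -> R[i]) : normc (\prod_(k < s) u k) = \prod_(k < s) normc (u k).
  elim: s => [|s IH]; first by rewrite !big_ord0 normc1.
  by rewrite !big_ord_recr normcM IH.
set S := expR (n%:R * (I + e / 2)).
have bd x : 0 <= x <= h -> normc (P (r%:C * expi x)) <= S.
  move=> hx; have n0' : (0 < n)%N by [].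
  have := hN n x nN n0' hx; rewrite ler_norml => /andP[_ H].
  rewrite /P (normprod n (fun k => f (expi h ^+ k * (r%:C * expi x)))).
  apply: (@le_trans _ _ (\prod_(k < n) expR (L (x + k%:R * h)))).
    apply: ler_prod => k _; rewrite normc_ge0 /= lnK ?posrE //.
    have -> : expi h ^+ k * (r%:C * expi x) = r%:C * expi (x + k%:R * h).
      by rewrite expiD expi_natM; ring.
    by rewrite le_max lexx orbT.
  rewrite -expR_sum ler_expR -ler_pdivrMl //.
  by move: H; rewrite -/h -/I lerBlDl addrC.
have bd' k x : (k <= n)%N -> 0 <= x <= k%:R * h -> normc (P (r%:C * expi x)) <= S.
  elim: k x => [|k IH] x kn /andP[x0 xk].
    by apply: bd; rewrite x0 (le_trans xk) // mul0r ltW.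
  have [xh|/ltW xh] := leP x h; first by apply: bd; rewrite x0.
  have -> : r%:C * expi x = expi h * (r%:C * expi (x - h)).
    by rewrite mulrCA -expiD addrC subrK.
  rewrite Prot; apply: IH; first exact: ltnW.
  by rewrite subr_ge0 xh /= lerBlDr -[X in _ + X]mul1r -mulrDl natr1.
have cP : disc_cont P R0.
  move=> z zR; apply: ccont_prod => k; apply: (@ccont_comp _ f (fun z => expi h ^+ k * z)).
    by apply: ccontM; [exact: ccont_cst|exact: ccont_id].
  by apply: cf; rewrite normcM nw mul1r.
have dP z : normc z < R0 -> z != 0 -> normc z != rho -> cdiff P z.
  move=> zR z0 zr; apply: cdiff_prod => k; apply: (@cdiff_comp _ f (fun z => expi h ^+ k * z)).
    by apply: cdiffM; [exact: cdiff_cst|exact: cdiff_id].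
  by apply: df; rewrite ?normcM ?nw ?mul1r // mulf_neq0 // expf_neq0 // expi_neq0.
have bdint (g : R[i] -> R) : continuous (fun x => g (P (r%:C * expi x))) -> (forall z, `|g z| <= normc z) ->
    `|\int[circ]_x g (P (r%:C * expi x))| <= S.
  move=> cg gle; rewrite Rintegral_circle_cont // normrM gtr0_norm ?invr_gt0 //.
  have := @Rintegral_near_cst R (fun x => g (P (r%:C * expi x))) 0 pi2 0 S.
  rewrite mul0r !subr0 => H.
  rewrite mulrC ler_pdivrMr //; apply: H; first exact: ltW.
    exact: cont_integrable.
  move=> x hx; rewrite subr0; apply: (le_trans (gle _)).
  by apply: (@bd' n) => //; rewrite hn.
have HRe : `|Re (P 0)| <= S.
  rewrite -(mean_value_Re cP dP hr); apply: (bdint (fun z => Re z)); last exact: normc_Re.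
  exact: (cont_Re_circle (disc_cont_circle cP rR)).
have HIm : `|Im (P 0)| <= S.
  rewrite -(mean_value_Im cP dP hr); apply: (bdint (fun z => Im z)); last exact: normc_Im.
  exact: (cont_Im_circle (disc_cont_circle cP rR)).
have normX (z : R[i]) (m : nat) : normc (z ^+ m) = normc z ^+ m.
  by elim: m => [|m IH]; rewrite ?expr0 ?normc1 // !exprS normcM IH.
have H2S : normc (f 0) ^+ n <= 2 * S.
  rewrite -normX -P0; apply: (le_trans (normc_le _)).
  by rewrite mulr2n mulrDl mul1r lerD.
have : ln (normc (f 0) ^+ n) <= ln (2 * S).
  by rewrite ler_ln ?posrE ?mulr_gt0 ?exprn_gt0 // expR_gt0.
rewrite lnXn // lnM ?posrE ?expR_gt0 // expRK -[_ *+ n]mulr_natl => H.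
have : n%:R * ln (normc (f 0)) <= n%:R * (I + e).
  apply: (le_trans H); rewrite [X in _ <= X]mulrDr.
  have -> : n%:R * e = n%:R * (e / 2) + n%:R * (e / 2) by rewrite -mulrDr -splitr.
  by rewrite mulrDr addrCA lerD2l lerD2r.
by rewrite ler_pM2l.
Qed.

End LogMean.

(** * A reversed Fatou lemma with convergent majorants *)

Section RevFatou.
Context (R : realType).
Local Notation circ := (circle_measure R).
Implicit Types g h : measurableTypeR R -> R.

Lemma limn_einf_ge (u : (\bar R)^nat) (a : R) :
  (forall e : R, 0 < e -> \forall n \near \oo, ((a - e)%:E <= u n)%E) -> (a%:E <= limn_einf u)%E.
Proof.
move=> H; rewrite limn_einf_lim; apply/lee_addgt0Pr => e e0.
rewrite -leeBlDr // -EFinB.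
have [N _ hN] := H e e0.
apply: lime_ge; first exact: is_cvg_einfs.
exists N => // n /= Nn; apply: le_ereal_inf_tmp => _ [k /= nk <-].
by apply: hN => /=; exact: leq_trans nk.
Qed.

Lemma limn_einf_le (u : (\bar R)^nat) (v : R^nat) (a : R) :
  (forall n, u n <= (v n)%:E)%E -> v @ \oo --> a -> (limn_einf u <= a%:E)%E.
Proof.
move=> H cv; rewrite limn_einf_lim.
have cE : (fun n => (v n)%:E) @ \oo --> a%:E by apply/fine_cvgP; split => //; exact: nearW.
rewrite -(cvg_lim _ cE) //; apply: lee_lim.
- exact: is_cvg_einfs.
- by apply/cvg_ex; exists a%:E.
- apply: nearW => n; apply: le_trans (H n).
  by apply: ereal_inf_lbound; exists n => /=.
Qed.

(** Fatou's lemma for [hn - gn]. The majorants may vary with n as long as their integrals converge,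
    and for [gn] an asymptotic upper bound by g replaces convergence. *)
Lemma reverse_fatou g h (gn hn : nat -> measurableTypeR R -> R) (l : R) :
  (forall n, circ.-integrable setT (EFin \o gn n)) ->
  (forall n, circ.-integrable setT (EFin \o hn n)) ->
  circ.-integrable setT (EFin \o g) ->
  circ.-integrable setT (EFin \o h) ->
  (forall n x, gn n x <= hn n x) ->
  {ae circ, forall x, hn n x @[n --> \oo] --> h x} ->
  {ae circ, forall x, forall e : R, 0 < e -> \forall n \near \oo, gn n x <= g x + e} ->
  (\int[circ]_x hn n x) @[n --> \oo] --> \int[circ]_x h x ->
  (forall n, l <= \int[circ]_x gn n x) -> l <= \int[circ]_x g x.
Proof.
move=> ign ihn ig ih gh ch cg cint hl.
pose k n x := (hn n x - gn n x)%:E.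
have ik n : circ.-integrable setT (k n) by exact: (integrableB _ (ihn n) (ign n)).
have k0 n x : (0 <= k n x)%E by rewrite lee_fin subr_ge0.
have F := @fatou _ _ R circ setT measurableT k (fun n => measurable_int _ (ik n)) (fun n x _ => k0 n x).
have up : (limn_einf (fun n => \int[circ]_x k n x) <= (\int[circ]_x h x - l)%:E)%E.
  apply: (@limn_einf_le _ (fun n => \int[circ]_x hn n x - l)).
    move=> n; rewrite -(fineK (integrable_fin_num measurableT (ik n))) lee_fin.
    rewrite -[fine _]/(\int[circ]_x (hn n x - gn n x)) RintegralB //.
    by rewrite lerB.
  by apply: cvgB => //; exact: cvg_cst.
have ihg : circ.-integrable setT (EFin \o (fun x => h x - g x)) by exact: (integrableB _ ih ig).
have lo : ((\int[circ]_x (h x - g x))%:E <= \int[circ]_x limn_einf (k ^~ x))%E.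
  (* h - g may take negative values; its positive part makes the almost everywhere comparison of
     nonnegative functions applicable. *)
  pose d x : \bar R := (h x - g x)%:E.
  apply: (@le_trans _ _ (\int[circ]_x (d^\+ x))%E).
    have -> : (\int[circ]_x (h x - g x))%:E = (\int[circ]_x (h x - g x)%:E)%E.
      by rewrite fineK //; exact: (integrable_fin_num measurableT ihg).
    rewrite integralE; apply: geeDl; rewrite leeNl oppe0.
    exact: integral_ge0.
  apply: ae_ge0_le_integral => //.
  - exact: (measurable_funepos (measurable_int _ ihg)).
  - move=> x _; apply: le_trans (_ : (0%:E <= _)%E) => //; apply: limn_einf_ge => e e0.
    by apply: nearW => n; rewrite (le_trans _ (k0 n x)) // lee_fin sub0r oppr_le0 ltW.
  - have -> : (fun x => limn_einf (k ^~ x)) = (fun x => - limn_esup (fun n => - k n x))%E by [].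
    apply: measurableT_comp => //; apply: measurable_fun_limn_esup => n.
    by apply: measurableT_comp => //; exact: (measurable_int _ (ik n)).
  - apply: filterS2 ch cg => x cx gx _; rewrite funeposE /d ge_max; apply/andP; split.
      apply: limn_einf_ge => e e0.
      have e20 : 0 < e / 2 by rewrite divr_gt0.
      move/cvgrPdist_lt : cx => /(_ _ e20) cx.
      apply: filterS2 (cx) (gx _ e20) => n c1 c2.
      rewrite /k lee_fin; move: c1; rewrite ltr_norml => /andP[c11 c12].
      by move: c2 c11 c12; lra.
    apply: limn_einf_ge => e e0.
    by apply: nearW => n; rewrite (le_trans _ (k0 n x)) // lee_fin sub0r oppr_le0 ltW.
have := le_trans lo (le_trans F up).
by rewrite lee_fin RintegralB // => ?; lra.
Qed.

End RevFatou.

(** * From logarithmic means to means of boundary values *)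

Section HardyMean.
Context (R : realType).
Local Notation circ := (circle_measure R).
Local Notation T := (measurableTypeR R).

(** Fatou's lemma and dominated convergence act along sequences. The shift by 2 keeps every radius
    strictly between 0 and 1. *)
Definition rseq (n : nat) : R := 1 - n.+2%:R^-1.

Lemma rseq_ge0 n : 0 <= rseq n.
Proof. by rewrite subr_ge0 invf_le1 // ler1n. Qed.

Lemma rseq_lt1 n : rseq n < 1.
Proof. by rewrite gtrBl invr_gt0. Qed.

Lemma cvg_rseq : rseq n @[n --> \oo] --> (1 : R).
Proof.
rewrite -[X in _ --> X]subr0; apply: cvgB; first exact: cvg_cst.
by have := @cvg_harmonic R; rewrite -(cvg_shiftn 1) => h; under eq_fun do rewrite -addn1.
Qed.

Lemma meas_normc (f : T -> R[i]) : measurable_fun setT (fun x => Re (f x)) ->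
  measurable_fun setT (fun x => Im (f x)) -> measurable_fun setT (fun x => normc (f x)).
Proof.
move=> mr mi.
have -> : (fun x => normc (f x)) = (fun x => Num.sqrt (Re (f x) ^+ 2 + Im (f x) ^+ 2)).
  by apply/funext => x; case: (f x).
have ms : measurable_fun [set: T] (@Num.sqrt R : T -> T).
  by apply: continuous_measurable_fun; exact: sqrt_continuous.
by apply: (measurableT_comp ms); apply: measurable_funD; exact: measurable_funX.
Qed.

Lemma meas_lnmax (f : T -> R) (c : R) : measurable_fun setT f ->
  measurable_fun setT (fun x => ln (Num.max c (f x))).
Proof.
move=> mf; apply: measurableT_comp; first exact: measurable_ln.
by apply: measurable_maxr => //; exact: measurable_cst.
Qed.

Lemma meas_circle_Re (f : R[i] -> R[i]) (r : R) : (forall x, ccont f (r%:C * expi x)) ->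
  measurable_fun [set: T] (fun x : T => Re (f (r%:C * expi x))).
Proof. by move=> cf; apply: continuous_measurable_fun; exact: cont_Re_circle. Qed.

Lemma meas_circle_Im (f : R[i] -> R[i]) (r : R) : (forall x, ccont f (r%:C * expi x)) ->
  measurable_fun [set: T] (fun x : T => Im (f (r%:C * expi x))).
Proof. by move=> cf; apply: continuous_measurable_fun; exact: cont_Im_circle. Qed.

Lemma circle_cst_integrable (c : R) : circ.-integrable setT (EFin \o (fun=> c)).
Proof. by apply: (circle_integrable (M := `|c|)) => //. Qed.

Lemma Rintegral_circle_cst (c : R) : \int[circ]_x c = c.
Proof. by rewrite Rintegral_cst // circle_mass mulr1. Qed.

Lemma circle_cont_integrable (g : R -> R) : continuous g -> circ.-integrable [set: T] (EFin \o g).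
Proof.
move=> cg; have mg : measurable_fun [set: T] (g : T -> R) by exact: continuous_measurable_fun.
have mE : measurable_fun [set: T] (EFin \o (g : T -> R)) by exact/measurable_EFinP.
apply/integrableP; split => //.
rewrite integral_circle_ge0 //; last exact: measurableT_comp.
have /integrableP[_ h] : (@lebesgue_measure R).-integrable `[0, 2 * pi] (EFin \o g).
  exact: cont_integrable.
by apply: lte_mul_pinfty => //; rewrite lee_fin invr_ge0 ltW // pi2_gt0.
Qed.

Lemma circ_integrableD (f g : T -> R) : circ.-integrable setT (EFin \o f) ->
  circ.-integrable setT (EFin \o g) -> circ.-integrable setT (EFin \o (fun x => f x + g x)).
Proof. by move=> h1 h2; exact: (integrableD _ h1 h2). Qed.

Lemma cvg_addn (u : nat -> R) (l : R) (n0 : nat) :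
  u n @[n --> \oo] --> l -> u (n + n0)%N @[n --> \oo] --> l.
Proof. by rewrite -(cvg_shiftn n0 u _). Qed.

Lemma ln_lower (N : R) (z : R[i]) : 0 < N -> 2 * normc z <= N ->
  0 < normc (1 + (N^-1)%:C * z) /\
  Re z - 2 * Re z ^+ 2 / N <= N * ln (normc (1 + (N^-1)%:C * z)).
Proof.
move=> N0 zN; set s := Re z / N.
have hs : - 2^-1 <= s.
  rewrite /s ler_pdivlMr //; have := normc_Re z; rewrite ler_norml => /andP[h _].
  by apply: le_trans h; rewrite mulNr lerN2 mulrC ler_pdivlMr // mulrC.
have s1 : 0 < 1 + s by lra.
have ht : 1 + s <= normc (1 + (N^-1)%:C * z).
  have := normc_Re (1 + (N^-1)%:C * z); rewrite cReD cReM /= mul0r subr0 mulrC -/s.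
  by apply: le_trans; rewrite ler_norm.
have t0 := lt_le_trans s1 ht; split => //.
have l1 : s - 2 * s ^+ 2 <= ln (1 + s).
  have -> : ln (1 + s) = - ln ((1 + s)^-1) by rewrite lnV ?posrE // opprK.
  have h : ln ((1 + s)^-1) <= (1 + s)^-1 - 1.
    rewrite -[X in ln X](subrK 1) addrC; apply: le_ln1Dx.
    by rewrite ltrBrDl subrr invr_gt0.
  rewrite lerNr; apply: (le_trans h).
  rewrite -(ler_pM2r s1) mulrBl mulVf ?gt_eqF // mul1r -subr_ge0.
  have -> : - (s - 2 * s ^+ 2) * (1 + s) - (1 - (1 + s)) = s ^+ 2 * (1 + 2 * s) by ring.
  by rewrite mulr_ge0 ?sqr_ge0 //; lra.
have -> : Re z - 2 * Re z ^+ 2 / N = N * (s - 2 * s ^+ 2).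
  by rewrite /s; field; rewrite gt_eqF.
rewrite ler_pM2l //; apply: (le_trans l1).
by rewrite ler_ln ?posrE.
Qed.

Lemma ln_upper (N : R) (z : R[i]) : 0 < N -> 2 * normc z <= N ->
  N * ln (Num.max 2^-1 (normc (1 + (N^-1)%:C * z))) <= Re z + normc z ^+ 2 / (2 * N).
Proof.
move=> N0 zN; set t := normc _.
have h2 : 2^-1 <= t.
  have := normc_triangle (1 + (N^-1)%:C * z) (- ((N^-1)%:C * z)).
  rewrite addrK normc1 normcN normcM normc_real gtr0_norm ?invr_gt0 // -/t.
  have : N^-1 * normc z <= 2^-1.
    by rewrite mulrC ler_pdivrMr // mulrC ler_pdivlMr // mulrC.
  by move=> ? ?; lra.
have t0 : 0 < t by apply: lt_le_trans h2; rewrite invr_gt0.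
have -> : Num.max 2^-1 t = t by apply/max_idPr.
have l2 : ln (t ^+ 2) <= 2 * Re z / N + normc z ^+ 2 / N ^+ 2.
  have e : t ^+ 2 = 1 + (2 * Re z / N + normc z ^+ 2 / N ^+ 2).
    rewrite /t !sqr_normcE cReD cReM cImD cImM /= mul0r subr0 mul0r addr0 add0r.
    by field; rewrite gt_eqF.
  rewrite e; apply: le_ln1Dx; have : 0 < t ^+ 2 by rewrite exprn_gt0.
  by rewrite e => ?; lra.
rewrite lnXn // -[_ *+ 2]mulr_natl in l2.
have -> : N * ln t = (N / 2) * (2 * ln t) by rewrite mulrA divfK.
have -> : Re z + normc z ^+ 2 / (2 * N) = (N / 2) * (2 * Re z / N + normc z ^+ 2 / N ^+ 2).
  by field; rewrite gt_eqF.
have N2 : 0 < N / 2 by rewrite divr_gt0.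
rewrite ler_pM2l //.
Qed.

Lemma ae_circ (E : set T) (P : T -> Prop) : measurable E -> circ (~` E) = 0%E ->
  (forall x, E x -> P x) -> {ae circ, forall x, P x}.
Proof.
move=> mE E0 H; exists (~` E); split => //; first exact: measurableC.
by move=> x /= nP Ex; apply: nP; exact: H.
Qed.

Section Data.
Context (F : R[i] -> R[i]) (E : set T) (bv : T -> R[i]).
Context (dF : forall z, normc z < 1 -> cdiff F z)
  (mE : measurable E) (E0 : circ (~` E) = 0%E)
  (cF : forall x, E x -> (F ((rseq n)%:C * expi x) : R[i]^o) @[n --> \oo] --> (bv x : R[i]^o))
  (mRe : measurable_fun setT (fun x => Re (bv x)))
  (mIm : measurable_fun setT (fun x => Im (bv x)))
  (iL : circ.-integrable setT (EFin \o (fun x => ln (Num.max 1 (normc (bv x))))))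
  (cL : (\int[circ]_x ln (Num.max 1 (normc (F ((rseq n)%:C * expi x))))) @[n --> \oo] -->
        \int[circ]_x ln (Num.max 1 (normc (bv x)))).

(* The logarithmic mean inequality for 1 + f / N, multiplied by N -> oo.  The
   convergence [cL] of the log-plus means (the N^+ condition) provides the
   convergent majorants for Fatou's lemma. *)
Lemma hardy_mean_le (f : R[i] -> R[i]) (fs : T -> R[i]) (rho M : R) (n0 : nat) :
  disc_cont f 1 ->
  (forall z, normc z < 1 -> z != 0 -> normc z != rho -> cdiff f z) ->
  0 <= M ->
  (forall n x, (n0 <= n)%N -> normc (f ((rseq n)%:C * expi x)) <= M * (1 + normc (F ((rseq n)%:C * expi x)))) ->
  (forall x, E x -> (f ((rseq n)%:C * expi x) : R[i]^o) @[n --> \oo] --> (fs x : R[i]^o)) ->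
  measurable_fun setT (fun x => Re (fs x)) -> measurable_fun setT (fun x => Im (fs x)) ->
  circ.-integrable setT (EFin \o (fun x => normc (fs x))) ->
  Re (f 0) <= \int[circ]_x Re (fs x).
Proof.
move=> cf df M0 fM cfs mr mi ifs.
have cFd : disc_cont F 1 by move=> z /dF /cdiff_cont.
have radn n : `|rseq n| < 1 by rewrite ger0_norm ?rseq_ge0 // rseq_lt1.
have radI n : 0 <= rseq n < 1 by rewrite rseq_ge0 rseq_lt1.
have mnfs := meas_normc mr mi.
pose w (N : R) x := 1 + (N^-1)%:C * fs x.
have mwRe N : measurable_fun setT (fun x => Re (w N x)).
  rewrite /w; under eq_fun do rewrite cReD cReM /= mul0r subr0.
  by apply: measurable_funD => //; apply: measurable_funM.
have mwIm N : measurable_fun setT (fun x => Im (w N x)).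
  rewrite /w; under eq_fun do rewrite cImD cImM /= mul0r addr0 add0r.
  by apply: measurable_funM.
have wle (N : R) (z : R[i]) : 0 < N -> normc (1 + (N^-1)%:C * z) <= 1 + N^-1 * normc z.
  move=> N0; apply: (le_trans (normc_triangle _ _)); rewrite normc1 normcM normc_real.
  by rewrite gtr0_norm ?invr_gt0.
have lnub (t y : R) : 0 <= y -> t <= 1 + y -> ln (Num.max 2^-1 t) <= y.
  move=> y0 ty; apply: (@le_trans _ _ (ln (1 + y))).
    rewrite ler_ln ?posrE ?lt_max ?invr_gt0 ?ltr0n //; last by rewrite ltr_wpDr.
    by rewrite ge_max ty andbT (le_trans _ (_ : 1 <= _)) ?lerDl // invf_le1 // ler1n.
  by apply: le_ln1Dx; rewrite (lt_le_trans _ y0) // ltrN10.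
have lnlb (t : R) : - ln 2 <= ln (Num.max 2^-1 t).
  rewrite -lnV ?posrE // ler_ln ?posrE ?lt_max ?invr_gt0 ?ltr0n //.
  by rewrite le_max lexx.
have lnabs (t y : R) : 0 <= y -> t <= 1 + y -> `|ln (Num.max 2^-1 t)| <= ln 2 + y.
  move=> y0 ty; have h1 := lnub _ _ y0 ty; have h2 := lnlb t.
  have l2 : 0 <= ln 2 :> R by rewrite ln_ge0 // ler1n.
  by rewrite ler_norml; apply/andP; split; lra.
have iw (N : R) : 1 <= N -> circ.-integrable setT (EFin \o (fun x => ln (Num.max 2^-1 (normc (w N x))))).
  move=> N1; have N0 := lt_le_trans ltr01 N1.
  have ifs2 : circ.-integrable setT (EFin \o (fun x => ln 2 + normc (fs x))).
    exact: (integrableD _ (circle_cst_integrable (ln 2)) ifs).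
  apply: (le_integrable _ _ _ ifs2) => //.
    by apply/measurable_EFinP; apply: meas_lnmax; exact: meas_normc.
  move=> x _ /=; rewrite lee_fin.
  apply: (le_trans (lnabs _ _ (normc_ge0 (fs x)) _)); last exact: ler_norm.
  apply: (le_trans (wle _ _ N0)); rewrite lerD2l ler_piMl ?normc_ge0 //.
  by rewrite invf_le1.
have step1 (N : R) : 1 <= N -> 0 < normc (1 + (N^-1)%:C * f 0) ->
    ln (normc (1 + (N^-1)%:C * f 0)) <= \int[circ]_x ln (Num.max 2^-1 (normc (w N x))).
  move=> N1 fN0; have N0 := lt_le_trans ltr01 N1.
  have Ni : N^-1 <= 1 by rewrite invf_le1.
  pose g n (x : T) := ln (Num.max 2^-1 (normc (1 + (N^-1)%:C * f ((rseq (n + n0))%:C * expi x)))).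
  (* From rank n0 on, |f| <= M (1 + |F|) <= 2 M max(1, |F|), whence max(1/2, |1 + f / N|) <= (1 + 2
     M) max(1, |F|). The integrals of this majorant converge by [cL]. *)
  pose h n (x : T) := ln (1 + 2 * M) + ln (Num.max 1 (normc (F ((rseq (n + n0))%:C * expi x)))).
  pose k z := 1 + (N^-1)%:C * f z.
  have ck : disc_cont k 1.
    move=> z /cf cz; apply: ccontD; first exact: ccont_cst.
    by apply: ccontM => //; exact: ccont_cst.
  have dk z : normc z < 1 -> z != 0 -> normc z != rho -> cdiff k z.
    move=> z1 z2 z3; apply: cdiffD; first exact: cdiff_cst.
    by apply: cdiffM; [exact: cdiff_cst|exact: df].
  have cln (u : R[i] -> R[i]) (c : R) n : 0 < c -> disc_cont u 1 ->
      continuous (fun x : R => ln (Num.max c (normc (u ((rseq n)%:C * expi x))))).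
    move=> c0 cu x.
    have m0 : 0 < Num.max c (normc (u ((rseq n)%:C * expi x))) by rewrite lt_max c0.
    have cM : (fun x => Num.max c (normc (u ((rseq n)%:C * expi x)))) @ x --> Num.max c (normc (u ((rseq n)%:C * expi x))).
      by apply: cvg_maxr; apply: cvg_normc_circle; exact: (disc_cont_circle cu (radn _)).
    by move=> A /(continuous_ln m0) hA; exact: (cM _ hA).
  apply: (@reverse_fatou R _ (fun x => ln (1 + 2 * M) + ln (Num.max 1 (normc (bv x)))) g h).
  - move=> n; apply: circle_cont_integrable; exact: (cln k).
  - move=> n; apply: circ_integrableD; first exact: circle_cst_integrable.
    apply: circle_cont_integrable; exact: (cln F).
  - exact: iw.
  - by apply: circ_integrableD => //; exact: circle_cst_integrable.
  - move=> n x; rewrite /g /h -lnM ?posrE ?lt_max ?ltr01 //; last by rewrite ltr_wpDr ?mulr_ge0.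
    set FF := normc (F _); set ff := f _.
    have F1 : 1 <= Num.max 1 FF by rewrite le_max lexx.
    have F2 : FF <= Num.max 1 FF by rewrite le_max lexx orbT.
    have M2 : 0 <= 2 * M by rewrite mulr_ge0.
    rewrite ler_ln ?posrE ?lt_max ?invr_gt0 ?ltr0n //; last first.
      by rewrite mulr_gt0 // ?(lt_le_trans _ F1) // ltr_wpDr.
    rewrite ge_max; apply/andP; split.
      rewrite (@le_trans _ _ 1) // ?invf_le1 ?ler1n //.
      by rewrite -[X in X <= _]mulr1; apply: ler_pM => //; rewrite lerDl.
    apply: (le_trans (wle _ _ N0)).
    have h1 : N^-1 * normc ff <= M * (1 + FF).
      apply: le_trans (fM _ x (leq_addl n n0)).
      by rewrite ler_piMl ?normc_ge0.
    have h2 : M * (1 + FF) <= M * (Num.max 1 FF + Num.max 1 FF) by rewrite ler_wpM2l // lerD.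
    have -> : (1 + 2 * M) * Num.max 1 FF = Num.max 1 FF + M * (Num.max 1 FF + Num.max 1 FF) by ring.
    by apply: lerD => //; exact: le_trans h1 h2.
  - apply: (ae_circ mE E0) => x Ex; apply: cvgD; first exact: cvg_cst.
    have m0 : 0 < Num.max 1 (normc (bv x)) by rewrite lt_max ltr01.
    have cM : (fun n => Num.max 1 (normc (F ((rseq (n + n0))%:C * expi x)))) @ \oo --> Num.max 1 (normc (bv x)).
      have hh : (fun n => normc (F ((rseq n)%:C * expi x))) @ \oo --> normc (bv x).
        by apply: cvg_normc; exact: cF.
      apply: cvg_maxr.
      exact: (@cvg_addn (fun n => normc (F ((rseq n)%:C * expi x))) _ n0 hh).
    by move=> A /(continuous_ln m0) hA; exact: (cM _ hA).
  - apply: (ae_circ mE E0) => x Ex e e0.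
    have cg : g n x @[n --> \oo] --> ln (Num.max 2^-1 (normc (w N x))).
      have m0 : 0 < Num.max 2^-1 (normc (w N x)) by rewrite lt_max invr_gt0 ltr0n.
      have cM : (fun n => Num.max 2^-1 (normc (1 + (N^-1)%:C * f ((rseq (n + n0))%:C * expi x)))) @ \oo --> Num.max 2^-1 (normc (w N x)).
        apply: cvg_maxr.
        have cff := cfs x Ex.
        have : (fun n => (1 + (N^-1)%:C * f ((rseq n)%:C * expi x) : R[i]^o)) @ \oo --> (w N x : R[i]^o).
          apply: (@cvgD R[i] R[i]^o); first exact: cvgC_cst.
          by apply: cvgZC cff; exact: cvgC_cst.
        move/cvg_normc; exact: (@cvg_addn (fun n => normc (1 + (N^-1)%:C * f ((rseq n)%:C * expi x)))).
      by move=> A /(continuous_ln m0) hA; exact: (cM _ hA).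
    move/cvgrPdist_lt : cg => /(_ e e0); apply: filterS => n.
    by rewrite ltr_norml => /andP[? ?]; lra.
  - have E1 n : \int[circ]_x h n x = ln (1 + 2 * M) + \int[circ]_x ln (Num.max 1 (normc (F ((rseq (n + n0))%:C * expi x)))).
      rewrite RintegralD //; first by rewrite Rintegral_circle_cst.
        exact: circle_cst_integrable.
      apply: circle_cont_integrable; exact: (cln F).
    rewrite RintegralD //; last exact: circle_cst_integrable.
    rewrite Rintegral_circle_cst; under eq_fun do rewrite E1.
    apply: cvgD; first exact: cvg_cst.
    exact: (@cvg_addn (fun n => \int[circ]_x0 ln (Num.max 1 (normc (F ((rseq n)%:C * expi x0)))))).
  - move=> n; apply: (@log_mean R k 1 rho) => //.
have step2 (N : R) : 1 <= N -> 2 * normc (f 0) <= N ->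
    Re (f 0) - 2 * Re (f 0) ^+ 2 / N <= \int[circ]_x (N * ln (Num.max 2^-1 (normc (w N x)))).
  move=> N1 fN; have N0 := lt_le_trans ltr01 N1.
  have hs := ln_lower N0 fN.
  have t0 : 0 < normc (1 + (N^-1)%:C * f 0) by case: hs.
  rewrite RintegralZl //; last exact: iw.
  apply: (@le_trans _ _ (N * ln (normc (1 + (N^-1)%:C * f 0)))); first by case: hs.
  by rewrite ler_pM2l // step1.
apply/ler_addgt0Pr => e e0; rewrite -lerBlDr.
(* Every [NN n] is then at least 2 |f(0)|, as [ln_lower] demands, and at least 2 (Re f(0))^2 / e, so
   that the quadratic error at the origin is at most e. *)
pose K := Num.trunc (2 * normc (f 0) + 2 * Re (f 0) ^+ 2 / e).
pose NN n : R := (n + K).+1%:R.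
have NN1 n : 1 <= NN n by rewrite ler1n.
have NN0 n : 0 < NN n := lt_le_trans ltr01 (NN1 n).
have NK n : 2 * normc (f 0) + 2 * Re (f 0) ^+ 2 / e <= NN n.
  apply/ltW/(lt_le_trans (truncnS_gt _)).
  by rewrite ler_nat ltnS leq_addl.
have f00 := normc_ge0 (f 0).
have s0 : 0 <= 2 * Re (f 0) ^+ 2 / e by rewrite divr_ge0 ?(ltW e0) // mulr_ge0 // sqr_ge0.
(* Now N -> oo, with the fixed majorant |fs| coming from ln(1 + y) <= y; [ln_upper] bounds the
   integrands asymptotically by Re fs. *)
apply: (@reverse_fatou R _ (fun x => normc (fs x))
   (fun n x => NN n * ln (Num.max 2^-1 (normc (w (NN n) x)))) (fun n x => normc (fs x))) => //.
- by move=> n; exact: (integrableZl _ _ (iw _ (NN1 n))).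
- apply: (le_integrable _ _ _ ifs) => //; first exact/measurable_EFinP.
  by move=> x _ /=; rewrite lee_fin [leRHS]ger0_norm ?normc_ge0 // normc_Re.
- move=> n x; rewrite -ler_pdivlMl //; apply: lnub.
    by rewrite mulr_ge0 ?normc_ge0 // invr_ge0 ltW.
  exact: wle.
- by apply: (ae_circ mE E0) => x Ex; exact: cvg_cst.
- apply: (ae_circ mE E0) => x Ex e' e'0.
  have nf := normc_ge0 (fs x).
  pose K' := Num.trunc (2 * normc (fs x) + normc (fs x) ^+ 2 / (2 * e')).
  have s1 : 0 <= normc (fs x) ^+ 2 / (2 * e').
    by rewrite divr_ge0 ?sqr_ge0 // mulr_ge0 // ltW.
  exists K' => // n /= Kn.
  have NK' : 2 * normc (fs x) + normc (fs x) ^+ 2 / (2 * e') <= NN n.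
    apply/ltW/(lt_le_trans (truncnS_gt _)).
    by rewrite ler_nat ltnS (leq_trans Kn) // leq_addr.
  have fN : 2 * normc (fs x) <= NN n by apply: le_trans NK'; rewrite lerDl.
  apply: (le_trans (ln_upper (NN0 n) fN)); rewrite lerD2l.
  rewrite ler_pdivrMr ?mulr_gt0 //.
  have : normc (fs x) ^+ 2 / (2 * e') <= NN n by apply: le_trans NK'; rewrite lerDr mulr_ge0.
  rewrite ler_pdivrMr ?mulr_gt0 // => /le_trans; apply.
  by rewrite le_eqVlt; apply/orP; left; apply/eqP; ring.
- exact: cvg_cst.
- move=> n; apply: le_trans (step2 _ (NN1 n) _).
    rewrite lerD2l lerN2 ler_pdivrMr // [e * _]mulrC -ler_pdivrMr //.
    by apply: le_trans (NK n); rewrite lerDr mulr_ge0.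
  by apply: le_trans (NK n); rewrite lerDl.
Qed.


(** Multiplying f by 1, -1, -i and i turns the one-sided [hardy_mean_le] into equality for both the
    real and the imaginary part. *)
Lemma hardy_mean (f : R[i] -> R[i]) (fs : T -> R[i]) (rho M : R) (n0 : nat) :
  disc_cont f 1 ->
  (forall z, normc z < 1 -> z != 0 -> normc z != rho -> cdiff f z) ->
  0 <= M ->
  (forall n x, (n0 <= n)%N -> normc (f ((rseq n)%:C * expi x)) <= M * (1 + normc (F ((rseq n)%:C * expi x)))) ->
  (forall x, E x -> (f ((rseq n)%:C * expi x) : R[i]^o) @[n --> \oo] --> (fs x : R[i]^o)) ->
  measurable_fun setT (fun x => Re (fs x)) -> measurable_fun setT (fun x => Im (fs x)) ->
  circ.-integrable setT (EFin \o (fun x => normc (fs x))) ->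
  \int[circ]_x Re (fs x) = Re (f 0) /\ \int[circ]_x Im (fs x) = Im (f 0).
Proof.
move=> cf df M0 fM cfs mr mi ifs.
have iRe : circ.-integrable setT (EFin \o (fun x => Re (fs x))).
  apply: (le_integrable _ _ _ ifs) => //; first exact/measurable_EFinP.
  by move=> x _ /=; rewrite lee_fin [leRHS]ger0_norm ?normc_ge0 // normc_Re.
have iIm : circ.-integrable setT (EFin \o (fun x => Im (fs x))).
  apply: (le_integrable _ _ _ ifs) => //; first exact/measurable_EFinP.
  by move=> x _ /=; rewrite lee_fin [leRHS]ger0_norm ?normc_ge0 // normc_Im.
have main (c : R[i]) : normc c = 1 -> Re (f 0 * c) <= \int[circ]_x Re (fs x * c).
  move=> c1.
  apply: (@hardy_mean_le (fun z => f z * c) (fun x => fs x * c) rho M n0).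
  - by move=> z /cf cz; apply: ccontM => //; exact: ccont_cst.
  - by move=> z z1 z2 z3; apply: cdiffM; [exact: df|exact: cdiff_cst].
  - exact: M0.
  - by move=> n x; rewrite normcM c1 mulr1; exact: fM.
  - by move=> x Ex; apply: cvgZC; [exact: cfs|exact: cvgC_cst].
  - under eq_fun do rewrite cReM; apply: measurable_funB; exact: measurable_funM.
  - under eq_fun do rewrite cImM; apply: measurable_funD; exact: measurable_funM.
  - by under eq_fun do rewrite normcM c1 mulr1.
have RN (g : T -> R) : circ.-integrable setT (EFin \o g) -> \int[circ]_x (- g x) = - \int[circ]_x g x.
  move=> ig; rewrite -[RHS]mulN1r -RintegralZl //.
  by apply: eq_Rintegral => x _; rewrite mulN1r.
have p1 := main 1 (normc1 R).
have p2 := main (-1); rewrite normcN normc1 in p2; have {}p2 := p2 erefl.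
have p3 := main (0 -i* 1); rewrite /= expr0n /= add0r sqrrN expr1n sqrtr1 in p3; have {}p3 := p3 erefl.
have p4 := main (0 +i* 1); rewrite /= expr0n /= add0r expr1n sqrtr1 in p4; have {}p4 := p4 erefl.
have E1 (z : R[i]) : Re (z * 1) = Re z by rewrite mulr1.
have E2 (z : R[i]) : Re (z * -1) = - Re z by case: z => a b; rewrite mulrN1.
have E3 (z : R[i]) : Re (z * (0 -i* 1)) = Im z by case: z => a b; rewrite /= mulr0 sub0r mulrN1 opprK.
have E4 (z : R[i]) : Re (z * (0 +i* 1)) = - Im z by case: z => a b; rewrite /= mulr0 sub0r mulr1.
split; apply/eqP; rewrite eq_le.
  rewrite -[X in X <= _]opprK -RN // lerNl; apply/andP; split.
    by rewrite -E2; apply: (le_trans p2); rewrite (eq_Rintegral _ (fun x _ => E2 (fs x))).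
  by rewrite -E1; apply: (le_trans p1); rewrite (eq_Rintegral _ (fun x _ => E1 (fs x))).
rewrite -[X in X <= _]opprK -RN // lerNl; apply/andP; split.
  by rewrite -E4; apply: (le_trans p4); rewrite (eq_Rintegral _ (fun x _ => E4 (fs x))).
by rewrite -E3; apply: (le_trans p3); rewrite (eq_Rintegral _ (fun x _ => E3 (fs x))).
Qed.

Context (ibv : circ.-integrable setT (EFin \o (fun x => normc (bv x)))).

Lemma hardy_origin : \int[circ]_x Re (bv x) = Re (F 0) /\ \int[circ]_x Im (bv x) = Im (F 0).
Proof.
apply: (@hardy_mean F bv (-1) 1 0) => //.
- by move=> z /dF /cdiff_cont.
- by move=> z /dF.
- by move=> n x _; rewrite mul1r lerDr.
Qed.

(** |1 - conj(z) e^{ix}| = |e^{ix} - z|, so this is the Poisson kernel of z without its constant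
    factor 1 - |z|^2. *)
Definition pweight (z : R[i]) (x : R) : R := (normc (1 - z^* * expi x) ^+ 2)^-1.

Lemma normc_conj (z : R[i]) : normc z^* = normc z.
Proof. by case: z => a b /=; rewrite sqrrN. Qed.

Lemma mulc_conj (z : R[i]) : z * z^* = (normc z ^+ 2)%:C.
Proof. by rewrite sqr_normcE; case: z => a b; simpc; congr (_ +i* _); rewrite -?expr2 // addrC mulrC subrr. Qed.

Lemma pweight_den (z : R[i]) (x : R) : normc z < 1 ->
  1 - normc z <= normc (1 - z^* * expi x) <= 2.
Proof.
move=> z1; have e : normc (z^* * expi x) = normc z by rewrite normcM normc_conj normc_expi mulr1.
apply/andP; split.
  have := normc_triangle (1 - z^* * expi x) (z^* * expi x); rewrite subrK normc1 e; lra.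
have := normc_triangle 1 (- (z^* * expi x)); rewrite normcN normc1 e; lra.
Qed.

(** On the unit circle e^{ix} - z = e^{ix} conj(1 - conj(z) e^{ix}), so the factor w / (1 - conj(z)
    w) turns the complex kernel 1 / (w - z) into a positive weight. *)
Lemma pweight_kernel (z : R[i]) (x : R) : normc z < 1 ->
  (expi x - z)^-1 * (expi x / (1 - z^* * expi x)) = (pweight z x)%:C.
Proof.
move=> z1.
have /andP[c1 _] := pweight_den x z1.
have conjE (u v : R[i]) : conjc (1 - conjc u * v) = 1 - u * conjc v.
  by case: u => a b; case: v => a' b'; apply/eqP; rewrite eq_complex /=; apply/andP; split; apply/eqP; ring.
have cc : expi x - z = expi x * conjc (1 - conjc z * expi x).
  by rewrite conjE expi_conj mulrBr mulr1 mulrCA mulfV ?expi_neq0 // mulr1.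
have -> : (pweight z x)%:C = ((1 - conjc z * expi x) * conjc (1 - conjc z * expi x))^-1.
  by rewrite mulc_conj /pweight fmorphV.
rewrite cc !invfM mulrACA mulVf ?expi_neq0 // mul1r.
by rewrite mulrC.
Qed.

Lemma pweight_bounds (z : R[i]) (x : R) : normc z < 1 ->
  4^-1 <= pweight z x <= ((1 - normc z) ^+ 2)^-1.
Proof.
move=> z1; have /andP[c1 c2] := pweight_den x z1.
have c0 : 0 < 1 - normc z by rewrite subr_gt0.
have c3 := lt_le_trans c0 c1.
rewrite /pweight !lef_pV2 ?posrE ?exprn_gt0 //.
rewrite (_ : 4 = 2 ^+ 2); last by rewrite expr2 -natrM.
by rewrite !ler_pXn2r // ?nnegrE ?(ltW c0) ?(ltW c3) // c1 c2.
Qed.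

Lemma cont_pweight (z : R[i]) : normc z < 1 -> continuous (pweight z).
Proof.
move=> z1 x; have /andP[c1 _] := pweight_den x z1.
have c0 : 0 < normc (1 - z^* * expi x) by apply: lt_le_trans c1; rewrite subr_gt0.
rewrite /pweight; apply: cvgV; first by rewrite gt_eqF // exprn_gt0.
have cn : (fun x => normc (1 - z^* * expi x)) @ x --> normc (1 - z^* * expi x).
  apply: cvg_normc; apply: (@cvgB R[i] R[i]^o); first exact: cvgC_cst.
  by apply: cvgZC; [exact: cvgC_cst|exact: cvg_expi].
by under eq_fun do rewrite expr2; rewrite expr2; exact: cvgM.
Qed.

(* [hardy_mean] for (F(w) - F(z)) / (w - z) * w / (1 - conj z * w): this vanishes
   at 0, and its boundary values are a positive weight times bv - F(z). *)
Lemma hardy_weight (z : R[i]) : normc z < 1 ->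
  \int[circ]_x (Re (bv x - F z) * pweight z x) = 0 /\
  \int[circ]_x (Im (bv x - F z) * pweight z x) = 0.
Proof.
move=> z1; have [phi [hphi cphi dphi]] := cdiff_slope dF z1.
set d := 1 - normc z; have d0 : 0 < d by rewrite subr_gt0.
pose q (w : R[i]) := w / (1 - z^* * w).
have den (w : R[i]) : normc w < 1 -> d <= normc (1 - z^* * w).
  move=> w1; have := normc_triangle (1 - z^* * w) (z^* * w); rewrite subrK normc1 normcM normc_conj.
  have : normc z * normc w <= normc z by rewrite ler_piMr ?normc_ge0 // ltW.
  by rewrite /d; lra.
have den0 (w : R[i]) : normc w < 1 -> 1 - z^* * w != 0.
  by move=> w1; rewrite -normc_gt0 (lt_le_trans d0) // den.
have dq (w : R[i]) : normc w < 1 -> cdiff q w.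
  move=> w1; apply: cdiffM; first exact: cdiff_id.
  apply: cdiffV; first exact: den0.
  apply: cdiffB; first exact: cdiff_cst.
  by apply: cdiffM; [exact: cdiff_cst|exact: cdiff_id].
have phiE w : w != z -> phi w = (F w - F z) / (w - z).
  by move=> wz; rewrite hphi mulfK // subr_eq0.
have cvr x : ((rseq n)%:C * expi x : R[i]^o) @[n --> \oo] --> (expi x : R[i]^o).
  rewrite -[X in _ --> X]mul1r; apply: cvgZC; last exact: cvgC_cst.
  by apply: cvg_complex; [exact: cvg_rseq|exact: cvg_cst].
pose f w := phi w * q w.
have nf u : u != z -> normc (f u) = normc (F u - F z) / normc (u - z) * (normc u / normc (1 - z^* * u)).
  by move=> uz; rewrite /f phiE // /q !(normcM, normcV).
have d20 : 0 < d / 2 by rewrite divr_gt0.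
(* From rank N on, the circles keep a distance of at least d / 2 from z, where d = 1 - |z|; the
   growth bound on f is claimed only there. *)
have [N _ hN] : \forall n \near \oo, 1 - d / 2 < rseq n.
  have := cvg_rseq => /cvgrPdist_lt /(_ _ d20); apply: filterS => n.
  by rewrite ltr_norml => /andP[? ?]; lra.
have far n x : (N <= n)%N -> d / 2 <= normc ((rseq n)%:C * expi x - z).
  move=> /hN /= rn; have := normc_triangle ((rseq n)%:C * expi x - z) z.
  rewrite subrK normc_circle ger0_norm ?rseq_ge0 //; rewrite /d in rn *; lra.
have cr n x : normc ((rseq n)%:C * expi x) < 1.
  by rewrite normc_circle ger0_norm ?rseq_ge0 // rseq_lt1.
have [A1 A2] : \int[circ]_x Re ((bv x - F z) * (pweight z x)%:C) = Re (f 0) /\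
         \int[circ]_x Im ((bv x - F z) * (pweight z x)%:C) = Im (f 0).
  (* The exceptional circle is |w| = |z|. In the growth constant, 2 / d bounds 1 / |w - z|, another
     1 / d bounds q, and |F(w) - F(z)| <= (1 + |F(z)|) (1 + |F(w)|). *)
  apply: (@hardy_mean f _ (normc z) ((1 + normc (F z)) * (2 / d ^+ 2)) N).
  - move=> w w1; apply: ccontM; last exact/cdiff_cont/dq.
    have [->//|wz] := eqVneq w z; exact/cdiff_cont/dphi.
  - move=> w w1 _ wz; apply: cdiffM; last exact: dq.
    by apply: dphi => //; apply: contra_neq wz => ->.
  - by rewrite mulr_ge0 ?addr_ge0 ?normc_ge0 // divr_ge0 // sqr_ge0.
  - move=> n x Nn; set w := _ * _.
    have wz : w != z by rewrite -subr_eq0 -normc_gt0; apply: lt_le_trans (far n x Nn).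
    rewrite nf //.
    have h1 : (normc (w - z))^-1 <= 2 / d.
      rewrite -[2 / d]invrK invf_div lef_pV2 ?posrE //; first exact: far.
      by apply: lt_le_trans (far n x Nn).
    have h2 : normc w / normc (1 - z^* * w) <= d^-1.
      rewrite -[d^-1]mul1r; apply: ler_pM; rewrite ?normc_ge0 ?invr_ge0 ?normc_ge0 //.
        exact/ltW/cr.
      rewrite lef_pV2 ?posrE //; first exact/den/cr.
      by apply: lt_le_trans d0 _; exact/den/cr.
    have h3 : normc (F w - F z) <= (1 + normc (F z)) * (1 + normc (F w)).
      apply: (le_trans (normc_triangle _ _)); rewrite normcN.
      have := normc_ge0 (F w); have := normc_ge0 (F z) => a b.
      have : 0 <= normc (F w) * normc (F z) by rewrite mulr_ge0.
      have -> : (1 + normc (F z)) * (1 + normc (F w)) = 1 + normc (F z) + normc (F w) + normc (F w) * normc (F z) by ring.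
      lra.
    have -> : (1 + normc (F z)) * (2 / d ^+ 2) * (1 + normc (F w)) =
       (1 + normc (F z)) * (1 + normc (F w)) * (2 / d) * d^-1.
      by field; rewrite gt_eqF.
    apply: ler_pM => //; rewrite ?mulr_ge0 ?invr_ge0 ?normc_ge0 //.
    by apply: ler_pM => //; rewrite ?invr_ge0 ?normc_ge0.
  - move=> x Ex; rewrite -pweight_kernel // mulrA.
    have xz : expi x - z != 0.
      rewrite -normc_gt0; have := normc_triangle (expi x - z) z.
      by rewrite subrK normc_expi => ?; lra.
    have xd : 1 - z^* * expi x != 0.
      by rewrite -normc_gt0; have /andP[+ _] := pweight_den x z1; apply: lt_le_trans.
    apply: (@cvg_trans _ (((F ((rseq n)%:C * expi x) - F z) / ((rseq n)%:C * expi x - z) *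
       (((rseq n)%:C * expi x) / (1 - z^* * ((rseq n)%:C * expi x))) : R[i]^o) @[n --> \oo])).
      apply: near_eq_cvg; exists N => // n /= Nn; rewrite /f phiE //.
      by rewrite -subr_eq0 -normc_gt0; apply: lt_le_trans (far n x Nn).
    apply: cvgZC; apply: cvgZC.
    + by apply: (@cvgB R[i] R[i]^o); [exact: cF|exact: cvgC_cst].
    + apply: cvgC_V => //.
      by apply: (@cvgB R[i] R[i]^o); [exact: cvr|exact: cvgC_cst].
    + exact: cvr.
    + apply: cvgC_V => //; apply: (@cvgB R[i] R[i]^o); first exact: cvgC_cst.
      by apply: cvgZC; [exact: cvgC_cst|exact: cvr].
  - under eq_fun do rewrite cReM /= mulr0 subr0 cReB; apply: measurable_funM.
      exact: measurable_funB.
    by apply: continuous_measurable_fun; exact: cont_pweight.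
  - under eq_fun do rewrite cImM /= mulr0 add0r cImB; apply: measurable_funM.
      exact: measurable_funB.
    by apply: continuous_measurable_fun; exact: cont_pweight.
  - have ib : circ.-integrable setT (EFin \o (fun x => (d ^+ 2)^-1 * (normc (bv x) + normc (F z)))).
      apply: (integrableZl _ _ (circ_integrableD ibv (circle_cst_integrable _))) => //.
    apply: (le_integrable _ _ _ ib) => //.
      apply/measurable_EFinP; under eq_fun do rewrite normcM normc_real.
      apply: measurable_funM.
        apply: meas_normc.
          by under eq_fun do rewrite cReB; exact: measurable_funB.
        by under eq_fun do rewrite cImB; exact: measurable_funB.
      apply: measurableT_comp => //.
      by apply: continuous_measurable_fun; exact: cont_pweight.
    move=> x _ /=; rewrite lee_fin ger0_norm ?normc_ge0 //.
    apply: le_trans (ler_norm _).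
    rewrite normcM normc_real mulrC.
    have /andP[w1 w2] := pweight_bounds x z1.
    have w0 : 0 <= pweight z x by apply: le_trans w1; rewrite invr_ge0.
    apply: ler_pM; rewrite ?normr_ge0 ?normc_ge0 //.
      by rewrite ger0_norm.
    by apply: (le_trans (normc_triangle _ _)); rewrite normcN.
have f0 : f 0 = 0 by rewrite /f /q mul0r mulr0.
rewrite f0 /= in A1 A2.
split; [rewrite -[RHS]A1|rewrite -[RHS]A2]; apply: eq_Rintegral => x _.
  by rewrite cReM /= mulr0 subr0.
by rewrite cImM /= mulr0 add0r.
Qed.

(** If the affine form had a value v < 0 at F(z), its excess over v on the boundary would be at
    least -v > 0, yet would have weighted mean 0 by [hardy_weight]; the lower bound 1/4 of the
    weight makes this absurd. *)
Lemma hardy_halfplane (a b c : R) (z : R[i]) : normc z < 1 ->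
  (forall x, 0 <= a * Re (bv x) + b * Im (bv x) + c) ->
  0 <= a * Re (F z) + b * Im (F z) + c.
Proof.
move=> z1 H; rewrite leNgt; apply/negP; set v := _ + c => v0.
have [W1 W2] := hardy_weight z1.
have iN : circ.-integrable setT (EFin \o (fun x => ((1 - normc z) ^+ 2)^-1 * (normc (bv x) + normc (F z)))).
  exact: (integrableZl _ _ (circ_integrableD ibv (circle_cst_integrable _))).
have mw : measurable_fun [set: T] (pweight z : T -> R).
  by apply: continuous_measurable_fun; exact: cont_pweight.
have bw (g : R[i] -> R) : (forall u, `|g u| <= normc u) -> measurable_fun setT (fun x => g (bv x - F z)) ->
    circ.-integrable setT (EFin \o (fun x => g (bv x - F z) * pweight z x)).
  move=> gu mg; apply: (le_integrable _ _ _ iN) => //.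
    by apply/measurable_EFinP; exact: measurable_funM.
  move=> x _ /=; rewrite lee_fin normrM; apply: le_trans (ler_norm _).
  have /andP[w1 w2] := pweight_bounds x z1.
  have w0 : 0 <= pweight z x by apply: le_trans w1; rewrite invr_ge0.
  rewrite mulrC; apply: ler_pM => //; first by rewrite ger0_norm.
  by apply: (le_trans (gu _)); apply: (le_trans (normc_triangle _ _)); rewrite normcN.
have i1 := bw (fun u => Re u) (@normc_Re R).
have {}i1 : circ.-integrable setT (EFin \o (fun x => Re (bv x - F z) * pweight z x)).
  by apply: i1; under eq_fun do rewrite cReB; exact: measurable_funB.
have i2 := bw (fun u => Im u) (@normc_Im R).
have {}i2 : circ.-integrable setT (EFin \o (fun x => Im (bv x - F z) * pweight z x)).
  by apply: i2; under eq_fun do rewrite cImB; exact: measurable_funB.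
have j1 : circ.-integrable setT (EFin \o (fun x => a * (Re (bv x - F z) * pweight z x))).
  exact: (integrableZl _ _ i1).
have j2 : circ.-integrable setT (EFin \o (fun x => b * (Im (bv x - F z) * pweight z x))).
  exact: (integrableZl _ _ i2).
have I0 : \int[circ]_x (a * (Re (bv x - F z) * pweight z x) + b * (Im (bv x - F z) * pweight z x)) = 0.
  by rewrite RintegralD // !RintegralZl // W1 W2 !mulr0 addr0.
have : \int[circ]_x (- v / 4) <= 0.
  rewrite -[leRHS]I0; apply: le_Rintegral => //; first exact: circle_cst_integrable.
    exact: circ_integrableD.
  move=> x _; have /andP[w1 _] := pweight_bounds x z1.
  have -> : a * (Re (bv x - F z) * pweight z x) + b * (Im (bv x - F z) * pweight z x) =
    (a * Re (bv x) + b * Im (bv x) + c - v) * pweight z x.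
    by rewrite cReB cImB /v; ring.
  by apply: ler_pM => //; [lra|have := H x; lra].
by rewrite Rintegral_circle_cst; lra.
Qed.

End Data.
End HardyMean.

(** * Littlewood's subordination principle *)

Section CircF.
Context (R : realType).
(* A copy of the measure that carries the finiteness instance needed by Fubini. *)
Definition circF : set (measurableTypeR R) -> \bar R := circle_measure R.
HB.instance Definition _ := Measure.copy circF (circle_measure R).
HB.instance Definition _ := @Measure_isFinite.Build _ _ _ circF (@circle_finite R).
End CircF.

(** * The Poisson kernel *)

Section PoissonKernel.
Context (R : realType).
Local Notation circ := (circle_measure R).
Local Notation T := (measurableTypeR R).

Definition pkernel (z : R[i]) (x : R) : R := (1 - normc z ^+ 2) * pweight z x.

Lemma pkernel_ge0 z x : normc z < 1 -> 0 <= pkernel z x.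
Proof.
move=> z1; apply: mulr_ge0; last by rewrite invr_ge0 sqr_ge0.
by rewrite subr_ge0 expr_le1 ?normc_ge0 // ltW.
Qed.

Lemma cont_pkernel z : normc z < 1 -> continuous (pkernel z).
Proof. by move=> z1 x; apply: cvgM; [exact: cvg_cst|exact: cont_pweight]. Qed.

Definition cayley (z : R[i]) : R[i] := (1 + z) / (1 - z).

Lemma cayley_Re z : Re (cayley z) = (1 - normc z ^+ 2) / normc (1 - z) ^+ 2.
Proof.
rewrite /cayley.
have den : (1 - z)^-1 = ((normc (1 - z) ^+ 2)^-1)%:C * conjc (1 - z).
  have -> : ((normc (1 - z) ^+ 2)^-1)%:C = ((1 - z) * conjc (1 - z))^-1.
    by rewrite mulc_conj fmorphV.
  have [->|h] := eqVneq (1 - z) 0; first by rewrite mul0r !invr0 mul0r.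
  rewrite invfM -mulrA mulVf ?mulr1 //.
  by rewrite -normc_gt0 normc_conj normc_gt0.
rewrite den mulrCA.
have -> : (1 + z) * conjc (1 - z) = (1 - normc z ^+ 2) +i* (Im z *+ 2).
  rewrite sqr_normcE; case: z {den} => a b; apply/eqP; rewrite eq_complex /=.
  by apply/andP; split; apply/eqP; ring.
by rewrite cReM /= mul0r subr0 mulrC.
Qed.

Lemma pkernelE z x : pkernel z x = Re (cayley (z^* * expi x)).
Proof. by rewrite cayley_Re normcM normc_conj normc_expi mulr1. Qed.

(** This form exhibits the kernel as the real part of a function analytic in z, so that an analytic
    map can be substituted for z, as in [pkernel_mean]. *)
Lemma pkernel_symE z x : normc z < 1 ->
  pkernel z x = Re ((expi x + z) / (expi x - z)).
Proof.
move=> z1; rewrite pkernelE /cayley.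
have Rc (u : R[i]) : Re u = Re (conjc u) by case: u.
rewrite Rc.
have cV (u : R[i]) : conjc u^-1 = (conjc u)^-1 by exact: fmorphV.
have cM (u v : R[i]) : conjc (u * v) = conjc u * conjc v by exact: rmorphM.
have c1 (u v : R[i]) : conjc (1 + conjc u * v) = 1 + u * conjc v.
  by case: u => a b; case: v => a' b'; apply/eqP; rewrite eq_complex /=; apply/andP; split; apply/eqP; ring.
have c2 (u v : R[i]) : conjc (1 - conjc u * v) = 1 - u * conjc v.
  by case: u => a b; case: v => a' b'; apply/eqP; rewrite eq_complex /=; apply/andP; split; apply/eqP; ring.
rewrite cM cV c1 c2 expi_conj.
have e0 := expi_neq0 x.
have -> : 1 + z / expi x = (expi x + z) / expi x by rewrite mulrDl mulfV.
have -> : 1 - z / expi x = (expi x - z) / expi x by rewrite mulrBl mulfV.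
by rewrite invf_div mulrA divfK.
Qed.

Lemma pkernel_mass z : normc z < 1 -> \int[circ]_x pkernel z x = 1.
Proof.
move=> z1; pose g w := (1 + z^* * w) / (1 - z^* * w).
(* 2 / (1 + |z|) exceeds 1 and stays below the modulus 1 / |z| of the pole, which leaves room for
   the mean value property on the unit circle itself. *)
have [R0 [R01 hR0]] : exists R0 : R, 1 < R0 /\ forall w, normc w < R0 -> 1 - z^* * w != 0.
  have z0 : 0 < 1 + normc z by rewrite ltr_wpDr ?normc_ge0.
  exists (2 / (1 + normc z)); split.
    by rewrite ltr_pdivlMr ?mul1r //; lra.
  move=> w hw; apply/eqP => /(congr1 (fun u => u + z^* * w)); rewrite subrK add0r => h.
  have := congr1 (@normc R) h; rewrite normc1 normcM normc_conj => e.
  move: hw; rewrite ltr_pdivlMr // mulrDr mulr1 mulrC -e.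
  have : normc w >= 1.
    by rewrite e ler_piMl ?normc_ge0 // ltW.
  lra.
have dg w : normc w < R0 -> cdiff g w.
  move=> /hR0 w0; apply: cdiffM.
    apply: cdiffD; first exact: cdiff_cst.
    by apply: cdiffM; [exact: cdiff_cst|exact: cdiff_id].
  apply: cdiffV => //; apply: cdiffB; first exact: cdiff_cst.
  by apply: cdiffM; [exact: cdiff_cst|exact: cdiff_id].
have := @mean_value_Re R g R0 (-1) 1 (fun w h => cdiff_cont (dg w h)) (fun w h _ _ => dg w h).
rewrite ler01 R01 => /(_ isT); rewrite /g mulr0 addr0 subr0 divr1 /= => <-.
by apply: eq_Rintegral => x _; rewrite pkernelE /cayley mul1r.
Qed.

(** The difference quotient of G at z times w / (1 - conj(z) w) vanishes at 0, so by the mean value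
    property the weighted mean of Im G - Im G(z) is 0; [pkernel_mass] normalises the weight. *)
Lemma poisson_Im (G : R[i] -> R[i]) (R0 : R) (z : R[i]) : 1 < R0 ->
  (forall w, normc w < R0 -> cdiff G w) -> normc z < 1 ->
  \int[circ]_x (Im (G (expi x)) * pkernel z x) = Im (G z).
Proof.
move=> R01 dG z1.
have [phi [hphi cphi dphi0]] := cdiff_slope dG (lt_trans z1 R01).
have [R1 [R11 R10 hR1]] : exists R1 : R, [/\ 1 < R1, R1 <= R0 & forall w, normc w < R1 -> 1 - z^* * w != 0].
  exists (Num.min R0 (2 / (1 + normc z))).
  have z0 : 0 < 1 + normc z by rewrite ltr_wpDr ?normc_ge0.
  split.
  - by rewrite lt_min R01 /= ltr_pdivlMr ?mul1r //; lra.
  - by rewrite ge_min lexx.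
  move=> w; rewrite lt_min => /andP[_ hw].
  apply/eqP => /(congr1 (fun u => u + z^* * w)); rewrite subrK add0r => h.
  have := congr1 (@normc R) h; rewrite normc1 normcM normc_conj => e.
  move: hw; rewrite ltr_pdivlMr // mulrDr mulr1 mulrC -e.
  have : normc w >= 1.
    by rewrite e ler_piMl ?normc_ge0 // ltW.
  lra.
pose q (w : R[i]) := w / (1 - z^* * w).
have dq w : normc w < R1 -> cdiff q w.
  move=> w1; apply: cdiffM; first exact: cdiff_id.
  apply: cdiffV; first exact: hR1.
  apply: cdiffB; first exact: cdiff_cst.
  by apply: cdiffM; [exact: cdiff_cst|exact: cdiff_id].
have phiE w : w != z -> phi w = (G w - G z) / (w - z).
  by move=> wz; rewrite hphi mulfK // subr_eq0.
have dphi w : normc w < R1 -> w != z -> cdiff phi w.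
  by move=> w1; apply: dphi0; exact: lt_le_trans R10.
pose f w := phi w * q w.
have cf : disc_cont f R1.
  move=> w w1; apply: ccontM; last exact/cdiff_cont/dq.
  have [->//|wz] := eqVneq w z; exact/cdiff_cont/dphi.
have df w : normc w < R1 -> w != 0 -> normc w != normc z -> cdiff f w.
  move=> w1 _ wz; apply: cdiffM; last exact: dq.
  by apply: dphi => //; apply: contra_neq wz => ->.
have := @mean_value_Im R f R1 (normc z) 1 cf df; rewrite ler01 R11 => /(_ isT).
rewrite {2}/f /q mul0r mulr0 /= => I0.
have cG x : ccont G (1%:C * expi x).
  by apply/cdiff_cont/dG; rewrite normc_circle normr1.
have cI : continuous (fun x : R => Im (G (expi x))).
  have := cont_Im_circle cG; by under eq_fun do rewrite mul1r.
have fE x : Im (f (1%:C * expi x)) = Im (G (expi x)) * pweight z x - Im (G z) * pweight z x.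
  have xz : expi x != z.
    by apply: contraTneq z1 => <-; rewrite normc_expi ltxx.
  rewrite mul1r /f phiE // /q -mulrA pweight_kernel // cImM /= mulr0 add0r cImB.
  by rewrite mulrBl.
have cw := cont_pweight z1.
have i1 : circ.-integrable setT (EFin \o (fun x => Im (G (expi x)) * pweight z x)).
  by apply: circle_cont_integrable => x; apply: cvgM; [exact: cI|exact: cw].
have i2 : circ.-integrable setT (EFin \o (fun x => Im (G z) * pweight z x)).
  by apply: circle_cont_integrable => x; apply: cvgM; [exact: cvg_cst|exact: cw].
have i3 : circ.-integrable setT (EFin \o (pweight z : T -> R)).
  exact: circle_cont_integrable.
have I1 : \int[circ]_x (Im (G (expi x)) * pweight z x) = Im (G z) * \int[circ]_x pweight z x.
  apply/eqP; rewrite -subr_eq0 -RintegralZl // -RintegralB // -[X in _ == X]I0.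
  by apply/eqP; apply: eq_Rintegral => x _; rewrite fE.
have := pkernel_mass z1; rewrite RintegralZl // => mass.
transitivity ((1 - normc z ^+ 2) * \int[circ]_x (Im (G (expi x)) * pweight z x)).
  rewrite -RintegralZl //; apply: eq_Rintegral => x _; rewrite /pkernel; ring.
by rewrite I1 mulrCA mass mulr1.
Qed.

(** The function (e^{ix} + omega(z)) / (e^{ix} - omega(z)) is analytic in z with value 1 at the
    origin. This is where omega(0) = 0 enters subordination. *)
Lemma pkernel_mean (om : R[i] -> R[i]) (r x : R) :
  (forall z, normc z < 1 -> cdiff om z) -> (forall z, normc z < 1 -> normc (om z) < 1) ->
  om 0 = 0 -> 0 <= r < 1 ->
  \int[circ]_t pkernel (om (r%:C * expi t)) x = 1.
Proof.
move=> dom om1 om0 hr.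
pose g z := (expi x + om z) / (expi x - om z).
have dg z : normc z < 1 -> cdiff g z.
  move=> z1; apply: cdiffM.
    by apply: cdiffD; [exact: cdiff_cst|exact: dom].
  apply: cdiffV; last by apply: cdiffB; [exact: cdiff_cst|exact: dom].
  rewrite subr_eq0; apply: contraTneq (om1 _ z1) => <-; by rewrite normc_expi ltxx.
have := @mean_value_Re R g 1 (-1) r (fun w h => cdiff_cont (dg w h)) (fun w h _ _ => dg w h) hr.
have -> : g 0 = 1 by rewrite /g om0 addr0 subr0 mulfV ?expi_neq0.
move=> /= <-.
apply: eq_Rintegral => t _; rewrite pkernel_symE //; apply: om1.
by case/andP: hr => r0 r1; rewrite normc_circle ger0_norm.
Qed.

End PoissonKernel.

Lemma cont_powR_abs (R : realType) (q : R) : 0 < q -> continuous (fun x : R => `|x| `^ q).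
Proof.
move=> q0 b; have [->|b0] := eqVneq b 0.
  rewrite /continuous_at normr0 powR0 ?gt_eqF //; apply/cvgrPdist_lt => e e0.
  near=> x; rewrite sub0r normrN ger0_norm ?powR_ge0 //.
  have -> : e = (e `^ q^-1) `^ q by rewrite -powRrM mulVf ?gt_eqF // powRr1 // ltW.
  apply: gt0_ltr_powR; rewrite ?nnegrE ?powR_ge0 //.
  near: x; apply: cvgr0_norm_lt; first exact: cvg_id.
  by rewrite powR_gt0.
have b1 : 0 < `|b| by rewrite normr_gt0.
have h := @is_derive1_powR R q _ b1.
have c : {for `|b|, continuous (fun x : R => x `^ q)}.
  by apply: differentiable_continuous; apply/derivable1_diffP; exact: (@ex_derive _ _ _ _ _ _ _ h).
exact: (cvg_comp _ _ (@norm_continuous _ R^o b) c).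
Unshelve. all: by end_near. Qed.

(** * Convexity of |x|^p *)

Section PowR.
Context (R : realType) (p : R) (p1 : 1 < p).

Lemma powR_abs_mul (b : R) : `|b| `^ (p - 1) * `|b| = `|b| `^ p.
Proof.
have [->|b0] := eqVneq b 0.
  by rewrite normr0 mulr0 powR0 // gt_eqF // (lt_trans ltr01).
by rewrite -[X in _ * X](powRr1 (normr_ge0 b)) -powRD ?subrK // normr_eq0 b0 implybT.
Qed.

(** Young's inequality for |x| and |b|^(p-1), with exponents p and p/(p-1), gives the supporting
    line of the convex function |x|^p at b whatever the sign of b, including b = 0. *)
Lemma powR_tangent (b x : R) :
  `|b| `^ p + p * `|b| `^ (p - 1) * Num.sg b * (x - b) <= `|x| `^ p.
Proof.
have p0 : 0 < p by exact: lt_trans p1.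
have q0 : 0 < p - 1 by rewrite subr_gt0.
have Y : `|x| * `|b| `^ (p - 1) <= `|x| `^ p / p + `|b| `^ p / (p / (p - 1)).
  have -> : `|b| `^ p = (`|b| `^ (p - 1)) `^ (p / (p - 1)).
    by rewrite -powRrM mulrC divfK // gt_eqF.
  apply: conjugate_powR; rewrite ?normr_ge0 ?powR_ge0 ?divr_gt0 //.
  by field; rewrite !gt_eqF.
have sx : `|b| `^ (p - 1) * (Num.sg b * x) <= `|x| * `|b| `^ (p - 1).
  rewrite mulrC ler_wpM2r ?powR_ge0 //; apply: (le_trans (ler_norm _)).
  by rewrite normrM ler_piMl // normr_sg lern1; case: (b != 0).
have sb : `|b| `^ (p - 1) * (Num.sg b * b) = `|b| `^ p.
  by rewrite -normrEsg powR_abs_mul.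
have {}Y : p * (`|x| * `|b| `^ (p - 1)) <= `|x| `^ p + (p - 1) * `|b| `^ p.
  rewrite -(ler_pM2l p0) mulrDr in Y; apply: (le_trans Y); rewrite le_eqVlt; apply/orP; left.
  by apply/eqP; field; rewrite !gt_eqF.
have : p * (`|b| `^ (p - 1) * (Num.sg b * x)) <= p * (`|x| * `|b| `^ (p - 1)) by rewrite ler_pM2l.
have -> : p * `|b| `^ (p - 1) * Num.sg b * (x - b) =
  p * (`|b| `^ (p - 1) * (Num.sg b * x)) - p * (`|b| `^ (p - 1) * (Num.sg b * b)) by ring.
rewrite sb; move: Y; rewrite mulrBl mul1r.
move: (_ `^ p) (_ `^ p) (p * _) (p * _) (p * _) => a1 a2 a3 a4 a5; lra.
Qed.

Lemma cont_powR_comp (f : R -> R) : continuous f -> continuous (fun x => `|f x| `^ p).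
Proof. by move=> cf x; exact: (cvg_comp _ _ (cf x) (@cont_powR_abs R p (lt_trans ltr01 p1) (f x))). Qed.

End PowR.

Section Littlewood.
Context (R : realType).
Local Notation circ := (circle_measure R).
Local Notation T := (measurableTypeR R).

Lemma EFin_Rint (g : T -> R) : circ.-integrable setT (EFin \o g) ->
  (\int[circ]_x g x)%:E = (\int[circ]_x (g x)%:E)%E.
Proof. by move=> ig; rewrite fineK //; exact: (integrable_fin_num measurableT ig). Qed.

Lemma circ_bounded_cvg (f_ : nat -> T -> R) (f : T -> R) (M : R) :
  (forall n, measurable_fun setT (f_ n)) -> measurable_fun setT f ->
  (forall n x, `|f_ n x| <= M) -> {ae circ, forall x, f_ n x @[n --> \oo] --> f x} ->
  \int[circ]_x f_ n x @[n --> \oo] --> \int[circ]_x f x.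
Proof.
move=> mf_ mf fM cf.
have cE : {ae circ, forall x, setT x -> (EFin \o f_ n) x @[n --> \oo] --> (EFin \o f) x}.
  by apply: filterS cf => x h _; apply/fine_cvgP; split => //; exact: nearW.
have [h1 _ h2] := @dominated_convergence _ T R circ setT measurableT
  (fun n => EFin \o f_ n) (EFin \o f) (EFin \o (fun=> M))
  (fun n => (measurable_EFinP _ _).2 (mf_ n)) ((measurable_EFinP _ _).2 mf)
  cE (circle_cst_integrable M)
  (nearW _ (fun x n _ => (fM n x : (`|(f_ n x)%:E| <= M%:E)%E))).
move: h2; rewrite -EFin_Rint // => /fine_cvgP[_].
by apply: cvg_trans; apply: near_eq_cvg; exact: nearW.
Qed.

Lemma meas_inv (d : measure_display) (S : measurableType d) (f : S -> R) : measurable_fun setT f -> (forall s, 0 <= f s) ->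
  measurable_fun setT (fun s => (f s)^-1).
Proof.
move=> mf f0; have -> : (fun s => (f s)^-1) = (fun s => f s `^ (-1)).
  by apply/funext => s; rewrite powR_inv1.
exact: (measurableT_comp (measurable_powR (-1)) mf).
Qed.

(** Real coordinates make the kernel visibly measurable jointly in the point of the disk and the
    angle, as Tonelli's theorem requires. *)
Lemma pkernel_cosE (z : R[i]) (x : R) : pkernel z x =
  (1 - (Re z ^+ 2 + Im z ^+ 2)) * (1 - 2 * (Re z * cos x + Im z * sin x) + (Re z ^+ 2 + Im z ^+ 2)
     )^-1.
Proof.
rewrite /pkernel /pweight !sqr_normcE; congr (_ * _^-1).
case: z => a b /=.
transitivity (1 - 2 * (a * cos x + b * sin x) + (a ^+ 2 + b ^+ 2) * (cos x ^+ 2 + sin x ^+ 2)).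
  by ring.
by rewrite cos2Dsin2 mulr1.
Qed.

Lemma meas_pkernel (om : T -> R[i]) : measurable_fun setT (fun t => Re (om t)) ->
  measurable_fun setT (fun t => Im (om t)) ->
  measurable_fun setT (fun s : T * T => pkernel (om s.1) s.2).
Proof.
move=> m1 m2.
have M1 : measurable_fun setT (fun s : T * T => Re (om s.1)).
  by apply: (measurableT_comp m1); exact: measurable_fst.
have M2 : measurable_fun setT (fun s : T * T => Im (om s.1)).
  by apply: (measurableT_comp m2); exact: measurable_fst.
have mc : measurable_fun setT (fun s : T * T => cos s.2).
  have h : measurable_fun [set: T] (@cos R : T -> T).
    by apply: continuous_measurable_fun; exact: continuous_cos.
  by apply: (measurableT_comp h); exact: measurable_snd.
have ms : measurable_fun setT (fun s : T * T => sin s.2).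
  have h : measurable_fun [set: T] (@sin R : T -> T).
    by apply: continuous_measurable_fun; exact: continuous_sin.
  by apply: (measurableT_comp h); exact: measurable_snd.
have mq : measurable_fun setT (fun s : T * T => Re (om s.1) ^+ 2 + Im (om s.1) ^+ 2).
  by apply: measurable_funD; exact: measurable_funX.
under eq_fun do rewrite pkernel_cosE.
apply: measurable_funM; first exact: measurable_funB.
apply: meas_inv.
  apply: measurable_funD => //; apply: measurable_funB => //.
  by apply: measurable_funM => //; apply: measurable_funD; exact: measurable_funM.
move=> -[t x] /=; have := cos2Dsin2 x => e.
have -> : 1 - 2 * (Re (om t) * cos x + Im (om t) * sin x) + (Re (om t) ^+ 2 + Im (om t) ^+ 2) =
  (Re (om t) - cos x) ^+ 2 + (Im (om t) - sin x) ^+ 2 + (1 - (cos x ^+ 2 + sin x ^+ 2)) by ring.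
by rewrite e subrr addr0 addr_ge0 // sqr_ge0.
Qed.

Context (p : R) (p1 : 1 < p).

(** Integrate the supporting line of |x|^p at b = Im G(z) against the kernel: the kernel has mass 1,
    and by [poisson_Im] the linear term integrates to 0. *)
Lemma poisson_jensen (G : R[i] -> R[i]) (R0 : R) (z : R[i]) : 1 < R0 ->
  (forall w, normc w < R0 -> cdiff G w) -> normc z < 1 ->
  `|Im (G z)| `^ p <= \int[circ]_x (`|Im (G (expi x))| `^ p * pkernel z x).
Proof.
move=> R01 dG z1.
have P := poisson_Im R01 dG z1.
have Ms := pkernel_mass z1.
set b := Im (G z) in P *.
pose s := p * `|b| `^ (p - 1) * Num.sg b.
have cI : continuous (fun x : R => Im (G (expi x))).
  have cG x : ccont G (1%:C * expi x).
    by apply/cdiff_cont/dG; rewrite normc_circle normr1.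
  have := cont_Im_circle cG; by under eq_fun do rewrite mul1r.
have ck := cont_pkernel z1.
have i1 : circ.-integrable setT (EFin \o (fun x => Im (G (expi x)) * pkernel z x)).
  by apply: circle_cont_integrable => x; apply: cvgM; [exact: cI|exact: ck].
have i2 : circ.-integrable setT (EFin \o (fun x => s * (Im (G (expi x)) * pkernel z x))).
  by apply: circle_cont_integrable => x; apply: cvgM; [exact: cvg_cst|apply: cvgM; [exact: cI|exact: ck]].
have i3 : circ.-integrable setT (EFin \o (fun x => (`|b| `^ p - s * b) * pkernel z x)).
  by apply: circle_cont_integrable => x; apply: cvgM; [exact: cvg_cst|exact: ck].
have i4 : circ.-integrable setT (EFin \o (pkernel z : T -> R)).
  exact: circle_cont_integrable.
have i5 : circ.-integrable setT (EFin \o (fun x => `|Im (G (expi x))| `^ p * pkernel z x)).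
  apply: circle_cont_integrable => x; apply: cvgM; last exact: ck.
  exact: (cont_powR_comp p1 cI).
have -> : `|b| `^ p = \int[circ]_x (s * (Im (G (expi x)) * pkernel z x) + (`|b| `^ p - s * b) * pkernel z x).
  rewrite RintegralD // (RintegralZl _ _ i1) // (RintegralZl _ _ i4) // P Ms mulr1.
  by rewrite addrCA subrr addr0.
apply: le_Rintegral => //; first exact: circ_integrableD.
move=> x _ /=.
have -> : s * (Im (G (expi x)) * pkernel z x) + (`|b| `^ p - s * b) * pkernel z x =
  (`|b| `^ p + s * (Im (G (expi x)) - b)) * pkernel z x by ring.
by apply: ler_wpM2r; [exact: pkernel_ge0|exact: powR_tangent].
Qed.

(** [poisson_jensen] at the point omega(r e^{it}), integrated over t; after Tonelli the inner mean
    of the kernel is 1 by [pkernel_mean]. The factor rho makes G(rho w) analytic beyond the closed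
    disk, so that Poisson's formula holds on the unit circle. *)
Lemma littlewood (G om : R[i] -> R[i]) (rho r : R) :
  (forall z, normc z < 1 -> cdiff G z) -> (forall z, normc z < 1 -> cdiff om z) ->
  (forall z, normc z < 1 -> normc (om z) < 1) -> om 0 = 0 -> 0 < rho < 1 -> 0 <= r < 1 ->
  \int[circ]_t (`|Im (G (rho%:C * om (r%:C * expi t)))| `^ p) <=
  \int[circ]_x (`|Im (G (rho%:C * expi x))| `^ p).
Proof.
move=> dG dom om1 om0 /andP[rho0 rho1] hr; have /andP[r0 r1] := hr.
pose Gr w := G (rho%:C * w).
have nr w : normc w < rho^-1 -> normc (rho%:C * w) < 1.
  by move=> w1; rewrite normcM normc_real gtr0_norm // mulrC -ltr_pdivlMr // mul1r.
have R01 : 1 < rho^-1 by rewrite invf_gt1.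
have dGr w : normc w < rho^-1 -> cdiff Gr w.
  move=> w1; apply: (@cdiff_comp _ G (fun w => rho%:C * w)); last exact/dG/nr.
  by apply: cdiffM; [exact: cdiff_cst|exact: cdiff_id].
have z1 t : normc (r%:C * expi t : R[i]) < 1 by rewrite normc_circle ger0_norm.
have co t : ccont om (r%:C * expi t) by exact/cdiff_cont/dom.
have cGo t : ccont (fun w => Gr (om w)) (r%:C * expi t).
  apply: ccont_comp; first exact: co.
  by apply/cdiff_cont/dGr; apply: lt_trans R01; exact: om1.
have cI : continuous (fun x : R => Im (Gr (expi x))).
  have cG x : ccont Gr (1%:C * expi x).
    by apply/cdiff_cont/dGr; rewrite normc_circle normr1.
  have := cont_Im_circle cG; by under eq_fun do rewrite mul1r.
pose h x := `|Im (Gr (expi x))| `^ p.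
have ch : continuous h by exact: (cont_powR_comp p1 cI).
have ih : circ.-integrable setT (EFin \o (h : T -> R)) by exact: circle_cont_integrable.
have h0 x : 0 <= h x by exact: powR_ge0.
have cl : continuous (fun t : R => `|Im (Gr (om (r%:C * expi t)))| `^ p).
  by exact: (cont_powR_comp p1 (cont_Im_circle cGo)).
have il : circ.-integrable setT (EFin \o (fun t : T => `|Im (Gr (om (r%:C * expi t)))| `^ p)).
  exact: circle_cont_integrable.
suff : (\int[circ]_t (`|Im (Gr (om (r%:C * expi t)))| `^ p)%:E <= \int[circ]_x (h x)%:E)%E.
  by have <- := EFin_Rint ih; have <- := EFin_Rint il; rewrite lee_fin.
pose k (s : T * T) := (h s.2 * pkernel (om (r%:C * expi s.1)) s.2)%:E.
have k0 s : (0 <= k s)%E by rewrite lee_fin mulr_ge0 // pkernel_ge0 // om1.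
have mk : measurable_fun setT k.
  apply/measurable_EFinP; apply: measurable_funM.
    have mh : measurable_fun [set: T] (h : T -> T) by exact: continuous_measurable_fun.
    by apply: (measurableT_comp mh); exact: measurable_snd.
  by apply: (@meas_pkernel (fun t => om (r%:C * expi t))); [exact: meas_circle_Re|exact: meas_circle_Im].
have F : (\int[circ]_t \int[circ]_x k (t, x) = \int[circ]_x \int[circ]_t k (t, x))%E.
  exact: (@fubini_tonelli _ _ T T R (@circF R) (@circF R) k mk k0).
apply: (@le_trans _ _ (\int[circ]_t \int[circ]_x k (t, x))%E).
  apply: ge0_le_integral; first exact: measurableT.
  - by move=> t _; rewrite lee_fin powR_ge0.
  - by apply/measurable_EFinP; exact: continuous_measurable_fun.
  - exact: (@measurable_fun_fubini_tonelli_F _ _ T T R (@circF R) k mk).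
  - move=> t _; rewrite -EFin_Rint /=; last first.
      apply: circle_cont_integrable => x; apply: cvgM; first exact: ch.
      exact/cont_pkernel/om1.
    by rewrite lee_fin; apply: (poisson_jensen R01 dGr); exact: om1.
rewrite F; apply: ge0_le_integral; first exact: measurableT.
- by move=> x _; apply: integral_ge0.
- exact: (@measurable_fun_fubini_tonelli_G _ _ T T R (@circF R) k mk).
- by apply/measurable_EFinP; exact: continuous_measurable_fun.
move=> x _; have ik : circ.-integrable setT (EFin \o (fun t : T => pkernel (om (r%:C * expi t)) x)).
  apply: circle_cont_integrable.
  have c1 t : ccont (fun w => (expi x + om w) / (expi x - om w)) (r%:C * expi t).
    apply: ccontM; first by apply: ccontD; [exact: ccont_cst|exact: co].
    apply: ccontV; last by apply: ccontB; [exact: ccont_cst|exact: co].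
    by rewrite subr_eq0; apply: contraTneq (om1 _ (z1 t)) => <-; rewrite normc_expi ltxx.
  have -> : (fun t : R => pkernel (om (r%:C * expi t)) x) =
      (fun t => Re ((expi x + om (r%:C * expi t)) / (expi x - om (r%:C * expi t)))).
    by apply/funext => t; exact: (pkernel_symE x (om1 _ (z1 t))).
  exact: (cont_Re_circle c1).
rewrite -EFin_Rint /=; last exact: (integrableZl _ _ ik).
have e := RintegralZl (h x) measurableT ik.
by rewrite lee_fin e (pkernel_mean x dom om1 om0 hr) mulr1.
Qed.

Lemma meas_powR_abs (f : T -> R) : measurable_fun setT f ->
  measurable_fun setT (fun x => `|f x| `^ p).
Proof.
move=> mf; have mp : measurable_fun [set: T] (fun x : T => `|x| `^ p : T).
  by apply: continuous_measurable_fun; apply: cont_powR_abs; exact: lt_trans p1.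
exact: (measurableT_comp mp mf).
Qed.

Lemma powR_abs_bound (M x : R) : `|x| <= M -> `| `|x| `^ p| <= M `^ p.
Proof.
move=> xM; rewrite ger0_norm ?powR_ge0 //; apply: ge0_ler_powR => //.
- exact/ltW/(lt_trans ltr01).
- by rewrite nnegrE; apply: le_trans xM.
Qed.

(** Two limits in this order: rho -> 1 with the circle of omega fixed, then the radius of that
    circle tends to 1. The bound M on |Im G| dominates both. *)
Lemma littlewood_boundary (G om : R[i] -> R[i]) (M : R) (v g : T -> R) :
  (forall z, normc z < 1 -> cdiff G z) -> (forall z, normc z < 1 -> cdiff om z) ->
  (forall z, normc z < 1 -> normc (om z) < 1) -> om 0 = 0 ->
  (forall z, normc z < 1 -> `|Im (G z)| <= M) ->
  measurable_fun setT v -> measurable_fun setT g ->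
  {ae circ, forall x, Im (G (om ((rseq R n)%:C * expi x))) @[n --> \oo] --> v x} ->
  {ae circ, forall x, Im (G ((rseq R n)%:C * expi x)) @[n --> \oo] --> g x} ->
  \int[circ]_x (`|v x| `^ p) <= \int[circ]_x (`|g x| `^ p).
Proof.
move=> dG dom om1 om0 GM mv mg cv cg.
have r1 n x : normc ((rseq R n)%:C * expi x : R[i]) < 1.
  by rewrite normc_circle ger0_norm ?rseq_ge0 // rseq_lt1.
have rr n : 0 <= rseq R n < 1 by rewrite rseq_ge0 rseq_lt1.
have rp n : 0 < rseq R n < 1 by rewrite rseq_lt1 subr_gt0 invf_lt1 // ltr1n.
have cp (u : nat -> R) (l : R) : u n @[n --> \oo] --> l -> `|u n| `^ p @[n --> \oo] --> `|l| `^ p.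
  by move=> ul; exact: (cvg_comp _ _ ul (@cont_powR_abs R p (lt_trans ltr01 p1) l)).
have rG : \int[circ]_x (`|Im (G ((rseq R n)%:C * expi x))| `^ p) @[n --> \oo] -->
    \int[circ]_x (`|g x| `^ p).
  apply: (circ_bounded_cvg (M := M `^ p)).
  - by move=> n; apply: meas_powR_abs; apply: meas_circle_Im => x; exact/cdiff_cont/dG.
  - exact: meas_powR_abs.
  - by move=> n x; apply: powR_abs_bound; exact: GM.
  - by apply: (@filterS _ _ (ae_filter_ringOfSetsType circ) _ _ _ cg) => x; exact: cp.
have lG k : \int[circ]_x (`|Im (G (om ((rseq R k)%:C * expi x)))| `^ p) <= \int[circ]_x (`|g x| `^ p).
  have nG n x : normc ((rseq R n)%:C * om ((rseq R k)%:C * expi x)) < 1.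
    rewrite normcM normc_real ger0_norm ?rseq_ge0 // -[1]mulr1.
    by apply: ltr_pM; rewrite ?rseq_ge0 ?normc_ge0 ?rseq_lt1 // om1.
  have cI : \int[circ]_x (`|Im (G ((rseq R n)%:C * om ((rseq R k)%:C * expi x)))| `^ p) @[n --> \oo] -->
     \int[circ]_x (`|Im (G (om ((rseq R k)%:C * expi x)))| `^ p).
    apply: (circ_bounded_cvg (M := M `^ p)).
    - move=> n; apply: meas_powR_abs.
      apply: (@meas_circle_Im R (fun w => G ((rseq R n)%:C * om w))) => x.
      apply: (@ccont_comp R G (fun w => (rseq R n)%:C * om w)); last exact/cdiff_cont/dG/nG.
      by apply: ccontM; [exact: ccont_cst|exact/cdiff_cont/dom].
    - apply: meas_powR_abs; apply: (@meas_circle_Im R (fun w => G (om w))) => x.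
      by apply: ccont_comp; [exact/cdiff_cont/dom|exact/cdiff_cont/dG/om1].
    - by move=> n x; apply: powR_abs_bound; exact: GM.
    - apply: aeW => x; apply: cp; apply: cvg_Im.
      have /ccontE c := cdiff_cont (dG _ (om1 _ (r1 k x))).
      apply: (cvg_comp (fun n => ((rseq R n)%:C * om ((rseq R k)%:C * expi x) : R[i]^o)) (G : R[i]^o -> R[i]^o) _ c).
      rewrite -[X in _ `=>` nbhs X]mul1r; apply: cvgZC; last exact: cvgC_cst.
      by apply: cvg_complex; [exact: cvg_rseq|exact: cvg_cst].
  apply: (ler_cvg_to cI rG); apply: nearW => n.
  exact: (littlewood dG dom om1 om0 (rp n) (rr k)).
suff cI : \int[circ]_x (`|Im (G (om ((rseq R n)%:C * expi x)))| `^ p) @[n --> \oo] -->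
    \int[circ]_x (`|v x| `^ p).
  by apply: (ler_cvg_to cI (@cvg_cst _ _ _ _ _)); apply: nearW => k; exact: lG.
apply: (circ_bounded_cvg (M := M `^ p)).
- move=> n; apply: meas_powR_abs; apply: (@meas_circle_Im R (fun w => G (om w))) => x.
  by apply: ccont_comp; [exact/cdiff_cont/dom|exact/cdiff_cont/dG/om1].
- exact: meas_powR_abs.
- by move=> n x; apply: powR_abs_bound; exact/GM/om1.
- by apply: (@filterS _ _ (ae_filter_ringOfSetsType circ) _ _ _ cv) => x; exact: cp.
Qed.

End Littlewood.

(** * The conformal map of the disk onto a half strip *)

Section Asinh.
Context (R : realType).
Implicit Types (x y c s : R) (z w : R[i]).

Definition sh x : R := (expR x - expR (- x)) / 2.
Definition ch x : R := (expR x + expR (- x)) / 2.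
Definition acosh c : R := ln (c + Num.sqrt (c ^+ 2 - 1)).

Lemma ch2_sh2 x : ch x ^+ 2 - sh x ^+ 2 = 1.
Proof.
have e : expR x * expR (- x) = 1 by rewrite -expRD subrr expR0.
transitivity (expR x * expR (- x)) => //.
by rewrite /ch /sh; field.
Qed.

Lemma sh_ge0 x : 0 <= x -> 0 <= sh x.
Proof.
move=> x0; apply: divr_ge0 => //; rewrite subr_ge0 ler_expR.
by apply: (le_trans _ x0); rewrite oppr_le0.
Qed.

Lemma sh_gt0 x : 0 < x -> 0 < sh x.
Proof.
move=> x0; apply: divr_gt0 => //; rewrite subr_gt0 ltr_expR.
by apply: (lt_trans _ x0); rewrite oppr_lt0.
Qed.

Lemma ch_ge1 x : 1 <= ch x.
Proof.
have e : expR x * expR (- x) = 1 by rewrite -expRD subrr expR0.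
have := sqr_ge0 (expR x - expR (- x)) => h.
have : 1 <= ch x ^+ 2.
  by rewrite -(ch2_sh2 x) gerBl sqr_ge0.
have c0 : 0 <= ch x by rewrite divr_ge0 // addr_ge0 ?expR_ge0.
by rewrite -{1}(expr1n _ 2) ler_pXn2r // nnegrE.
Qed.

Lemma ch_sh x : ch x + sh x = expR x.
Proof. by rewrite /ch /sh; field. Qed.

Lemma sqrt_ch x : 0 <= x -> Num.sqrt (ch x ^+ 2 - 1) = sh x.
Proof.
move=> x0; have -> : ch x ^+ 2 - 1 = sh x ^+ 2 by rewrite -(ch2_sh2 x); ring.
by rewrite sqrtr_sqr ger0_norm // sh_ge0.
Qed.

Lemma acoshK x : 0 <= x -> acosh (ch x) = x.
Proof. by move=> x0; rewrite /acosh sqrt_ch // ch_sh expRK. Qed.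

Lemma acosh_exp c : 1 <= c -> expR (acosh c) = c + Num.sqrt (c ^+ 2 - 1).
Proof.
move=> c1; rewrite lnK // posrE; have := sqrtr_ge0 (c ^+ 2 - 1) => h; lra.
Qed.

Lemma acosh_expN c : 1 <= c -> expR (- acosh c) = c - Num.sqrt (c ^+ 2 - 1).
Proof.
move=> c1; rewrite expRN acosh_exp //.
have h := sqrtr_ge0 (c ^+ 2 - 1).
have q : Num.sqrt (c ^+ 2 - 1) ^+ 2 = c ^+ 2 - 1.
  by rewrite sqr_sqrtr // subr_ge0 -{1}(expr1n _ 2) ler_pXn2r ?nnegrE //; lra.
have n0 : c + Num.sqrt (c ^+ 2 - 1) != 0 by apply/eqP => e; lra.
apply: (mulfI n0); rewrite mulfV //.
move: q; move: (Num.sqrt _) => t q.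
transitivity (c ^+ 2 - t ^+ 2); [rewrite q|]; ring.
Qed.

Lemma ch_acosh c : 1 <= c -> ch (acosh c) = c.
Proof. by move=> c1; rewrite /ch acosh_exp // acosh_expN //; field. Qed.

Lemma sh_acosh c : 1 <= c -> sh (acosh c) = Num.sqrt (c ^+ 2 - 1).
Proof. by move=> c1; rewrite /sh acosh_exp // acosh_expN //; field. Qed.

Lemma acosh_ge0 c : 1 <= c -> 0 <= acosh c.
Proof.
move=> c1; apply: ln_ge0; have := sqrtr_ge0 (c ^+ 2 - 1); lra.
Qed.

Lemma cvg_acosh (T : Type) (F : set_system T) {FF : ProperFilter F} (u : T -> R) (l : R) :
  1 <= l -> u @ F --> l -> (fun t => acosh (u t)) @ F --> acosh l.
Proof.
move=> l1 ul; rewrite /acosh.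
have c1 : (fun t => u t + Num.sqrt (u t ^+ 2 - 1)) @ F --> l + Num.sqrt (l ^+ 2 - 1).
  apply: cvgD => //.
  have c2 : (fun t => u t ^+ 2 - 1) @ F --> l ^+ 2 - 1.
    by apply: cvgB; [exact: (cvgM ul ul)|exact: cvg_cst].
  exact: (cvg_comp _ _ c2 (@sqrt_continuous R _)).
have p : 0 < l + Num.sqrt (l ^+ 2 - 1) by have := sqrtr_ge0 (l ^+ 2 - 1); lra.
exact: (cvg_comp _ _ c1 (continuous_ln p)).
Qed.

Lemma asinN x : -1 <= x <= 1 -> asin (- x) = - asin x.
Proof.
move=> x1; have [/andP[h1 h2] h3] := asin_def x1.
rewrite -{1}h3 -sinN sinK // in_itv /=; apply/andP; split; lra.
Qed.

Lemma asin_pi2 : asin (1 : R) = pi / 2.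
Proof.
have h := @pi_gt0 R.
have e : asin (sin (pi / 2)) = pi / 2 :> R.
  by apply: sinK; rewrite in_itv /= lexx andbT; lra.
by rewrite sin_pihalf in e.
Qed.

(** The endpoints need a separate argument, asin having no derivative there; they do occur, since
    [foc_dif] is 1 or -1 on the imaginary axis beyond the foci. *)
Lemma cvg_asin (T : Type) (F : set_system T) {FF : ProperFilter F} (u : T -> R) (l : R) :
  (forall t, -1 <= u t <= 1) -> -1 <= l <= 1 -> u @ F --> l -> (fun t => asin (u t)) @ F --> asin l.
Proof.
have at1 (v : T -> R) : (forall t, -1 <= v t <= 1) -> v @ F --> (1 : R) ->
    (fun t => asin (v t)) @ F --> asin (1 : R).
  move=> v1 cv; apply/cvgrPdist_le => e e0; rewrite asin_pi2.
  pose d := Num.min e 1; have d0 : 0 < d by rewrite lt_min e0 ltr01.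
  have d1 : d <= 1 by rewrite ge_min lexx orbT.
  have de : d <= e by rewrite ge_min lexx.
  have p2 := @pi_ge2 R.
  have cd : cos d < 1.
    by rewrite -[X in _ < X]cos0 ltr_cos // in_itv /=; apply/andP; split; lra.
  have cd0 : 0 < 1 - cos d by rewrite subr_gt0.
  move/cvgrPdist_lt : cv => /(_ _ cd0); apply: filterS => t ht.
  have [/andP[h1 h2] h3] := asin_def (v1 t).
  rewrite ger0_norm ?subr_ge0 //.
  suff : pi / 2 - d <= asin (v t) by move: de; lra.
  rewrite leNgt; apply/negP => hlt.
  have : sin (asin (v t)) < sin (pi / 2 - d).
    by rewrite ltr_sin // in_itv /=; apply/andP; split; lra.
  rewrite h3 sinB sin_pihalf cos_pihalf mul1r mul0r subr0 => h4.
  by move: ht; rewrite ltNge ger0_norm; [rewrite lerD2l lerN2 ltW|have /andP[_] := v1 t; rewrite subr_ge0].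
move=> u1 l1 ul.
have [l1e|ln1] := eqVneq l 1; first by rewrite l1e; apply: at1 => //; rewrite -l1e.
have [lm1|lnm1] := eqVneq l (-1).
  have h : (fun t => asin (- u t)) @ F --> asin (1 : R).
    apply: (at1 (fun t => - u t)); first by move=> t; case/andP: (u1 t) => a b; rewrite lerN2 b lerNl a.
    by rewrite -[X in _ --> X]opprK -lm1; exact: cvgN.
  rewrite lm1 asinN; last by rewrite lexx -subr_ge0 opprK addr_ge0.
  have -> : (fun t => asin (u t)) = (fun t => - asin (- u t)).
    by apply/funext => t; rewrite asinN // opprK.
  exact: cvgN.
have l2 : -1 < l < 1 by case/andP: l1 => a b; rewrite !lt_neqAle a b eq_sym lnm1 ln1.
exact: (cvg_comp _ _ ul (continuous_asin l2)).
Qed.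

(* Elliptic coordinates with foci i and -i: for z = sinh(alpha + i beta), half the
   sum and half the difference of the distances to -i and i are cosh(alpha) and
   sin(beta). *)
Definition foc_sum z : R := (normc (z + 'i) + normc (z - 'i)) / 2.
Definition foc_dif z : R := (normc (z + 'i) - normc (z - 'i)) / 2.
Definition asinhc z : R[i] := acosh (foc_sum z) +i* asin (foc_dif z).
Definition sinhc w : R[i] := (sh (Re w) * cos (Im w)) +i* (ch (Re w) * sin (Im w)).

Lemma normci : normc ('i : R[i]) = 1.
Proof. by rewrite /= expr0n add0r expr1n sqrtr1. Qed.

Lemma foc_sum_ge1 z : 1 <= foc_sum z.
Proof.
have := normc_triangle (z + 'i) (- (z - 'i)).
have -> : z + 'i + - (z - 'i) = 2%:C * 'i.
  by case: z => a b; apply/eqP; rewrite eq_complex /=; apply/andP; split; apply/eqP; ring.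
rewrite normcM normci normc_real normcN mulr1 ger0_norm // => h.
by rewrite /foc_sum ler_pdivlMr // mul1r.
Qed.

Lemma foc_dif_le1 z : -1 <= foc_dif z <= 1.
Proof.
have e1 := normc_triangle (z - 'i) (2%:C * 'i).
have e2 := normc_triangle (z + 'i) (- (2%:C * 'i)).
have i2 : z - 'i + 2%:C * 'i = z + 'i.
  by case: z {e1 e2} => a b; apply/eqP; rewrite eq_complex /=; apply/andP; split; apply/eqP; ring.
have i3 : z + 'i - 2%:C * 'i = z - 'i.
  by case: z {e1 e2 i2} => a b; apply/eqP; rewrite eq_complex /=; apply/andP; split; apply/eqP; ring.
have i4 : normc (2%:C * 'i : R[i]) = 2 by rewrite normcM normci normc_real mulr1 ger0_norm.
move: e1 e2; rewrite i2 i3 normcN i4 /foc_dif => e1 e2.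
by rewrite ler_pdivrMr // ler_pdivlMr //; apply/andP; split; lra.
Qed.

Lemma foc_mul z : foc_sum z * foc_dif z = Im z.
Proof.
have h : foc_sum z * foc_dif z = (normc (z + 'i) ^+ 2 - normc (z - 'i) ^+ 2) / 4.
  by rewrite /foc_sum /foc_dif; field.
by rewrite h !sqr_normcE; case: z {h} => a b /=; field.
Qed.

Lemma foc_sqr z : foc_sum z ^+ 2 + foc_dif z ^+ 2 = normc z ^+ 2 + 1.
Proof.
have h : foc_sum z ^+ 2 + foc_dif z ^+ 2 = (normc (z + 'i) ^+ 2 + normc (z - 'i) ^+ 2) / 2.
  by rewrite /foc_sum /foc_dif; field.
by rewrite h !sqr_normcE; case: z {h} => a b /=; field.
Qed.

Lemma foc_Re z : (foc_sum z ^+ 2 - 1) * (1 - foc_dif z ^+ 2) = Re z ^+ 2.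
Proof.
transitivity (foc_sum z ^+ 2 + foc_dif z ^+ 2 - 1 - (foc_sum z * foc_dif z) ^+ 2); first ring.
by rewrite foc_sqr foc_mul sqr_normcE; ring.
Qed.

(** [foc_mul] gives the imaginary part; [foc_Re] gives the square of the real part, and Re z >= 0
    selects the sign of the root. *)
Lemma asinhcK z : 0 <= Re z -> sinhc (asinhc z) = z.
Proof.
move=> z0; rewrite /sinhc /=.
have c1 := foc_sum_ge1 z; have s1 := foc_dif_le1 z.
rewrite sh_acosh // ch_acosh // cos_asin // asinK; last by rewrite in_itv.
rewrite foc_mul -sqrtrM; last by rewrite subr_ge0 -{1}(expr1n _ 2) ler_pXn2r ?nnegrE // (le_trans _ c1).
by rewrite foc_Re sqrtr_sqr ger0_norm //; case: z {z0 c1 s1}.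
Qed.

Lemma sinhcK w : 0 <= Re w -> - (pi / 2) <= Im w <= pi / 2 -> asinhc (sinhc w) = w.
Proof.
move=> w0 wI; have cI := cos_ge0_pihalf wI.
have nP : normc (sinhc w + 'i) = ch (Re w) + sin (Im w).
  have -> : normc (sinhc w + 'i) = Num.sqrt (normc (sinhc w + 'i) ^+ 2).
    by rewrite sqrtr_sqr ger0_norm // normc_ge0.
  have -> : normc (sinhc w + 'i) ^+ 2 = (ch (Re w) + sin (Im w)) ^+ 2.
    rewrite sqr_normcE /sinhc /=.
    have e1 := ch2_sh2 (Re w); have e2 := cos2sin2 (Im w).
    transitivity (sh (Re w) ^+ 2 * cos (Im w) ^+ 2 + (ch (Re w) * sin (Im w) + 1) ^+ 2); first ring.
    have -> : sh (Re w) ^+ 2 = ch (Re w) ^+ 2 - 1 by rewrite -e1; ring.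
    by rewrite e2; ring.
  rewrite sqrtr_sqr ger0_norm //; have := ch_ge1 (Re w); have := sin_geN1 (Im w); lra.
have nM : normc (sinhc w - 'i) = ch (Re w) - sin (Im w).
  have -> : normc (sinhc w - 'i) = Num.sqrt (normc (sinhc w - 'i) ^+ 2).
    by rewrite sqrtr_sqr ger0_norm // normc_ge0.
  have -> : normc (sinhc w - 'i) ^+ 2 = (ch (Re w) - sin (Im w)) ^+ 2.
    rewrite sqr_normcE /sinhc /=.
    have e1 := ch2_sh2 (Re w); have e2 := cos2sin2 (Im w).
    transitivity (sh (Re w) ^+ 2 * cos (Im w) ^+ 2 + (ch (Re w) * sin (Im w) - 1) ^+ 2); first ring.
    have -> : sh (Re w) ^+ 2 = ch (Re w) ^+ 2 - 1 by rewrite -e1; ring.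
    by rewrite e2; ring.
  rewrite sqrtr_sqr ger0_norm //; have := ch_ge1 (Re w); have := sin_le1 (Im w); lra.
have e1 : foc_sum (sinhc w) = ch (Re w) by rewrite /foc_sum nP nM; field.
have e2 : foc_dif (sinhc w) = sin (Im w) by rewrite /foc_dif nP nM; field.
rewrite /asinhc e1 e2 acoshK // sinK; last by rewrite in_itv.
by case: w {w0 wI cI nP nM e1 e2}.
Qed.

Lemma cvg_asinhc (T : Type) (F : set_system T) {FF : ProperFilter F} (u : T -> R[i]^o) (l : R[i]^o) :
  u @ F --> l -> (fun t => asinhc (u t) : R[i]^o) @ F --> (asinhc l : R[i]^o).
Proof.
move=> ul.
have cP : (fun t => normc (u t + 'i)) @ F --> normc (l + 'i).
  by apply: cvg_normc; apply: (@cvgD R[i] R[i]^o); [exact: ul|exact: cvgC_cst].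
have cM : (fun t => normc (u t - 'i)) @ F --> normc (l - 'i).
  by apply: cvg_normc; apply: (@cvgB R[i] R[i]^o); [exact: ul|exact: cvgC_cst].
apply: cvg_complex.
  apply: cvg_acosh; first exact: foc_sum_ge1.
  by apply: cvgM; [exact: cvgD|exact: cvg_cst].
apply: cvg_asin; [by move=> t; exact: foc_dif_le1|exact: foc_dif_le1|].
by apply: cvgM; [exact: cvgB|exact: cvg_cst].
Qed.

Lemma ccont_asinhc z : ccont asinhc z.
Proof. by apply/ccontE; apply: (@cvg_asinhc _ (nbhs (z : R[i]^o)) _ id); exact: cvg_id. Qed.

Lemma sinhcE w : sinhc w = (2^-1)%:C * (cexp w - cexp (- w)).
Proof.
case: w => a b; rewrite /sinhc /cexp /sh /ch /expi /= cosN sinN; apply/eqP.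
by rewrite eq_complex /=; apply/andP; split; apply/eqP; field.
Qed.

Lemma cdiff_sinhc w : cdiff sinhc w.
Proof.
have -> : sinhc = (fun w => (2^-1)%:C * (cexp w - cexp (- w))).
  by apply/funext => u; exact: sinhcE.
apply: cdiffM; first exact: cdiff_cst.
apply: cdiffB; first exact: cdiff_cexp.
exact: (cdiff_comp (cdiffN (cdiff_id w)) (cdiff_cexp (- w))).
Qed.

(** The slope of g is the reciprocal of that of f along g. Growth of f at least linear in the
    positive real direction from g(z) keeps this slope from vanishing at g(z). *)
Lemma cdiff_inverse (f g : R[i] -> R[i]) z : cdiff f (g z) -> ccont g z ->
  (\forall u \near (z : R[i]^o), f (g u) = u) ->
  (exists2 c, 0 < c & forall h, 0 < h -> c * h <= normc (f (g z + h%:C) - f (g z))) ->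
  cdiff g z.
Proof.
move=> [phi hphi cphi] cg fg [c c0 hc].
have fz : f (g z) = z by exact: (nbhs_singleton fg).
have p0 : phi (g z) != 0.
  apply/eqP => e.
  have [d d0 hd] := (ccontP phi (g z)).1 cphi _ c0.
  have d20 : 0 < d / 2 by rewrite divr_gt0.
  have := hd (g z + (d / 2)%:C); rewrite addrAC subrr add0r normc_real gtr0_norm // => /(_ _).
  have -> : d / 2 < d by rewrite ltr_pdivrMr // mulrDr mulr1 ltrDl.
  move=> /(_ isT); rewrite e subr0 => h1.
  have := hc _ d20; rewrite hphi addrAC subrr add0r normcM normc_real gtr0_norm //.
  by rewrite ler_pM2r // leNgt h1.
have cpg : ccont (fun u => phi (g u)) z by exact: ccont_comp.
have n0 := ccont_neq0 cpg p0.
exists (fun u => if u == z then (phi (g z))^-1 else (g u - g z) / (u - z)).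
  move=> u; case: eqP => [->|/eqP uz]; first by rewrite !subrr mulr0.
  by rewrite divfK // subr_eq0.
apply: (@ccont_near _ _ (fun u => (phi (g u))^-1)); last exact: ccontV.
near=> u; case: eqP => [->//|/eqP uz].
have pu : phi (g u) != 0 by near: u.
have fu : f (g u) = u by near: u.
have := hphi (g u); rewrite fu fz => e.
apply: (mulIf (x := u - z)); first by rewrite subr_eq0.
by rewrite divfK ?subr_eq0 // e mulrA mulVf // mul1r.
Unshelve. all: by end_near. Qed.

Lemma asin_lt_cos s : -1 < s < 1 -> 0 < cos (asin s).
Proof.
move=> /andP[s1 s2]; apply: cos_gt0_pihalf; apply/andP; split.
  by apply: asin_gtNpi2; rewrite s1 ltW.
by apply: asin_ltpi2; rewrite s2 ltW.
Qed.

Lemma foc_dif_lt1 z : 0 < Re z -> -1 < foc_dif z < 1.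
Proof.
move=> z0; have /andP[h1 h2] := foc_dif_le1 z; have e := foc_Re z.
rewrite !lt_neqAle h1 h2 !andbT; apply/andP; split; apply/eqP => h.
  by move: e; rewrite -h sqrrN expr1n subrr mulr0 => /esym/eqP; rewrite expf_eq0 gt_eqF.
by move: e; rewrite h expr1n subrr mulr0 => /esym/eqP; rewrite expf_eq0 gt_eqF.
Qed.

Lemma cdiff_asinhc z : 0 < Re z -> cdiff asinhc z.
Proof.
move=> z0; apply: (cdiff_inverse (f := sinhc)).
- exact: cdiff_sinhc.
- exact: ccont_asinhc.
- have := (@cvg_ReC _ z) => /cvgrPdist_lt /(_ _ z0); apply: filterS => u hu.
  apply: asinhcK; move: hu; rewrite ltr_norml => /andP[_]; lra.
have k0 := asin_lt_cos (foc_dif_lt1 z0).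
(* For w = alpha + i beta, Re(sinh(w + h) - sinh(w)) = (sh(alpha + h) - sh(alpha)) cos(beta), and
   the first factor is at least h / 2 when alpha >= 0; Re z > 0 makes cos(beta) positive. *)
exists (cos (asin (foc_dif z)) / 2); first by rewrite divr_gt0.
move=> h h0; apply: le_trans (normc_Re _); apply: le_trans (ler_norm _).
rewrite cReB /sinhc cReD cImD /= addr0 -mulrBl mulrC mulrCA [leRHS]mulrC ler_pM2l //.
have a0 := acosh_ge0 (foc_sum_ge1 z); move: (acosh _) a0 => a a0.
have -> : sh (a + h) - sh a = (expR h - 1) * (expR a + expR (- (a + h))) / 2.
  rewrite /sh opprD !expRD (expRN h); field.
  by rewrite gt_eqF // expR_gt0.
have h1 : h <= expR h - 1 by have := expR_ge1Dx h; lra.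
have h2 : 1 <= expR a + expR (- (a + h)).
  have := expR_ge1Dx a; have := expR_ge0 (- (a + h)); lra.
have := ler_pM (ltW h0) ler01 h1 h2; rewrite mulr1; lra.
Qed.

End Asinh.

(** * The strip map, its boundary values and its level sets *)

Section StripMap.
Context (R : realType).
Local Notation circ := (circle_measure R).
Local Notation T := (measurableTypeR R).
Local Notation pi2 := (2 * pi : R).
Implicit Types (z w : R[i]) (X : R).

Definition strip_map X z : R[i] := (2 / pi)%:C * asinhc (X%:C * cayley z).

Lemma disc_neq1 z : normc z < 1 -> 1 - z != 0.
Proof. by apply: contraTneq => /subr0_eq <-; rewrite normc1 ltxx. Qed.

Lemma cayley_Re_gt0 z : normc z < 1 -> 0 < Re (cayley z).
Proof.
move=> z1; rewrite cayley_Re divr_gt0 ?exprn_gt0 ?normc_gt0 ?disc_neq1 //.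
by rewrite subr_gt0 expr_lt1 // normc_ge0.
Qed.

Lemma ReZ (k : R) z : Re (k%:C * z) = k * Re z.
Proof. by rewrite cReM /= mul0r subr0. Qed.
Lemma ImZ (k : R) z : Im (k%:C * z) = k * Im z.
Proof. by rewrite cImM /= mul0r addr0. Qed.

Lemma pi_neq0 : pi != 0 :> R. Proof. by rewrite gt_eqF // pi_gt0. Qed.

Lemma two_pi_gt0 : 0 < 2 / pi :> R. Proof. by rewrite divr_gt0 // pi_gt0. Qed.

Lemma strip_map_diff X z : 0 < X -> normc z < 1 -> cdiff (strip_map X) z.
Proof.
move=> X0 z1; apply: cdiffM; first exact: cdiff_cst.
have h : cdiff (fun w => X%:C * cayley w) z.
  apply: cdiffM; first exact: cdiff_cst.
  apply: cdiffM; first by apply: cdiffD; [exact: cdiff_cst|exact: cdiff_id].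
  apply: cdiffV; first exact: disc_neq1.
  by apply: cdiffB; [exact: cdiff_cst|exact: cdiff_id].
apply: (cdiff_comp h); apply: cdiff_asinhc.
by rewrite ReZ mulr_gt0 // cayley_Re_gt0.
Qed.

Lemma strip_map_Im X z : `|Im (strip_map X z)| <= 1.
Proof.
rewrite ImZ /= normrM gtr0_norm ?two_pi_gt0 // mulrC.
rewrite -ler_pdivlMr ?two_pi_gt0 // mul1r invf_div ler_norml.
by rewrite asin_geNpi2 ?asin_lepi2 ?foc_dif_le1.
Qed.

Lemma strip_map_Re X z : 0 <= Re (strip_map X z).
Proof.
rewrite ReZ /= mulr_ge0 ?(ltW two_pi_gt0) //; apply: acosh_ge0; exact: foc_sum_ge1.
Qed.

Lemma foc_dif_real (x : R) : foc_dif x%:C = 0.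
Proof.
have := foc_mul x%:C; rewrite /= => /eqP; rewrite mulf_eq0 => /orP[/eqP e|/eqP //].
by have := foc_sum_ge1 x%:C; rewrite e ler10.
Qed.

Lemma asin0 : asin (0 : R) = 0.
Proof.
have e : asin (sin 0) = 0 :> R.
  by apply: sinK; rewrite in_itv /= oppr_le0 andbb divr_ge0 // pi_ge0.
by rewrite sin0 in e.
Qed.

Lemma strip_map_real X (r : R) : Im (strip_map X r%:C) = 0.
Proof.
rewrite ImZ /=.
have -> : X%:C * cayley r%:C = (X * ((1 + r) / (1 - r)))%:C.
  by rewrite /cayley !rmorphM fmorphV rmorphB rmorphD.
by rewrite foc_dif_real asin0 mulr0.
Qed.

(** At z = 1 the convention 0^-1 = 0 assigns a default value, but its imaginary part 0 is the true
    radial limit, because the real radius is mapped into the reals. Thus [strip_map_boundary] holds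
    at every x. *)
Lemma strip_map_expi0 X : Im (strip_map X 1) = 0.
Proof. exact: (strip_map_real X 1). Qed.

Lemma ccont_strip_map X z : z != 1 -> ccont (strip_map X) z.
Proof.
move=> z1; apply: ccontM; first exact: ccont_cst.
have h : ccont (fun w => X%:C * cayley w) z.
  apply: ccontM; first exact: ccont_cst.
  apply: ccontM; first by apply: ccontD; [exact: ccont_cst|exact: ccont_id].
  apply: ccontV; first by rewrite subr_eq0 eq_sym.
  by apply: ccontB; [exact: ccont_cst|exact: ccont_id].
exact: (ccont_comp h (@ccont_asinhc R _)).
Qed.

Lemma cvg_rseq_circle (x : R) : ((rseq R n)%:C * expi x : R[i]^o) @[n --> \oo] --> (expi x : R[i]^o).
Proof.
rewrite -[X in _ --> X]mul1r; apply: cvgZC; last exact: cvgC_cst.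
by apply: cvg_complex; [exact: cvg_rseq|exact: cvg_cst].
Qed.

Lemma strip_map_boundary X (x : R) :
  Im (strip_map X ((rseq R n)%:C * expi x)) @[n --> \oo] --> Im (strip_map X (expi x)).
Proof.
have [->|x1] := eqVneq (expi x) 1.
  rewrite strip_map_expi0; under eq_fun do rewrite mulr1 strip_map_real.
  exact: cvg_cst.
apply: cvg_Im; have /ccontE c := ccont_strip_map X x1.
by move=> A /c h; exact: (cvg_rseq_circle h).
Qed.

Lemma meas_strip_map X : 0 < X ->
  measurable_fun [set: T] (fun x : T => Im (strip_map X (expi x))).
Proof.
move=> X0; apply: (@measurable_fun_cvg _ _ _ setT (fun n x => Im (strip_map X ((rseq R n)%:C * expi x)))).
  move=> n; apply: meas_circle_Im => x; apply/cdiff_cont/strip_map_diff => //.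
  by rewrite normc_circle ger0_norm ?rseq_ge0 // rseq_lt1.
by move=> x _; exact: strip_map_boundary.
Qed.

Definition radius_of (a : R) : R := sh (pi / 2 * a).

Lemma strip_map0 (a : R) : 0 <= a -> strip_map (radius_of a) 0 = a%:C.
Proof.
move=> a0; rewrite /strip_map /cayley addr0 subr0 divr1 mulr1.
have -> : (radius_of a)%:C = sinhc (pi / 2 * a)%:C.
  by rewrite /sinhc /= cos0 sin0 mulr1 mulr0.
rewrite sinhcK /=.
- rewrite -rmorphM; congr (real_complex _ _).
  by have := pi_neq0; move: (pi : R) => q q0; field.
- by rewrite mulr_ge0 // divr_ge0 // pi_ge0.
- by rewrite oppr_le0 andbb divr_ge0 // pi_ge0.
Qed.

(** Z lies in the right half plane, hence nearer to X than to -X, which gives |om| < 1; and (1 + om)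
    / (1 - om) = Z / X. *)
Lemma strip_map_surj (a : R) w : 0 < a -> 0 < Re w -> `|Im w| < 1 ->
  let X := radius_of a in let Z := sinhc ((pi / 2)%:C * w) in
  let om := (Z - X%:C) / (Z + X%:C) in
  [/\ normc om < 1, Z + X%:C != 0 & strip_map X om = w].
Proof.
move=> a0 w0 w1 X Z om.
have p0 : 0 < pi / 2 :> R by rewrite divr_gt0 // pi_gt0.
have X0 : 0 < X by apply: sh_gt0; rewrite mulr_gt0.
have wI : - (pi / 2) < pi / 2 * Im w < pi / 2.
  by rewrite -ltr_norml normrM gtr0_norm // mulrC -ltr_pdivlMr // mulfV // gt_eqF.
have Z0 : 0 < Re Z.
  by rewrite /Z /sinhc /= !ReZ !ImZ mulr_gt0 ?cos_gt0_pihalf // sh_gt0 // mulr_gt0.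
have ZX : Z + X%:C != 0.
  apply/eqP => /(congr1 (fun u => Re u)); rewrite cReD /= => e.
  by have := addr_gt0 Z0 X0; rewrite e ltxx.
have n1 : normc om < 1.
  rewrite /om normcM normcV ltr_pdivrMr ?normc_gt0 // mul1r.
  rewrite -(@ltr_pXn2r _ 2) ?nnegrE ?normc_ge0 // !sqr_normcE.
  move: Z0; case: (Z) => c d /= c0; rewrite -subr_gt0.
  have -> : (c + X) ^+ 2 + (d + 0) ^+ 2 - ((c - X) ^+ 2 + (d - 0) ^+ 2) = 4 * (c * X) by ring.
  by rewrite mulr_gt0 // mulr_gt0.
split => //.
have XC : X%:C != 0 by rewrite fmorph_eq0 gt_eqF.
have -> : strip_map X om = (2 / pi)%:C * asinhc Z.
  congr (_ * asinhc _); rewrite /cayley /om.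
  have -> : 1 + (Z - X%:C) / (Z + X%:C) = (2%:R * Z) / (Z + X%:C) by field.
  have -> : 1 - (Z - X%:C) / (Z + X%:C) = (2%:R * X%:C) / (Z + X%:C) by field.
  by field; rewrite ZX XC.
rewrite sinhcK.
- have -> : (2 / pi)%:C * ((pi / 2)%:C * w) = (2 / pi * (pi / 2))%:C * w by rewrite mulrA -rmorphM.
  have -> : 2 / pi * (pi / 2) = 1 :> R by have := pi_neq0; move: (pi : R) => q q0; field.
  by rewrite mul1r.
- by rewrite ReZ ltW // mulr_gt0.
- by rewrite ImZ; case/andP: wI => /ltW -> /ltW ->.
Qed.

Lemma cayley_expi (x : R) : 0 < x < pi2 -> cayley (expi x) = 0 +i* (cos (x / 2) / sin (x / 2)).
Proof.
move=> /andP[x0 x1]; set y := x / 2.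
have s0 : 0 < sin y.
  by apply: sin_gt0_pi; rewrite divr_gt0 //= ltr_pdivrMr // mulrC.
have ex : x = y *+ 2 by rewrite /y; field.
have e1 : expi x != 1.
  rewrite eq_complex /= ex cos_mulr2n negb_and; apply/orP; left.
  rewrite -subr_eq0 cos2sin2.
  have -> : (1 - sin y ^+ 2) *+ 2 - 1 - 1 = - (sin y ^+ 2 *+ 2) by ring.
  by rewrite oppr_eq0 mulrn_eq0 /= expf_eq0 /= gt_eqF.
apply: (mulIf (x := 1 - expi x)); first by rewrite subr_eq0 eq_sym.
rewrite /cayley divfK; last by rewrite subr_eq0 eq_sym.
have sn : sin y != 0 by rewrite gt_eqF.
rewrite ex; apply/eqP; rewrite eq_complex /= cos_mulr2n sin_mulr2n.
have e := cos2sin2 y.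
apply/andP; split; apply/eqP.
  by field.
by rewrite e; field.
Qed.

(** On the imaginary axis [foc_Re] forces [foc_sum] = 1 or |[foc_dif]| = 1, so that [foc_dif] is Y
    truncated to [-1, 1]; a threshold below 1 does not see the truncation. *)
Lemma foc_dif_imag (Y sg : R) : 0 < sg < 1 -> (sg < `|foc_dif (0 +i* Y)|) = (sg < `|Y|).
Proof.
move=> /andP[s0 s1]; have c1 := foc_sum_ge1 (0 +i* Y).
have := foc_mul (0 +i* Y); have := foc_Re (0 +i* Y); rewrite /= expr0n /=.
move: (foc_sum _) (foc_dif _) c1 => c d c1 /eqP; rewrite mulf_eq0 => /orP[/eqP e|/eqP e] m.
  have c1e : c = 1.
    by apply/eqP; rewrite -(@eqrXn2 _ 2) ?expr1n //; [apply/eqP; move: e; lra|apply: le_trans c1].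
  by rewrite -m c1e mul1r.
have d1 : `|d| = 1.
  by apply/eqP; rewrite -(@eqrXn2 _ 2) ?normr_ge0 // expr1n real_normK ?num_real //; apply/eqP; lra.
by rewrite -m normrM d1 mulr1 s1 gtr0_norm ?(lt_le_trans s1) // (lt_le_trans ltr01).
Qed.

Lemma asin_gt (d b : R) : -1 <= d <= 1 -> 0 < b < pi / 2 -> (b < `|asin d|) = (sin b < `|d|).
Proof.
move=> d1 /andP[b0 b1].
have bI : b \in `[- (pi / 2), pi / 2] by rewrite in_itv /=; apply/andP; split; lra.
have key (u : R) : 0 <= u <= 1 -> (b < asin u) = (sin b < u) /\ 0 <= asin u.
  move=> /andP[u0 u1].
  have u1' : -1 <= u <= 1 by apply/andP; split; lra.
  have [h1 h2] := asin_def u1'; split; first by rewrite -{2}h2 ltr_sin.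
  rewrite leNgt; apply/negP => au.
  have : sin (asin u) < sin 0.
    by rewrite ltr_sin // in_itv /=; apply/andP; split; lra.
  by rewrite h2 sin0 ltNge u0.
have /andP[a1 a2] := d1.
have [d0|d0] := leP 0 d.
  have d2 : 0 <= d <= 1 by rewrite d0.
  have [h1 h2] := key d d2.
  by rewrite !ger0_norm.
have d2 : 0 <= - d <= 1 by apply/andP; split; lra.
have [h1 h2] := key (- d) d2.
rewrite (ltr0_norm d0) -h1 asinN // -normrN ger0_norm // -asinN //.
Qed.

Definition jsin (t : R) : R := sin (pi * t / 2).

Lemma jsin_bounds t : 0 < t < 1 -> 0 < jsin t < 1.
Proof.
move=> /andP[t0 t1]; have p0 := @pi_gt0 R.
have b0 : 0 < pi * t / 2 by rewrite divr_gt0 // mulr_gt0.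
have b1 : pi * t / 2 < pi / 2 by rewrite ltr_pM2r // gtr_pMr.
have h : sin (pi * t / 2) < sin (pi / 2).
  by rewrite ltr_sin // in_itv /=; apply/andP; split; lra.
by rewrite /jsin sin_gt0_pihalf ?b0 //=; rewrite sin_pihalf in h.
Qed.

(** With tan(tau) = X / sg the condition reads cos(tau) sin(y) < sin(tau) |cos(y)|, that is, sin(tau
    - y) > 0 for y <= pi / 2 and sin(y + tau - pi) > 0 beyond. *)
Lemma level_arc (X sg y : R) : 0 < X -> 0 < sg -> 0 < y < pi ->
  (sg < `|X * (cos y / sin y)|) = (y < atan (X / sg)) || (pi - atan (X / sg) < y).
Proof.
move=> X0 sg0 /andP[y0 y1]; set tau := atan _.
have t2 : tau < pi / 2 by exact: atan_ltpi2.
have t0 : 0 < tau by rewrite /tau -atan0 lt_atan // divr_gt0.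
have s0 : 0 < sin y by rewrite sin_gt0_pi // y0.
have ct : 0 < cos tau by apply: cos_gt0_pihalf; apply/andP; split; lra.
have st : X * cos tau = sg * sin tau.
  have : tan tau = X / sg by exact: atanK.
  rewrite /tan => /(congr1 (fun u => u * (cos tau * sg))).
  have -> : sin tau / cos tau * (cos tau * sg) = sg * sin tau by field; rewrite gt_eqF.
  have -> : X / sg * (cos tau * sg) = X * cos tau by field; rewrite gt_eqF.
  by [].
have k : (sg < `|X * (cos y / sin y)|) = (cos tau * sin y < sin tau * `|cos y|).
  rewrite !normrM normfV (gtr0_norm X0) (gtr0_norm s0) mulrA ltr_pdivlMr //.
  rewrite -(ltr_pM2l ct) !mulrA (mulrC (cos tau) X) st.
  by rewrite -!mulrA (mulrCA (cos tau)) ltr_pM2l.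
rewrite k {k}; have [yp|yp] := leP y (pi / 2).
  have cy : 0 <= cos y by apply: cos_ge0_pihalf; apply/andP; split; lra.
  have -> : (pi - tau < y) = false by apply/negbTE; rewrite -leNgt; lra.
  rewrite orbF ger0_norm // -subr_gt0 -sinB -[X in X < _]sin0 ltr_sin ?in_itv /= ?subr_gt0 //.
    by apply/andP; split; lra.
  by apply/andP; split; lra.
have cy : cos y < 0.
  rewrite -oppr_gt0 -sinBpihalf sin_gt0_pihalf //; apply/andP; split; lra.
have -> : (y < tau) = false by apply/negbTE; rewrite -leNgt; lra.
rewrite /= ltr0_norm // mulrN -subr_gt0.
have -> : - (sin tau * cos y) - cos tau * sin y = sin (y + tau - pi).
  by rewrite [RHS]sinB sinpi cospi sinD; ring.
rewrite -[X in X < _]sin0 ltr_sin ?in_itv /=; first by rewrite subr_gt0 ltrBlDr.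
  by apply/andP; split; lra.
by apply/andP; split; lra.
Qed.

(** On the circle (1 + z) / (1 - z) = i cot(x / 2), so the level set consists of two arcs of length
    2 tau on either side of z = 1, of total normalized measure 4 tau / (2 pi). *)
Lemma level_measure X (t : R) : 0 < X -> 0 < t < 1 ->
  circ [set x | t < `|Im (strip_map X (expi x))|] = (2 / pi * atan (X / jsin t))%:E.
Proof.
move=> X0 ht; have /andP[t0 t1] := ht; have /andP[s0 s1] := jsin_bounds ht.
set tau := atan _; have p0 := @pi_gt0 R.
have tau2 : tau < pi / 2 by exact: atan_ltpi2.
have tau0 : 0 < tau by rewrite /tau -atan0 lt_atan // divr_gt0.
pose P (x : R) : bool := t < `|Im (strip_map X (expi x))|.
(* The angle 0, where the cotangent formula does not apply, falls outside the level set by the value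
   at z = 1. *)
have P0 : P 0 = false by rewrite /P expi0 strip_map_expi0 normr0 ltNge (ltW t0).
have e : [set x | P x] `&` `[0%R, pi2[ =
    `]0, 2 * tau[ `|` `]pi2 - 2 * tau, pi2[.
  have in1 x : 0 < x < pi2 -> P x =
      (x / 2 < tau) || (pi - tau < x / 2).
    move=> hx; have /andP[x0 x1] := hx.
    rewrite -level_arc //; last by rewrite divr_gt0 //= ltr_pdivrMr // mulrC.
    rewrite /P ImZ /= cayley_expi // normrM (gtr0_norm two_pi_gt0).
    have -> : X%:C * (0 +i* (cos (x / 2) / sin (x / 2))) = 0 +i* (X * (cos (x / 2) / sin (x / 2))).
      by apply/eqP; rewrite eq_complex /=; apply/andP; split; apply/eqP; ring.
    rewrite -foc_dif_imag ?s0 // mulrC -ltr_pdivrMr ?two_pi_gt0 // invf_div.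
    have -> : t * (pi / 2) = pi * t / 2 by ring.
    rewrite asin_gt //; first exact: foc_dif_le1.
    by rewrite divr_gt0 ?mulr_gt0 //= ltr_pM2r // gtr_pMr.
  apply/seteqP; split => x /=; rewrite !in_itv /=.
    move=> [h /andP[x0 x1]].
    have xp : 0 < x.
      rewrite lt_neqAle x0 andbT; apply/eqP => x00; move: h; by rewrite -x00 P0.
    move: h; rewrite in1 ?xp // => /orP[h|h]; [left|right]; apply/andP; split => //; lra.
  move=> [|] /andP[h1 h2]; split; rewrite ?in1; try (apply/andP; split; lra).
    by apply/orP; left; lra.
  by apply/orP; right; lra.
change (((pi2^-1)%:E * (@lebesgue_measure R) ([set x | P x] `&` `[0%R, pi2[))%E =
  (2 / pi * tau)%:E).
rewrite e measureU //; last first.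
  apply/seteqP; split => // x /=; rewrite !in_itv /= => -[/andP[_ h1] /andP[h2 _]]; lra.
have m1 := @lebesgue_measure_itv R `]0, 2 * tau[.
have m2 := @lebesgue_measure_itv R `]pi2 - 2 * tau, pi2[.
move: m1 m2; rewrite /= !lte_fin mulr_gt0 // gtrBl mulr_gt0 // => m1 m2.
rewrite [X in (_ * (X + _))%E]m1 [X in (_ * (_ + X))%E]m2 -!EFinD -EFinM; congr EFin.
by have := pi_neq0; move: (pi : R) => q q0; field.
Qed.

End StripMap.

(** * The p-th mean of the conformal map *)

Section LayerCake.
Context (R : realType).
Local Notation mu := (@lebesgue_measure R).
Local Notation circ := (circle_measure R).
Local Notation T := (measurableTypeR R).
Context (p : R) (p1 : 1 < p).

Let p0 : 0 < p. Proof. exact: lt_trans p1. Qed.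
Let q0 : 0 < p - 1. Proof. by rewrite subr_gt0. Qed.

Lemma cvg_powR (q : R) (x : R) : 0 < q -> 0 <= x ->
  [/\ y `^ q @[y --> x^'+] --> x `^ q & 0 < x -> y `^ q @[y --> x^'-] --> x `^ q].
Proof.
move=> q1 x0; have c := @cont_powR_abs R q q1 x.
rewrite /continuous_at /= (ger0_norm x0) in c; split.
  apply: (@cvg_trans _ ((fun y => `|y| `^ q) @ x^'+)); last exact: cvg_at_right_filter.
  apply: near_eq_cvg; near=> y; rewrite ger0_norm //; apply: (le_trans x0); apply: ltW.
  by near: y; exact: nbhs_right_gt.
move=> xp; apply: (@cvg_trans _ ((fun y => `|y| `^ q) @ x^'-)); last exact: cvg_at_left_filter.
apply: near_eq_cvg; near=> y; rewrite ger0_norm //; apply: ltW.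
by near: y; exact: nbhs_left_gt.
Unshelve. all: by end_near. Qed.

Lemma powR_cont_gt0 (q t : R) : 0 < t -> {for t, continuous (fun y : R => y `^ q)}.
Proof.
move=> t0; have h := @is_derive1_powR R q _ t0.
by apply: differentiable_continuous; apply/derivable1_diffP; exact: (@ex_derive _ _ _ _ _ _ _ h).
Qed.

(** The absolute value makes the weight continuous, hence measurable, on the whole line; it agrees
    with t^q for t > 0. *)
Lemma meas_powR_cst (c q : R) : 0 < q -> measurable_fun [set: T] (fun t : T => c * `|t| `^ q).
Proof.
move=> q1; apply: continuous_measurable_fun => x; apply: cvgM; first exact: cvg_cst.
exact: cont_powR_abs.
Qed.

Lemma powR_layer (y : R) : 0 <= y ->
  (\int[mu]_(t in `]0%R, y[) (p * `|t| `^ (p - 1))%:E = (y `^ p)%:E)%E.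
Proof.
rewrite le_eqVlt => /orP[/eqP <-|y0].
  by rewrite set_itvoo0 integral_set0 powR0 // gt_eqF.
rewrite -(@integral_itv_bndoo _ _ _ _ true false); last first.
  by apply: measurable_funTS; apply/measurable_EFinP; exact: meas_powR_cst.
rewrite (@continuous_FTC2 R (fun t => p * `|t| `^ (p - 1)) (fun t => t `^ p)) //.
- by rewrite powR0 ?gt_eqF // sube0.
- by apply: continuous_subspaceT => x; apply: cvgM; [exact: cvg_cst|exact: cont_powR_abs].
- split.
  + move=> x; rewrite in_itv /= => /andP[x0 _].
    exact: (@ex_derive _ _ _ _ _ _ _ (@is_derive1_powR R p _ x0)).
  + by have [] := cvg_powR p0 (lexx 0).
  + by have [_] := cvg_powR p0 (ltW y0); apply.
- move=> x xy; have := xy; rewrite in_itv /= => /andP[x0 _].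
  rewrite derive1E (@derive_val _ _ _ _ _ _ _ (@is_derive1_powR R p _ x0)).
  by rewrite (gtr0_norm x0).
Qed.

(** |g|^p is the integral of p t^(p-1) over 0 < t < |g|, and Tonelli exchanges the order; |g| <= 1
    confines t to the unit interval. *)
Lemma layer_cake (g : T -> R) : measurable_fun setT g -> (forall x, `|g x| <= 1) ->
  (\int[circ]_x (`|g x| `^ p)%:E =
   \int[mu]_(t in `]0%R, 1%R[) ((p * `|t| `^ (p - 1))%:E * circ [set x | (t < `|g x|)%R]))%E.
Proof.
move=> mg g1.
pose A : set (T * T) := [set s | 0 < s.2] `&` [set s | s.2 < `|g s.1|].
pose k (s : T * T) : \bar R := ((fun s : T * T => (p * `|s.2| `^ (p - 1))%:E) \_ A) s.
have mA : measurable A.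
  apply: measurableI.
    have h : measurable_fun [set: T * T] (snd : T * T -> T) by exact: measurable_snd.
    have := h measurableT _ (measurable_itv `]0, +oo[); rewrite setTI.
    by congr measurable; apply/seteqP; split => s /=; rewrite in_itv /= andbT.
  have h : measurable_fun [set: T * T] (fun s : T * T => `|g s.1| - s.2 : T).
    apply: measurable_funB; last exact: measurable_snd.
    apply: measurableT_comp => //; apply: (measurableT_comp mg); exact: measurable_fst.
  have := h measurableT _ (measurable_itv `]0, +oo[); rewrite setTI.
  by congr measurable; apply/seteqP; split => s /=; rewrite in_itv /= andbT subr_gt0.
have mk : measurable_fun setT k.
  apply/(measurable_restrictT _ mA); apply: measurable_funTS; apply/measurable_EFinP.
  by apply: (measurableT_comp (meas_powR_cst p q0)); exact: measurable_snd.
have k0 s : (0 <= k s)%E.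
  by rewrite /k patchE; case: ifP => // _; rewrite lee_fin mulr_ge0 ?powR_ge0 // ltW.
have F : (\int[circ]_x \int[mu]_t k (x, t) = \int[mu]_t \int[circ]_x k (x, t))%E.
  exact: (@fubini_tonelli _ _ T T R (@circF R) mu k mk k0).
transitivity (\int[circ]_x \int[mu]_t k (x, t))%E.
  apply: eq_integral => x _; rewrite -powR_layer // integral_mkcond.
  apply: eq_integral => t _; rewrite /k !patchE; congr (if _ then _ else _).
  by apply/idP/idP; rewrite !inE /A /= in_itv /= => /andP.
rewrite F [RHS]integral_mkcond; apply: eq_integral => t _.
rewrite patchE; case: ifPn => [|/negP] tI.
  move: tI; rewrite inE /= in_itv /= => /andP[t0 t1].
  rewrite -integral_cst; last first.
    have h : measurable_fun [set: T] (fun x : T => `|g x| : T) by exact: measurableT_comp.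
    have := h measurableT _ (measurable_itv `]t, +oo[); rewrite setTI.
    by congr measurable; apply/seteqP; split => x /=; rewrite in_itv /= andbT.
  rewrite [RHS]integral_mkcond; apply: eq_integral => x _; rewrite /k !patchE.
  congr (if _ then _ else _).
  by apply/idP/idP; rewrite !inE /A /=; [case|split].
rewrite integral0_eq // => x _; rewrite /k patchE; case: ifPn => //; rewrite inE => -[/= t0 t1].
by exfalso; apply: tI; rewrite inE /= in_itv /= t0 (lt_le_trans t1).
Qed.

(** sin x - x cos x increases from 0 on [0, pi]. At x = y / 2, multiplied by 2 cos(y / 2), it gives
    sin y >= y cos^2(y / 2) = y (1 + cos y) / 2. The crude constant is enough for integrability at
    0. *)
Lemma sin_ge_half (y : R) : 0 <= y <= pi / 2 -> y / 2 <= sin y.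
Proof.
move=> /andP[y0 y1]; have pp := @pi_gt0 R.
pose f x : R := sin x - x * cos x.
have df (x : R) : is_derive x 1 f (x * sin x).
  by apply: is_derive_eq; rewrite /GRing.scale /=; ring.
have f0 : 0 <= f (y / 2).
  have h := @ger0_derive1_ndecr R f 0 pi.
  rewrite -[X in X <= _](_ : f 0 = 0); last by rewrite /f sin0 mul0r subr0.
  apply: h.
  - by move=> x _; exact: (@ex_derive _ _ _ _ _ _ _ (df x)).
  - move=> x; rewrite in_itv /= => /andP[x0 x1].
    rewrite derive1E (@derive_val _ _ _ _ _ _ _ (df x)) mulr_ge0 ?ltW //.
    by rewrite sin_gt0_pi // x0.
  - apply: continuous_subspaceT => x.
    by apply/differentiable_continuous/derivable1_diffP; exact: (@ex_derive _ _ _ _ _ _ _ (df x)).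
  - exact: lexx.
  - exact: divr_ge0.
  - by move: (pi : R) pp y1 => q *; lra.
have c0 : 0 <= cos (y / 2).
  by apply: cos_ge0_pihalf; move: (pi : R) pp y1 => q *; apply/andP; split; lra.
have cy : 0 <= cos y.
  by apply: cos_ge0_pihalf; move: (pi : R) pp y1 => q *; apply/andP; split; lra.
have ey : y = y / 2 *+ 2 by field.
have e1 : sin y = 2 * (sin (y / 2) * cos (y / 2)) by rewrite {1}ey sin_mulr2n; ring.
have e2 : cos (y / 2) ^+ 2 = (1 + cos y) / 2 by rewrite {2}ey cos_mulr2n; field.
have : 0 <= 2 * (f (y / 2) * cos (y / 2)) by rewrite mulr_ge0 // mulr_ge0.
have -> : 2 * (f (y / 2) * cos (y / 2)) = sin y - y * cos (y / 2) ^+ 2.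
  by rewrite e1 /f; field.
rewrite e2; have : 0 <= y * cos y by rewrite mulr_ge0.
lra.
Qed.

Lemma jsin_ge (t : R) : 0 <= t <= 1 -> t / 2 <= jsin t.
Proof.
move=> /andP[t0 t1]; have p2 := @pi_ge2 R.
have b0 : t <= pi * t / 2.
  rewrite ler_pdivlMr // mulrC; apply: ler_wpM2r => //.
apply: le_trans (sin_ge_half _); first by rewrite ler_pM2r.
rewrite (le_trans t0 b0) /= ler_pM2r // ler_piMr // (le_trans _ p2) //.
Qed.

Lemma is_derive_sh (x : R) : is_derive x 1 (@sh R) (ch x).
Proof.
have h : is_derive x 1 (fun x : R => (expR x - expR (- x)) / 2) (ch x).
  by apply: is_derive_eq; rewrite /GRing.scale /= /ch; field.
exact: h.
Qed.

Lemma is_derive_atan_sh (k s x : R) : s != 0 ->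
  is_derive x 1 (fun x : R => atan (sh (k * x) / s)) (k * ch (k * x) * s / (s ^+ 2 + sh (k * x) ^+ 2)).
Proof.
move=> s0.
have h1 : is_derive x 1 (fun x : R => sh (k * x) / s) (k * ch (k * x) / s).
  have := is_derive_sh (k * x) => h.
  by apply: is_derive_eq; rewrite /GRing.scale /=; field.
have h2 := @is_derive1_atan R (sh (k * x) / s).
apply: is_derive_eq; rewrite /GRing.scale /=; field.
rewrite s0 andbT gt_eqF // ltr_pwDl ?sqr_ge0 // lt_neqAle sqr_ge0 eq_sym expf_eq0 /=.
by rewrite s0.
Qed.

(** With c = cosh b, the derivative in b of the difference has the sign of (c - 1) (1 - s^2 + c),
    nonnegative because s <= 1 <= c. Both sides have slope 1 / s at b = 0, so nothing is lost to
    first order. *)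
Lemma atan_sh_le (b s : R) : 0 <= b -> 0 < s <= 1 -> atan (sh b / s) <= b / s.
Proof.
move=> b0 /andP[s0 s1]; rewrite -subr_ge0.
pose f x : R := x / s - atan (sh (1 * x) / s).
have sn : s != 0 by rewrite gt_eqF.
have df (x : R) : is_derive x 1 f (s^-1 - 1 * ch (1 * x) * s / (s ^+ 2 + sh (1 * x) ^+ 2)).
  have h := is_derive_atan_sh 1 x sn.
  have h1 : is_derive x 1 (fun x : R => x / s) s^-1.
    by apply: is_derive_eq; rewrite /GRing.scale /=; field.
  exact: (is_deriveB h1 h).
have h := @ger0_derive1_ndecr R f 0 b.
have f0 : f 0 = 0 by rewrite /f mul0r mulr0 /sh oppr0 subrr !mul0r atan0 subr0.
have fb : f b = b / s - atan (sh b / s) by rewrite /f mul1r.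
rewrite -fb -f0; apply: h => //.
- move=> x; rewrite in_itv /= => /andP[x0 x1].
  rewrite derive1E (@derive_val _ _ _ _ _ _ _ (df x)) !mul1r subr_ge0.
  have d0 : 0 < s ^+ 2 + sh x ^+ 2 by rewrite ltr_wpDr ?sqr_ge0 // exprn_gt0.
  rewrite ler_pdivrMr // ler_pdivlMl //.
  have -> : sh x ^+ 2 = ch x ^+ 2 - 1 by rewrite -(ch2_sh2 x); ring.
  have := ch_ge1 x; move: (ch x) => c c1.
  rewrite -subr_ge0.
  have -> : s ^+ 2 + (c ^+ 2 - 1) - s * (c * s) = (c - 1) * ((1 - s ^+ 2) + c) by ring.
  rewrite mulr_ge0 // ?subr_ge0 // addr_ge0 ?subr_ge0 ?expr_le1 ?(ltW s0) //.
  exact: le_trans c1.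
- apply: continuous_subspaceT => x.
  by apply/differentiable_continuous/derivable1_diffP; exact: (@ex_derive _ _ _ _ _ _ _ (df x)).
Qed.

(** The normalized measure of {|v| > t} for v the imaginary part of the strip map with value a at 0;
    see [level_measure]. *)
Definition arc_mass (a t : R) : R := 2 / pi * atan (radius_of a / jsin t).

Lemma arc_mass_ge0 a t : 0 <= a -> 0 < t < 1 -> 0 <= arc_mass a t.
Proof.
move=> a0 /jsin_bounds/andP[s0 s1]; rewrite mulr_ge0 ?(ltW (two_pi_gt0 R)) //.
by rewrite -atan0 le_atan // divr_ge0 ?(ltW s0) // sh_ge0 // mulr_ge0 // divr_ge0 // pi_ge0.
Qed.

Lemma arc_mass_le a t : 0 <= a -> 0 < t < 1 -> arc_mass a t <= a / jsin t.
Proof.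
move=> a0 /jsin_bounds/andP[s0 s1].
have b0 : 0 <= pi / 2 * a by rewrite mulr_ge0 // divr_ge0 // pi_ge0.
have s01 : 0 < jsin t <= 1 by rewrite s0 ltW.
have := atan_sh_le b0 s01; rewrite -(ler_pM2l (two_pi_gt0 R)) => h.
apply: (le_trans h); rewrite le_eqVlt; apply/orP; left; apply/eqP.
have := pi_neq0 R; move: (pi : R) => q qn; field.
by rewrite qn gt_eqF.
Qed.

(** A difference quotient of arctan(sinh(pi a / 2) / s) at a = 0, along a = 1 / (n + 1); the
    derivative pi / (2 s) absorbs the prefactor 2 / pi. *)
Lemma arc_mass_cvg t : 0 < t < 1 ->
  (n.+1%:R * arc_mass (n.+1%:R^-1) t) @[n --> \oo] --> (jsin t)^-1.
Proof.
move=> /jsin_bounds/andP[s0 s1].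
have sn : jsin t != 0 by rewrite gt_eqF.
have [k [hk k0 ck]] := carath1 (is_derive_atan_sh (pi / 2) 0 sn).
have ck' : (fun n : nat => k n.+1%:R^-1) @ \oo --> k 0.
  by apply: (cvg_comp _ _ (@cvg_harmonic R) ck).
have e : (jsin t)^-1 = 2 / pi * k 0.
  rewrite k0 mulr0 /ch /sh oppr0 expR0 subrr mul0r expr0n addr0.
  have := pi_neq0 R; move: (pi : R) => q qn; field.
  by rewrite sn.
rewrite e.
have -> : (fun n : nat => n.+1%:R * arc_mass n.+1%:R^-1 t) = (fun n : nat => 2 / pi * k n.+1%:R^-1).
  apply/funext => n; have := hk n.+1%:R^-1.
  rewrite mulr0 {2}/sh oppr0 subrr !mul0r atan0 !subr0 => h.
  have nn : n.+1%:R != 0 :> R by rewrite pnatr_eq0.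
  rewrite /arc_mass /radius_of h addr0 mulrC -!mulrA; congr (_ * (_ * _)).
  by rewrite mulVf // mulr1.
by apply: cvgM; [exact: cvg_cst|].
Qed.

Definition A_dens (t : R) : R := p * (`|t| `^ (p - 1)) / jsin t.

Lemma cont_jsinV (t : R) : 0 < t < 1 -> {for t, continuous (fun t => (jsin t)^-1)}.
Proof.
move=> /jsin_bounds/andP[s0 s1]; apply: cvgV; first by rewrite gt_eqF.
have c : (fun t : R => pi * t / 2) @ t --> pi * t / 2.
  by apply: cvgM; [apply: cvgM; [exact: cvg_cst|exact: cvg_id]|exact: cvg_cst].
exact: (cvg_comp _ _ c (@continuous_sin R _)).
Qed.

Lemma meas_unit (f : R -> R) : (forall t, 0 < t < 1 -> {for t, continuous f}) ->
  measurable_fun (`]0, 1[ : set T) (f : T -> R).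
Proof.
move=> cf; apply: open_continuous_measurable_fun; first exact: itv_open.
by move=> t; rewrite inE /= in_itv /=; exact: cf.
Qed.

Lemma cont_weight : continuous (fun t : R => p * `|t| `^ (p - 1)).
Proof. by move=> t; apply: cvgM; [exact: cvg_cst|exact: cont_powR_abs]. Qed.

Lemma meas_A_dens : measurable_fun (`]0, 1[ : set T) (A_dens : T -> R).
Proof.
apply: meas_unit => t ht; apply: cvgM; last exact: cont_jsinV.
exact: cont_weight.
Qed.

Lemma A_dens_ge0 t : 0 < t < 1 -> 0 <= A_dens t.
Proof.
by move=> /jsin_bounds/andP[s0 _]; rewrite divr_ge0 ?(ltW s0) // mulr_ge0 ?powR_ge0 // ltW.
Qed.

(** For p < 2 the integrand is unbounded at 0, so the fundamental theorem is applied on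
    [1 / (n + 2), 1] and monotone convergence does the rest. *)
Lemma powR_near0_integral :
  (\int[mu]_(t in `]0%R, 1%R[) ((p - 1) * t `^ (p - 1 - 1))%:E <= 1)%E.
Proof.
pose f (t : R) : R := (p - 1) * t `^ (p - 1 - 1).
pose D (n : nat) : set R := `[(n.+2%:R^-1 : R), 1%R]%classic.
have cf (t : R) : 0 < t -> {for t, continuous f}.
  move=> t0; apply: cvgM; first exact: cvg_cst.
  exact: powR_cont_gt0.
have mf : measurable_fun (`]0, +oo[ : set T) (f : T -> R).
  apply: open_continuous_measurable_fun; first exact: interval_open.
  by move=> t; rewrite inE /= in_itv /= andbT; exact: cf.
have e0 n : 0 < n.+2%:R^-1 :> R by rewrite invr_gt0.
have e1 n : n.+2%:R^-1 < 1 :> R by rewrite invf_lt1 // ltr1n.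
have I n : (\int[mu]_(t in D n) (f t)%:E <= 1)%E.
  rewrite (@continuous_FTC2 R f (fun t => t `^ (p - 1))) //.
  - by rewrite powR1 -EFinB lee_fin gerBl powR_ge0.
  - by apply: continuous_in_subspaceT => t; rewrite inE /= in_itv /= => /andP[h _]; apply: cf; exact: lt_le_trans h.
  - split.
    + move=> x; rewrite in_itv /= => /andP[x0 _].
      exact: (@ex_derive _ _ _ _ _ _ _ (@is_derive1_powR R (p - 1) _ (lt_trans (e0 n) x0))).
    + by have [] := cvg_powR q0 (ltW (e0 n)).
    + by have [_] := cvg_powR q0 (@ler01 R); apply.
  - move=> x; rewrite in_itv /= => /andP[x0 _].
    by rewrite derive1E (@derive_val _ _ _ _ _ _ _ (@is_derive1_powR R (p - 1) _ (lt_trans (e0 n) x0))).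
have f0 t : (0 <= (f t)%:E)%E by rewrite lee_fin mulr_ge0 ?powR_ge0 // ltW.
have sub n : D n `<=` `]0, +oo[.
  by move=> t; rewrite /D /= !in_itv /= andbT => /andP[h _]; exact: (lt_le_trans (e0 n) h).
have C := @ge0_nondecreasing_set_cvg_integral _ T R D (EFin \o f) mu.
have {}C : (\int[mu]_(t in D n) (f t)%:E)%E @[n --> \oo] --> (\int[mu]_(t in \bigcup_n D n) (f t)%:E)%E.
  apply: C => //.
  - move=> m n mn; apply/subsetPset => t; rewrite /D /= !in_itv /= => /andP[h ->]; rewrite andbT.
    by apply: le_trans h; rewrite lef_pV2 ?posrE // ler_nat.
  - by move=> n; exact: measurable_itv.
  - move=> n; apply/measurable_EFinP; apply: measurable_funS mf => //; exact: sub.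
  - by move=> n t _; exact: f0.
have L : (\int[mu]_(t in \bigcup_n D n) (f t)%:E <= 1)%E.
  rewrite -(cvg_lim _ C) //; apply: lime_le; first by apply/cvg_ex; eexists; exact: C.
  exact: nearW.
apply: le_trans L; apply: ge0_subset_integral => //.
- by apply: bigcup_measurable => n _; exact: measurable_itv.
- apply/measurable_EFinP; apply: measurable_funS mf => //.
  by move=> t [n _]; exact: sub.
- by move=> t _; exact: f0.
move=> t /=; rewrite in_itv /= => /andP[t0 t1].
exists (Num.truncn t^-1) => //; rewrite /D /= in_itv /= (ltW t1) andbT.
rewrite -[X in _ <= X]invrK lef_pV2 ?posrE ?invr_gt0 //.
apply: ltW; apply: (lt_trans (truncnS_gt _)); by rewrite ltr_nat.
Qed.

Lemma A_dens_integrable : mu.-integrable `]0, 1[ (EFin \o A_dens).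
Proof.
apply/integrableP; split; first by apply/measurable_EFinP; exact: meas_A_dens.
(* Since [jsin t] is at least t / 2, the density is at most 2 p t^(p-2), which is c times the
   integrand of [powR_near0_integral]. *)
pose c := 2 * p / (p - 1).
have c0 : 0 <= c by rewrite divr_ge0 ?mulr_ge0 // ltW.
have mg : measurable_fun (`]0, 1[ : set T) (fun t : T => ((p - 1) * t `^ (p - 1 - 1))%:E).
  apply/measurable_EFinP; apply: meas_unit => t /andP[t0 _]; apply: cvgM; first exact: cvg_cst.
  exact: powR_cont_gt0.
have g0 (t : R) : (0 <= ((p - 1) * t `^ (p - 1 - 1))%:E)%E.
  by rewrite lee_fin mulr_ge0 ?powR_ge0 // ltW.
apply: (@le_lt_trans _ _ (c%:E * \int[mu]_(t in `]0%R, 1%R[) ((p - 1) * t `^ (p - 1 - 1))%:E)%E).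
  rewrite -ge0_integralZl //; apply: ge0_le_integral => //.
  - by apply: measurableT_comp => //; apply/measurable_EFinP; exact: meas_A_dens.
  - exact: measurable_funeM.
  move=> t /=; rewrite in_itv /= => ht; have /andP[t0 t1] := ht.
  rewrite lee_fin ger0_norm ?A_dens_ge0 //; have /andP[s0 s1] := jsin_bounds ht.
  rewrite /A_dens ler_pdivrMr // (gtr0_norm t0).
  have tp : t `^ (p - 1) = t * t `^ (p - 1 - 1).
    transitivity (t `^ (1 + (p - 1 - 1))); first by congr (_ `^ _); ring.
    have tn : t != 0 by rewrite gt_eqF.
    by rewrite (@powRD _ _ 1 (p - 1 - 1)) ?tn ?implybT // powRr1 // ltW.
  have js : t <= 2 * jsin t.
    have := @jsin_ge t; rewrite (ltW t0) (ltW t1) => /(_ isT); lra.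
  rewrite tp; have w0 := powR_ge0 t (p - 1 - 1); move: (_ `^ _) w0 => w w0.
  have -> : c * ((p - 1) * w) * jsin t = p * w * (2 * jsin t).
    by rewrite /c; field; rewrite gt_eqF.
  have -> : p * (t * w) = p * w * t by ring.
  by rewrite ler_wpM2l // mulr_ge0 // ltW.
apply: (@le_lt_trans _ _ (c%:E * 1)%E); last by rewrite mule1 ltry.
by rewrite lee_pmul // ?integral_ge0 // ?powR_near0_integral.
Qed.

(** [A_const] is a real-valued integral, which would be 0 by default if the extended integral were
    infinite; [A_dens_integrable] rules this out. *)
Lemma A_constE : (\int[mu]_(t in `]0%R, 1%R[) (A_dens t)%:E)%E = (A_const p)%:E.
Proof.
have -> : A_const p = \int[mu]_(t in `]0%R, 1%R[) A_dens t.
  rewrite /A_const /Rintegral.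
  rewrite (@integral_itv_bndoo R 0 1 (fun t => (t `^ (p - 1) / sin (pi * t / 2))%:E) true false); last first.
    apply/measurable_EFinP; apply: meas_unit => t ht; apply: cvgM; last exact: cont_jsinV.
    by move: ht => /andP[t0 _]; exact: powR_cont_gt0.
  have -> : (\int[mu]_(t in `]0%R, 1%R[) (A_dens t)%:E = p%:E * \int[mu]_(t in `]0%R, 1%R[) (t `^ (p - 1) / sin (pi * t / 2))%:E)%E.
    rewrite -ge0_integralZl //; last by rewrite lee_fin ltW.
    - apply: eq_integral => t; rewrite inE /= in_itv /= => /andP[t0 _].
      by rewrite /A_dens (gtr0_norm t0) -EFinM mulrA.
    - apply/measurable_EFinP; apply: meas_unit => t ht; apply: cvgM; last exact: cont_jsinV.
      by move: ht => /andP[t0 _]; exact: powR_cont_gt0.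
    - move=> t /=; rewrite in_itv /= => ht; have /andP[s0 _] := jsin_bounds ht.
      by rewrite lee_fin divr_ge0 ?powR_ge0 // ltW.
  move: (\int[mu]_(t in _) _)%E => [r||] //=.
    by rewrite gt0_muley ?lte_fin // mulr0.
  by rewrite gt0_muleNy ?lte_fin // mulr0.
rewrite fineK //; exact: (integrable_fin_num _ A_dens_integrable).
Qed.

(** Since sin < 1, A_p is at least the integral of p t^(p-1), which is 1. Positivity makes the
    right-hand side of the estimate infinite when the integral of u is infinite and B > 0. *)
Lemma A_const_gt0 : 0 < A_const p.
Proof.
rewrite -lte_fin -A_constE.
apply: (@lt_le_trans _ _ (\int[mu]_(t in `]0%R, 1%R[) (p * `|t| `^ (p - 1))%:E)%E).
  by rewrite powR_layer // powR1 lte_fin.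
apply: ge0_le_integral => //.
- by move=> t _; rewrite lee_fin mulr_ge0 ?powR_ge0 // ltW.
- by apply: measurable_funTS; apply/measurable_EFinP; exact: meas_powR_cst.
- by apply/measurable_EFinP; exact: meas_A_dens.
move=> t /=; rewrite in_itv /= => ht; have /andP[s0 s1] := jsin_bounds ht.
by rewrite lee_fin /A_dens ler_pdivlMr // ler_piMr ?(ltW s1) // mulr_ge0 ?powR_ge0 // ltW.
Qed.

Definition strip_power (a : R) : R := \int[circ]_x (`|Im (strip_map (radius_of a) (expi x))| `^ p).

Lemma radius_of_gt0 (a : R) : 0 < a -> 0 < radius_of a.
Proof. by move=> a0; apply: sh_gt0; rewrite mulr_gt0 // divr_gt0 // pi_gt0. Qed.

Lemma strip_power_integrable a : 0 < a ->
  circ.-integrable setT (EFin \o (fun x : T => `|Im (strip_map (radius_of a) (expi x))| `^ p)).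
Proof.
move=> a0; apply: (circle_integrable (M := 1 `^ p)).
  exact: (meas_powR_abs p1 (meas_strip_map (radius_of_gt0 a0))).
by move=> x; apply: (powR_abs_bound p1); exact: strip_map_Im.
Qed.

Lemma strip_powerE (a : R) : 0 < a ->
  (strip_power a)%:E = (\int[mu]_(t in `]0%R, 1%R[) (p * `|t| `^ (p - 1) * arc_mass a t)%:E)%E.
Proof.
move=> a0; rewrite /strip_power EFin_Rint; last exact: strip_power_integrable.
rewrite layer_cake; last by move=> x; exact: strip_map_Im.
  apply: eq_integral => t; rewrite inE /= in_itv /= => ht.
  by rewrite level_measure ?radius_of_gt0.
exact: (meas_strip_map (radius_of_gt0 a0)).
Qed.

Lemma cont_arc_mass (a t : R) : 0 < t < 1 -> {for t, continuous (arc_mass a)}.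
Proof.
move=> ht; apply: cvgM; first exact: cvg_cst.
have c : (fun t => radius_of a / jsin t) @ t --> radius_of a / jsin t.
  by apply: cvgM; [exact: cvg_cst|exact: cont_jsinV].
exact: (cvg_comp _ _ c (@continuous_atan R _)).
Qed.

Lemma meas_arc_dens (c a : R) :
  measurable_fun (`]0, 1[ : set T) (fun t : T => (c * (p * `|t| `^ (p - 1) * arc_mass a t))%:E).
Proof.
apply/measurable_EFinP; apply: meas_unit => t ht; apply: cvgM; first exact: cvg_cst.
by apply: cvgM; [exact: cont_weight|exact: cont_arc_mass].
Qed.

Lemma meas_arc_dens1 (a : R) :
  measurable_fun (`]0, 1[ : set T) (fun t : T => (p * `|t| `^ (p - 1) * arc_mass a t)%:E).
Proof.
have -> : (fun t : T => (p * `|t| `^ (p - 1) * arc_mass a t)%:E) =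
    (fun t : T => (1 * (p * `|t| `^ (p - 1) * arc_mass a t))%:E).
  by apply/funext => t; rewrite mul1r.
exact: meas_arc_dens.
Qed.

Lemma strip_power_le (a : R) : 0 < a -> strip_power a <= A_const p * a.
Proof.
move=> a0; rewrite -lee_fin strip_powerE // EFinM -A_constE muleC.
rewrite -ge0_integralZl //.
- apply: ge0_le_integral => //.
  + move=> t /=; rewrite in_itv /= => ht.
    by rewrite lee_fin mulr_ge0 ?arc_mass_ge0 ?(ltW a0) // mulr_ge0 ?powR_ge0 // ltW.
  + exact: meas_arc_dens1.
  + by apply: measurable_funeM; apply/measurable_EFinP; exact: meas_A_dens.
  move=> t /=; rewrite in_itv /= => ht.
  rewrite -EFinM lee_fin /A_dens.
  have -> : a * (p * `|t| `^ (p - 1) / jsin t) = p * `|t| `^ (p - 1) * (a / jsin t) by ring.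
  rewrite ler_wpM2l //; last exact: (arc_mass_le (ltW a0) ht).
  by rewrite mulr_ge0 ?powR_ge0 // ltW.
- by apply/measurable_EFinP; exact: meas_A_dens.
- by move=> t /=; rewrite in_itv /= => ht; rewrite lee_fin A_dens_ge0.
- by rewrite lee_fin ltW.
Qed.

(* Fatou's lemma along a = 1 / (n + 1). *)
Lemma A_const_le (C : R) : (forall a, 0 < a -> strip_power a <= C * a) -> A_const p <= C.
Proof.
move=> H; rewrite -lee_fin -A_constE.
pose f (n : nat) (t : T) : \bar R := (n.+1%:R * (p * `|t| `^ (p - 1) * arc_mass n.+1%:R^-1 t))%:E.
have n0 (n : nat) : 0 < n.+1%:R^-1 :> R by rewrite invr_gt0.
have f0 n t : `]0%R, 1%R[%classic t -> (0 <= f n t)%E.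
  rewrite /= in_itv /= => ht; rewrite lee_fin mulr_ge0 // mulr_ge0 //.
    by rewrite mulr_ge0 ?powR_ge0 // ltW.
  exact: (arc_mass_ge0 (ltW (n0 n)) ht).
have F := @fatou _ T R mu (`]0%R, 1%R[%classic) (measurable_itv _) f
  (fun n => meas_arc_dens n.+1%:R n.+1%:R^-1) f0.
have L : (limn_einf (fun n => \int[mu]_(t in `]0%R, 1%R[) f n t) <= C%:E)%E.
  apply: (@limn_einf_le R _ (fun=> C)); last exact: cvg_cst.
  move=> n; have := H _ (n0 n); rewrite -lee_fin strip_powerE // => h.
  have -> : (\int[mu]_(t in `]0%R, 1%R[) f n t =
    n.+1%:R%:E * \int[mu]_(t in `]0%R, 1%R[) (p * `|t| `^ (p - 1) * arc_mass n.+1%:R^-1 t)%:E)%E.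
    rewrite -ge0_integralZl //.
    - exact: meas_arc_dens1.
    - move=> t /=; rewrite in_itv /= => ht; rewrite lee_fin mulr_ge0 //.
        by rewrite mulr_ge0 ?powR_ge0 // ltW.
      exact: (arc_mass_ge0 (ltW (n0 n)) ht).
  apply: (@le_trans _ _ (n.+1%:R%:E * (C * n.+1%:R^-1)%:E)%E).
    by rewrite lee_wpmul2l // lee_fin.
  by rewrite -EFinM lee_fin mulrCA mulfV ?mulr1 // pnatr_eq0.
apply: le_trans L; apply: le_trans F; rewrite le_eqVlt; apply/orP; left; apply/eqP.
apply: eq_integral => t; rewrite inE /= in_itv /= => ht.
have c : f n t @[n --> \oo] --> (A_dens t)%:E.
  apply/fine_cvgP; split; first exact: nearW.
  have -> : fine \o (f ^~ t) = (fun n => p * `|t| `^ (p - 1) * (n.+1%:R * arc_mass n.+1%:R^-1 t)).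
    by apply/funext => n /=; ring.
  by apply: cvgM; [exact: cvg_cst|exact: arc_mass_cvg].
by have [-> _] := cvg_limn_einf_sup c.
Qed.

End LayerCake.

(** * The inequality *)

Section NullSets.
Context (d : measure_display) (S : measurableType d) (R : realType).
Context (nu : {measure set S -> \bar R}) (E : set S) (mE : measurable E) (E0 : nu (~` E) = 0%E).
Import HBNNSimple.

(* No measurability: a boundary value is known only off a null set, and Borel
   sets are not complete. *)
Lemma le_integral_off_null (f g : S -> \bar R) : (forall x, 0 <= f x)%E ->
  (forall x, 0 <= g x)%E -> (forall x, E x -> f x <= g x)%E ->
  (\int[nu]_x f x <= \int[nu]_x g x)%E.
Proof.
move=> f0 g0 fg; rewrite !ge0_integralTE //.
apply: ge_ereal_sup => _ [h hf <-]; rewrite -integralT_nnsfun.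
(* A simple function below f, cut off to E, lies below g everywhere and keeps its integral, E being
   of full measure. *)
have -> : (\int[nu]_x (h x)%:E = \int[nu]_x (proj_nnsfun h mE x)%:E)%E.
  apply: ge0_ae_eq_integral => //.
  - exact/measurable_EFinP.
  - exact/measurable_EFinP.
  - by move=> x _; rewrite lee_fin; exact: fun_ge0.
  - by move=> x _; rewrite lee_fin; exact: fun_ge0.
  - exists (~` E); split => //; first exact: measurableC.
    move=> x /= nx Ex; apply: nx => _.
    by rewrite mindicE mem_set // mulr1.
rewrite integralT_nnsfun; apply: ereal_sup_ubound; exists (proj_nnsfun h mE) => //= x.
rewrite mindicE; have [xE|xE] := pselect (E x).
  by rewrite mem_set // mulr1; apply: le_trans (hf x) (fg x xE).
by rewrite memNset // mulr0.
Qed.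

Lemma eq_integral_off_null (f g : S -> \bar R) :
  (forall x, E x -> f x = g x) -> (\int[nu]_x f x = \int[nu]_x g x)%E.
Proof.
move=> fg; rewrite [LHS]integralE [RHS]integralE; congr (_ - _)%E.
  by apply/eqP; rewrite eq_le; apply/andP; split; apply: le_integral_off_null => // x Ex;
    rewrite !funeposE fg.
by apply/eqP; rewrite eq_le; apply/andP; split; apply: le_integral_off_null => // x Ex;
  rewrite !funenegE fg.
Qed.

End NullSets.

(** * The bound for analytic maps into a half strip *)

Section StripBound.
Context (R : realType) (p : R) (p1 : 1 < p).
Local Notation circ := (circle_measure R).
Local Notation T := (measurableTypeR R).

(** Strict inequalities place F(z) in the open half strip, where [strip_map_surj] applies; F(0) = a
    gives Z(0) = X, hence om(0) = 0. *)
Lemma strip_bound (F : R[i] -> R[i]) (v : T -> R) (a : R) :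
  (forall z, normc z < 1 -> cdiff F z) ->
  (forall z, normc z < 1 -> 0 < Re (F z)) -> (forall z, normc z < 1 -> `|Im (F z)| < 1) ->
  F 0 = a%:C -> measurable_fun setT v ->
  {ae circ, forall x, Im (F ((rseq R n)%:C * expi x)) @[n --> \oo] --> v x} ->
  \int[circ]_x (`|v x| `^ p) <= A_const p * a.
Proof.
move=> dF F0 F1 Fa mv cv.
have a0 : 0 < a by have := F0 0; rewrite normc0 Fa => /(_ ltr01).
have X0 := radius_of_gt0 a0.
pose Z w := sinhc ((pi / 2)%:C * F w).
pose om w := (Z w - (radius_of a)%:C) / (Z w + (radius_of a)%:C).
have H w : normc w < 1 -> [/\ normc (om w) < 1, Z w + (radius_of a)%:C != 0 &
    strip_map (radius_of a) (om w) = F w].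
  by move=> w1; have := strip_map_surj a0 (F0 _ w1) (F1 _ w1).
have om0 : om 0 = 0.
  rewrite /om /Z Fa -rmorphM /sinhc /= cos0 sin0 mulr1 mulr0.
  by rewrite subrr mul0r.
have dZ w : normc w < 1 -> cdiff Z w.
  move=> w1; have h : cdiff (fun w => (pi / 2)%:C * F w) w.
    by apply: cdiffM; [exact: cdiff_cst|exact: dF].
  exact: (cdiff_comp h (cdiff_sinhc _)).
have dom w : normc w < 1 -> cdiff om w.
  move=> w1; apply: cdiffM; first by apply: cdiffB; [exact: dZ|exact: cdiff_cst].
  apply: cdiffV; first by have [] := H _ w1.
  by apply: cdiffD; [exact: dZ|exact: cdiff_cst].
apply: le_trans (strip_power_le p1 a0).
apply: (@littlewood_boundary R p p1 (strip_map (radius_of a)) om 1) => //.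
- by move=> z z1; exact: strip_map_diff.
- by move=> z /H[].
- by move=> z _; exact: strip_map_Im.
- exact: meas_strip_map.
- apply: (@filterS _ _ (ae_filter_ringOfSetsType circ) _ _ _ cv) => x.
  apply: cvg_trans; apply: near_eq_cvg; apply: nearW => n.
  have r1 : normc ((rseq R n)%:C * expi x : R[i]) < 1.
    by rewrite normc_circle ger0_norm ?rseq_ge0 // rseq_lt1.
  by have [_ _ ->] := H _ r1.
- by apply: aeW => x; exact: strip_map_boundary.
Qed.

Lemma powR_scale (c x : R) : 0 <= c -> `|c * x| `^ p = c `^ p * `|x| `^ p.
Proof. by move=> c0; rewrite normrM (ger0_norm c0) powRM. Qed.

Lemma closed_strip_bound (F : R[i] -> R[i]) (v : T -> R) (a B : R) : 0 < B ->
  (forall z, normc z < 1 -> cdiff F z) ->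
  (forall z, normc z < 1 -> 0 <= Re (F z)) -> (forall z, normc z < 1 -> `|Im (F z)| <= B) ->
  F 0 = a%:C -> measurable_fun setT v -> (forall x, `|v x| <= B) ->
  {ae circ, forall x, Im (F ((rseq R n)%:C * expi x)) @[n --> \oo] --> v x} ->
  \int[circ]_x (`|v x| `^ p) <= A_const p * B `^ (p - 1) * a.
Proof.
move=> B0 dF F0 F1 Fa mv vB cv.
have p0 : 0 < p by exact: lt_trans p1.
set I := \int[circ]_x _.
have iv : circ.-integrable setT (EFin \o (fun x : T => `|v x| `^ p)).
  apply: (circle_integrable (M := B `^ p)); first exact: meas_powR_abs.
  by move=> x; exact: powR_abs_bound.
have key n : (rseq R n / B) `^ p * I <= A_const p * (rseq R n / B * a + (1 - rseq R n)).
  have r0 : 0 < rseq R n by rewrite subr_gt0 invf_lt1 // ltr1n.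
  have r1 : rseq R n < 1 by exact: rseq_lt1.
  have c0 : 0 < rseq R n / B by rewrite divr_gt0.
  (* The factor r < 1 makes |Im| < 1 and the shift 1 - r makes Re > 0, both strictly, as
     [strip_bound] requires; both perturbations vanish as r -> 1. *)
  pose Fn z := (rseq R n / B)%:C * F z + (1 - rseq R n)%:C.
  have -> : (rseq R n / B) `^ p * I = \int[circ]_x (`|rseq R n / B * v x| `^ p).
    rewrite -RintegralZl //; apply: eq_Rintegral => x _.
    by rewrite powR_scale // ltW.
  apply: (@strip_bound Fn (fun x => rseq R n / B * v x)).
  - move=> z z1; apply: cdiffD; last exact: cdiff_cst.
    by apply: cdiffM; [exact: cdiff_cst|exact: dF].
  - move=> z z1; rewrite cReD ReZ /=; apply: ltr_wpDl; last by rewrite subr_gt0.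
    by rewrite mulr_ge0 ?(ltW c0) // F0.
  - move=> z z1; rewrite cImD ImZ /= addr0 normrM (gtr0_norm c0).
    apply: (@le_lt_trans _ _ (rseq R n / B * B)); last by rewrite divfK // gt_eqF.
    by rewrite ler_wpM2l ?(ltW c0) // F1.
  - by rewrite /Fn Fa -rmorphM -rmorphD.
  - exact: measurable_funM.
  - apply: (@filterS _ _ (ae_filter_ringOfSetsType circ) _ _ _ cv) => x h.
    under eq_fun do rewrite cImD ImZ /= addr0.
    by apply: cvgM; [exact: cvg_cst|exact: h].
have r0 n : 0 <= rseq R n by exact: rseq_ge0.
have c1 : (rseq R n / B) @[n --> \oo] --> B^-1.
  by rewrite -[X in _ --> X]mul1r; apply: cvgM; [exact: cvg_rseq|exact: cvg_cst].
have cL : (rseq R n / B) `^ p * I @[n --> \oo] --> B^-1 `^ p * I.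
  apply: cvgM; last exact: cvg_cst.
  have B1 : 0 < B^-1 by rewrite invr_gt0.
  by move=> A /(powR_cont_gt0 (q := p) B1) hA; exact: (c1 _ hA).
have cR : A_const p * (rseq R n / B * a + (1 - rseq R n)) @[n --> \oo] --> A_const p * (B^-1 * a + (1 - 1)).
  apply: cvgM; first exact: cvg_cst.
  apply: cvgD; first by apply: cvgM; [exact: c1|exact: cvg_cst].
  by apply: cvgB; [exact: cvg_cst|exact: cvg_rseq].
have h : B^-1 `^ p * I <= A_const p * (B^-1 * a).
  have := ler_cvg_to cL cR; rewrite subrr addr0; apply; exact: nearW.
have Bp : B `^ p * B^-1 `^ p = 1 by rewrite -powRM ?mulfV ?powR1 ?gt_eqF ?invr_ge0 // ltW.
have Bp1 : B `^ p = B `^ (p - 1) * B.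
  by rewrite -[X in _ = _ * X](gtr0_norm B0) -{2}(gtr0_norm B0) powR_abs_mul // gtr0_norm.
have := ler_wpM2l (powR_ge0 B p) h; rewrite mulrA Bp mul1r => /le_trans; apply.
rewrite Bp1 le_eqVlt; apply/orP; left; apply/eqP; field; exact: lt0r_neq0.
Qed.

End StripBound.

(** * From boundary data to the half strip *)

Section UpperBound.
Context (R : realType) (p : R) (p1 : 1 < p).
Local Notation circ := (circle_measure R).
Local Notation T := (measurableTypeR R).

Lemma norm_lt1 (z : R[i]) : (`|z| < 1) = (normc z < 1).
Proof. by rewrite normC_normc (ltcR (normc z) 1). Qed.

Lemma cvg_rseq_left : rseq R n @[n --> \oo] --> (1 : R)^'-.
Proof.
move=> A [e /= e0 h]; have := @cvg_rseq R => /cvgrPdist_lt /(_ _ e0).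
apply: filterS => n hn; apply: h => //; exact: rseq_lt1.
Qed.

Lemma ln_max1_ge0 (y : R) : 0 <= ln (Num.max 1 y).
Proof. by apply: ln_ge0; rewrite le_max lexx. Qed.

Lemma ln_max1_le (y : R) : 0 <= y -> ln (Num.max 1 y) <= y.
Proof.
move=> y0; have [h|h] := leP y 1.
  by rewrite ln1.
have := @le_ln1Dx R (y - 1); rewrite addrCA subrr addr0 => /(_ _) => k.
by have := k ltac:(lra); lra.
Qed.

Lemma meas_normc_along (F : R[i] -> R[i]) (r : R) : (forall z, normc z < 1 -> cdiff F z) -> 0 <= r < 1 ->
  measurable_fun setT (fun x : T => ln (Num.max 1 (normc (F (r%:C * expi x))))).
Proof.
move=> dF /andP[r0 r1]; apply: meas_lnmax.
have c x : ccont F (r%:C * expi x) by apply/cdiff_cont/dF; rewrite normc_circle ger0_norm.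
by apply: meas_normc; [exact: meas_circle_Re|exact: meas_circle_Im].
Qed.

Lemma half_strip_bound (B : R) (F : R[i] -> R[i]) :
  half_strip_data B F -> Lp_estimate p (A_const p) B F.
Proof.
move=> [[[aF [M hM]] hrad hlim] hu hv hI].
have dF z : normc z < 1 -> cdiff F z.
  by rewrite -norm_lt1 => z1; apply/derivable_cdiff/aF.
have [E [mE E0 hE]] : exists E : set T, [/\ measurable E, circ (~` E) = 0%E &
    forall x, E x -> [/\ cvg (along_radius F x r @[r --> 1^'-]), 0 <= bdry_re F x & `|bdry_im F x| <= B]].
  have : {ae circ, forall x, [/\ cvg (along_radius F x r @[r --> 1^'-]), 0 <= bdry_re F x & `|bdry_im F x| <= B]}.
    by apply: (@filterS3 _ _ (ae_filter_ringOfSetsType circ) _ _ _ _ _ hrad hu hv) => x.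
  move=> [N [mN N0 sub]]; exists (~` N); split; first exact: measurableC.
    by rewrite setCK.
  by move=> x Nx; apply: contrapT => h; apply: Nx; exact: sub.
(* Off the full-measure set E the value 0 is substituted. Once B >= 0 is known, both constraints
   then hold at every x; and bv is Borel, as the pointwise limit of 1_E F(r_n e^{ix}). *)
pose bv (x : T) : R[i] := if x \in E then boundary_value F x else 0.
have bvE x : E x -> bv x = boundary_value F x by move=> Ex; rewrite /bv mem_set.
have cF x : E x -> (F ((rseq R n)%:C * expi x) : R[i]^o) @[n --> \oo] --> (bv x : R[i]^o).
  move=> Ex; rewrite bvE //; have [h _ _] := hE x Ex.
  by move=> A /h hA; exact: (cvg_rseq_left hA).
have r1 n x : normc ((rseq R n)%:C * expi x : R[i]) < 1.
  by rewrite normc_circle ger0_norm ?rseq_ge0 // rseq_lt1.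
have rr n : 0 <= rseq R n < 1 by rewrite rseq_ge0 rseq_lt1.
have cI x n : ccont F ((rseq R n)%:C * expi x) by exact/cdiff_cont/dF.
have mRe : measurable_fun setT (fun x => Re (bv x)).
  apply: (@measurable_fun_cvg _ _ _ setT (fun n x => \1_E x * Re (F ((rseq R n)%:C * expi x)))).
    by move=> n; apply: measurable_funM; [exact: measurable_indic|exact: meas_circle_Re].
  move=> x _; rewrite indicE; have [xE|xE] := boolP (x \in E).
    by under eq_fun do rewrite mul1r; apply: cvg_Re; apply: cF; rewrite inE in xE.
  by under eq_fun do rewrite mul0r; rewrite /bv (negbTE xE); exact: cvg_cst.
have mIm : measurable_fun setT (fun x => Im (bv x)).
  apply: (@measurable_fun_cvg _ _ _ setT (fun n x => \1_E x * Im (F ((rseq R n)%:C * expi x)))).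
    by move=> n; apply: measurable_funM; [exact: measurable_indic|exact: meas_circle_Im].
  move=> x _; rewrite indicE; have [xE|xE] := boolP (x \in E).
    by under eq_fun do rewrite mul1r; apply: cvg_Im; apply: cF; rewrite inE in xE.
  by under eq_fun do rewrite mul0r; rewrite /bv (negbTE xE); exact: cvg_cst.
have mL : measurable_fun setT (fun x : T => ln (Num.max 1 (normc (bv x)))).
  by apply: meas_lnmax; exact: meas_normc.
have hlim1 : (\int[circ]_x (log_plus_norm (along_radius F x (rseq R n)))%:E)%E @[n --> \oo] -->
    (\int[circ]_x (ln (Num.max 1 (normc (bv x))))%:E)%E.
  have -> : (\int[circ]_x (ln (Num.max 1 (normc (bv x))))%:E)%E =
      (\int[circ]_x (log_plus_norm (boundary_value F x))%:E)%E.
    by apply: (eq_integral_off_null mE E0) => x Ex; rewrite bvE.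
  by move=> A /hlim hA; exact: (cvg_rseq_left hA).
have iL : circ.-integrable setT (EFin \o (fun x : T => ln (Num.max 1 (normc (bv x))))).
  apply/integrableP; split; first exact/measurable_EFinP.
  apply: (@le_lt_trans _ _ M%:E); last exact: ltry.
  under eq_integral => x _ do rewrite /= ger0_norm ?ln_max1_ge0 //.
  rewrite -(cvg_lim _ hlim1) //; apply: lime_le; first by apply/cvg_ex; eexists; exact: hlim1.
  by apply: nearW => n; exact: hM.
have iLn n : circ.-integrable setT (EFin \o (fun x : T => ln (Num.max 1 (normc (F ((rseq R n)%:C * expi x)))))).
  apply/integrableP; split; first by apply/measurable_EFinP; exact: meas_normc_along.
  apply: (@le_lt_trans _ _ M%:E); last exact: ltry.
  under eq_integral => x _ do rewrite /= ger0_norm ?ln_max1_ge0 //.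
  exact: hM.
have cL : (\int[circ]_x ln (Num.max 1 (normc (F ((rseq R n)%:C * expi x))))) @[n --> \oo] -->
        \int[circ]_x ln (Num.max 1 (normc (bv x))).
  move: hlim1; rewrite -EFin_Rint // => /fine_cvgP[_].
  by apply: cvg_trans; apply: near_eq_cvg; exact: nearW.
clear hlim hlim1 hM aF hrad hu hv mL iLn.
have Re0 x : 0 <= Re (bv x).
  by rewrite /bv; case: ifPn => // /set_mem Ex; have [] := hE x Ex.
(* The circle has mass 1, so E is not empty; any of its points shows B >= 0. *)
have [x0 Ex0] : exists x, E x.
  apply: contrapT => /forallNP h; have := circle_mass R.
  have <- : ~` E = setT by apply/seteqP; split => x // _; exact: h.
  by rewrite E0 => /eqP; rewrite eq_sym onee_eq0.
have B0 : 0 <= B by have [_ _ h] := hE x0 Ex0; apply: le_trans h.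
have ImB x : `|Im (bv x)| <= B.
  by rewrite /bv; case: ifPn => [/set_mem Ex|_]; [have [] := hE x Ex|rewrite normr0].
have eIm : (\int[circ]_x (`|bdry_im F x| `^ p)%:E = \int[circ]_x (`|Im (bv x)| `^ p)%:E)%E.
  by apply: (eq_integral_off_null mE E0) => x Ex; rewrite bvE.
have eRe : (\int[circ]_x (bdry_re F x)%:E = \int[circ]_x (Re (bv x))%:E)%E.
  by apply: (eq_integral_off_null mE E0) => x Ex; rewrite bvE.
have hI0 : (\int[circ]_x (Im (bv x))%:E)%E = 0%E.
  by rewrite -[RHS]hI; apply: (eq_integral_off_null mE E0) => x Ex; rewrite bvE.
have p0 : 0 < p by exact: lt_trans p1.
rewrite /Lp_estimate eIm eRe.
clear hI eIm eRe bvE hE; clearbody bv.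
(* The normalisation by B breaks down at B = 0, where v = 0 and both sides vanish, even for an
   infinite integral of u, by 0 times oo = 0. *)
have [B00|Bn0] := eqVneq B 0.
  rewrite B00 powR0; last by rewrite subr_eq0 gt_eqF.
  rewrite mulr0 mul0e integral0_eq // => x _; have := ImB x.
  by rewrite B00 normr_le0 => /eqP ->; rewrite normr0 powR0 // gt_eqF.
have Bp : 0 < B by rewrite lt_neqAle eq_sym Bn0.
have AB : 0 < A_const p * B `^ (p - 1) by rewrite mulr_gt0 ?powR_gt0 // A_const_gt0.
have U0 : (0 <= \int[circ]_x (Re (bv x))%:E)%E by apply: integral_ge0 => x _; rewrite lee_fin.
have [Uoo|Ufin] := eqVneq (\int[circ]_x (Re (bv x))%:E)%E +oo%E.
  by rewrite Uoo gt0_muley ?lte_fin // leey.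
have iRe : circ.-integrable setT (EFin \o (fun x => Re (bv x))).
  apply/integrableP; split; first exact/measurable_EFinP.
  under eq_integral => x _ do rewrite /= ger0_norm //.
  by rewrite lt_neqAle Ufin leey.
have ibv : circ.-integrable setT (EFin \o (fun x => normc (bv x))).
  have iN := circ_integrableD iRe (circle_cst_integrable B).
  apply: (le_integrable _ _ _ iN) => //.
    by apply/measurable_EFinP; exact: meas_normc.
  move=> x _ /=; rewrite lee_fin ger0_norm ?normc_ge0 //; apply: le_trans (ler_norm _).
  by apply: (le_trans (normc_le _)); rewrite ger0_norm // lerD2l.
have [oR oI] := hardy_origin dF mE E0 cF mRe mIm iL cL ibv.
have HP := hardy_halfplane dF mE E0 cF mRe mIm iL cL ibv.
have F0 z : normc z < 1 -> 0 <= Re (F z).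
  move=> z1; have := HP 1 0 0 z z1; rewrite mul1r mul0r !addr0; apply.
  by move=> x; rewrite mul1r mul0r !addr0.
have FB z : normc z < 1 -> `|Im (F z)| <= B.
  move=> z1; rewrite ler_norml; apply/andP; split.
    have := HP 0 1 B z z1; rewrite mul1r mul0r add0r => h.
    rewrite -subr_ge0 opprK; apply: h => x; rewrite mul1r mul0r add0r.
    by have := ImB x; rewrite ler_norml => /andP[h _]; rewrite -lerBlDr sub0r.
  have := HP 0 (-1) B z z1; rewrite mulN1r mul0r add0r => h.
  rewrite -subr_ge0 addrC; apply: h => x; rewrite mulN1r mul0r add0r addrC subr_ge0.
  by have := ImB x; rewrite ler_norml => /andP[].
have iIm : circ.-integrable setT (EFin \o (fun x => Im (bv x))).
  exact: (circle_integrable mIm ImB).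
(* The vanishing mean of v enters here: F(0) is real and equals the mean of u. *)
have Fa : F 0 = (\int[circ]_x Re (bv x))%:C.
  apply/eqP; rewrite eq_complex /= -oR -oI eqxx /=.
  have e0 : (\int[circ]_x Im (bv x))%:E = 0%E by rewrite (EFin_Rint iIm) hI0.
  by case: e0 => ->.
have iP : circ.-integrable setT (EFin \o (fun x => `|Im (bv x)| `^ p)).
  apply: (circle_integrable (M := B `^ p)); first exact: meas_powR_abs.
  by move=> x; exact: powR_abs_bound.
rewrite -(EFin_Rint iP) -(EFin_Rint iRe) -EFinM lee_fin.
apply: (closed_strip_bound p1 Bp dF F0 FB Fa mIm ImB).
by apply: (ae_circ mE E0) => x Ex; apply: cvg_Im; exact: cF.
Qed.

End UpperBound.

(** * Sharpness *)

Section Sharpness.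
Context (R : realType) (p : R) (p1 : 1 < p).
Local Notation circ := (circle_measure R).
Local Notation T := (measurableTypeR R).

Lemma acosh_le (c : R) : 1 <= c -> acosh c <= 2 * c.
Proof.
move=> c1; rewrite /acosh; set s := Num.sqrt _.
have sc : s <= c.
  rewrite /s -[X in _ <= X](gtr0_norm (lt_le_trans ltr01 c1)) -sqrtr_sqr ler_wsqrtr //.
  by rewrite gerDl oppr_le0.
have s0 : 0 <= s := sqrtr_ge0 _.
have := @le_ln1Dx R (c + s - 1); rewrite addrCA subrr addr0 => h.
by have := h ltac:(lra); lra.
Qed.

(** On |z| <= rho the Cayley transform has modulus at most (1 + rho) / (1 - rho), and acosh c <= 2
    c: a crude bound, but it makes every dilate bounded. *)
Lemma strip_map_bounded (X rho : R) (z : R[i]) : 0 < X -> 0 < rho < 1 -> normc z <= rho ->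
  normc (strip_map X z) <= 2 / pi * (2 * (X * ((1 + rho) / (1 - rho)) + 1)) + 1.
Proof.
move=> X0 /andP[r0 r1] zr.
have z1 : normc z < 1 by exact: le_lt_trans r1.
apply: (le_trans (normc_le _)); apply: lerD; last exact: strip_map_Im.
rewrite ger0_norm ?strip_map_Re // ReZ /= ler_pM2l ?two_pi_gt0 //.
apply: (le_trans (acosh_le (foc_sum_ge1 _))); rewrite ler_pM2l //.
have h : foc_sum (X%:C * cayley z) <= normc (X%:C * cayley z) + 1.
  rewrite /foc_sum ler_pdivrMr //.
  have := normc_triangle (X%:C * cayley z) 'i.
  have := normc_triangle (X%:C * cayley z) (- 'i).
  rewrite normcN normci; lra.
apply: (le_trans h); rewrite lerD2r normcM normc_real gtr0_norm // ler_pM2l //.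
rewrite /cayley normcM normcV.
have d1 : 1 - rho <= normc (1 - z).
  have := normc_triangle (1 - z) z; rewrite subrK normc1; lra.
have n1 : normc (1 + z) <= 1 + rho.
  by apply: (le_trans (normc_triangle _ _)); rewrite normc1 lerD2l.
have d0 : 0 < 1 - rho by rewrite subr_gt0.
apply: ler_pM; rewrite ?normc_ge0 ?invr_ge0 ?normc_ge0 //.
by rewrite lef_pV2 ?posrE // (lt_le_trans d0).
Qed.

Section Dilate.
Context (a rho : R) (a0 : 0 < a) (hrho : 0 < rho < 1).
Let F (z : R[i]) : R[i] := strip_map (radius_of a) (rho%:C * z).
Let K : R := 2 / pi * (2 * (radius_of a * ((1 + rho) / (1 - rho)) + 1)) + 1.

Let rho_gt0 : 0 < rho. Proof. by case/andP: hrho. Qed.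
Let rho_lt1 : rho < 1. Proof. by case/andP: hrho. Qed.

Lemma dilate_diff z : normc z < rho^-1 -> cdiff F z.
Proof.
move=> z1; have h : cdiff (fun z => rho%:C * z) z.
  by apply: cdiffM; [exact: cdiff_cst|exact: cdiff_id].
apply: (cdiff_comp h); apply: strip_map_diff; first exact: radius_of_gt0.
by rewrite normcM normc_real gtr0_norm // mulrC -ltr_pdivlMr // mul1r.
Qed.

Lemma dilate_bounded z : normc z <= 1 -> normc (F z) <= K.
Proof.
move=> z1; apply: strip_map_bounded => //; first exact: radius_of_gt0.
by rewrite normcM normc_real gtr0_norm // ler_piMr // ltW.
Qed.

Let inv1 : 1 < rho^-1. Proof. by rewrite invf_gt1. Qed.

Lemma dilate_cont z : normc z <= 1 -> ccont F z.
Proof. by move=> z1; apply/cdiff_cont/dilate_diff; exact: le_lt_trans inv1. Qed.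

Lemma dilate_radial (x : R) : (along_radius F x r @[r --> (1 : R)^'-]) --> (F (expi x) : R[i]^o).
Proof.
have /ccontE c : ccont F (expi x) by apply: dilate_cont; rewrite normc_expi.
have h : (fun r : R => (r%:C * expi x : R[i]^o)) @ (1 : R)^'- --> (expi x : R[i]^o).
  rewrite -[X in _ --> X]mul1r; apply: cvgZC; last exact: cvgC_cst.
  apply: cvg_complex; last exact: cvg_cst.
  by apply: cvg_at_left_filter; exact: cvg_id.
by move=> A /c hA; exact: (h _ hA).
Qed.

Lemma dilate_boundary (x : R) : boundary_value F x = F (expi x).
Proof. exact: (cvg_lim (@norm_hausdorff R[i] R[i]^o) (@dilate_radial x)). Qed.

Lemma dilate_log_bound (z : R[i]) : normc z <= 1 -> `|ln (Num.max 1 (normc (F z)))| <= K.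
Proof.
move=> z1; rewrite ger0_norm ?ln_max1_ge0 //; apply: (le_trans (ln_max1_le (normc_ge0 _))).
exact: dilate_bounded.
Qed.

Lemma dilate_meas_log (r : R) : 0 <= r <= 1 ->
  measurable_fun setT (fun x : T => ln (Num.max 1 (normc (F (r%:C * expi x))))).
Proof.
move=> /andP[r0 r1]; apply: meas_lnmax.
have c x : ccont F (r%:C * expi x) by apply: dilate_cont; rewrite normc_circle ger0_norm.
by apply: meas_normc; [exact: meas_circle_Re|exact: meas_circle_Im].
Qed.

Lemma dilate_log_integrable (r : R) : 0 <= r <= 1 ->
  circ.-integrable setT (EFin \o (fun x : T => ln (Num.max 1 (normc (F (r%:C * expi x)))))).
Proof.
move=> hr; apply: (circle_integrable (M := K)); first exact: dilate_meas_log.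
by move=> x; apply: dilate_log_bound; case/andP: hr => r0 r1; rewrite normc_circle ger0_norm.
Qed.

(** A dilate is bounded and continuous on the closed disk, so its radial limits are plain values and
    dominated convergence settles the log-plus means. *)
Lemma dilate_smirnov : smirnov F.
Proof.
split.
- split.
    by move=> z; rewrite norm_lt1 => z1; apply/derivable_cdiff/dilate_diff; exact: lt_trans inv1.
  exists K => r /andP[r0 r1].
  have hr : 0 <= r <= 1 by rewrite r0 ltW.
  rewrite -[X in (X <= _)%E](EFin_Rint (dilate_log_integrable hr)) lee_fin.
  rewrite -(Rintegral_circle_cst K); apply: le_Rintegral => //.
  + exact: dilate_log_integrable.
  + exact: circle_cst_integrable.
  move=> x _; apply: (le_trans (ler_norm _)); apply: dilate_log_bound.
  by rewrite normc_circle ger0_norm // ltW.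
- apply: aeW => x; apply/cvg_ex; exists (F (expi x)); exact: dilate_radial.
have i1 : 0 <= (1 : R) <= 1 by rewrite ler01 lexx.
have -> : (\int[circ]_x (log_plus_norm (boundary_value F x))%:E)%E =
    (\int[circ]_x ln (Num.max 1 (normc (F (1%:C * expi x)))))%:E.
  have -> := EFin_Rint (dilate_log_integrable i1).
  by apply: eq_integral => x _; rewrite dilate_boundary mul1r.
apply/cvge_at_leftP => u [u1 cu].
(* A sequence tending to 1 from the left may start with negative terms, while measurability and
   integrability are stated for radii in [0, 1]. Truncation at 0 changes only finitely many
   terms. *)
pose w n : R := Num.max 0 (u n).
have w01 n : 0 <= w n <= 1 by rewrite le_max lexx ge_max ler01 (ltW (u1 n)).
have C : \int[circ]_x ln (Num.max 1 (normc (F ((w n)%:C * expi x)))) @[n --> \oo] -->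
    \int[circ]_x ln (Num.max 1 (normc (F (1%:C * expi x)))).
  apply: (circ_bounded_cvg (M := K)).
  - by move=> n; exact: dilate_meas_log.
  - exact: dilate_meas_log.
  - move=> n x; apply: dilate_log_bound.
    by have /andP[h1 h2] := w01 n; rewrite normc_circle ger0_norm.
  apply: aeW => x.
  have cw : w n @[n --> \oo] --> (1 : R).
    rewrite -[X in _ --> X](_ : Num.max 0 1 = 1); last by apply/max_idPr.
    exact: cvg_maxr.
  have cz : ((w n)%:C * expi x : R[i]^o) @[n --> \oo] --> (1%:C * expi x : R[i]^o).
    apply: cvgZC; last exact: cvgC_cst.
    by apply: cvg_complex; [exact: cw|exact: cvg_cst].
  have /ccontE cFz : ccont F (1%:C * expi x) by apply: dilate_cont; rewrite mul1r normc_expi.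
  have cF : (F ((w n)%:C * expi x) : R[i]^o) @[n --> \oo] --> (F (1%:C * expi x) : R[i]^o).
    by move=> A /cFz hA; exact: (cz _ hA).
  have m0 : 0 < Num.max 1 (normc (F (1%:C * expi x))) by rewrite lt_max ltr01.
  have cM : Num.max 1 (normc (F ((w n)%:C * expi x))) @[n --> \oo] --> Num.max 1 (normc (F (1%:C * expi x))).
    by apply: cvg_maxr; apply: cvg_normc.
  by move=> A /(continuous_ln m0) hA; exact: (cM _ hA).
have CE : (\int[circ]_x (ln (Num.max 1 (normc (F ((w n)%:C * expi x)))))%:E)%E @[n --> \oo] -->
    (\int[circ]_x ln (Num.max 1 (normc (F (1%:C * expi x)))))%:E.
  apply/fine_cvgP; split; first by apply: nearW => n; rewrite -(EFin_Rint (dilate_log_integrable (w01 n))).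
  exact: C.
apply: cvg_trans CE; apply: near_eq_cvg.
near=> n; have un : 0 < u n by near: n; apply: (cvgr_gt _ cu); exact: ltr01.
by rewrite /w max_r // ltW.
Unshelve. all: by end_near.
Qed.

Lemma dilate_Im_integrable : circ.-integrable setT (EFin \o (fun x : T => Im (F (expi x)))).
Proof.
apply: circle_cont_integrable.
have c x : ccont F (1%:C * expi x) by apply: dilate_cont; rewrite mul1r normc_expi.
have := cont_Im_circle c; by under eq_fun do rewrite mul1r.
Qed.

Lemma dilate_Re_integrable : circ.-integrable setT (EFin \o (fun x : T => Re (F (expi x)))).
Proof.
apply: circle_cont_integrable.
have c x : ccont F (1%:C * expi x) by apply: dilate_cont; rewrite mul1r normc_expi.
have := cont_Re_circle c; by under eq_fun do rewrite mul1r.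
Qed.

Lemma dilate_origin : F 0 = a%:C.
Proof. by rewrite /F mulr0 strip_map0 // ltW. Qed.

Lemma dilate_mean_Re : \int[circ]_x Re (F (expi x)) = a.
Proof.
have h : 0 <= (1 : R) < rho^-1 by rewrite ler01 inv1.
transitivity (Re (F 0)); last by rewrite dilate_origin.
rewrite -(@mean_value_Re R F rho^-1 (-1) 1 (fun w h => cdiff_cont (dilate_diff h)) (fun w h _ _ => dilate_diff h) h).
by apply: eq_Rintegral => x _; rewrite mul1r.
Qed.

Lemma dilate_mean_Im : \int[circ]_x Im (F (expi x)) = 0.
Proof.
have h : 0 <= (1 : R) < rho^-1 by rewrite ler01 inv1.
transitivity (Im (F 0)); last by rewrite dilate_origin.
rewrite -(@mean_value_Im R F rho^-1 (-1) 1 (fun w h => cdiff_cont (dilate_diff h)) (fun w h _ _ => dilate_diff h) h).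
by apply: eq_Rintegral => x _; rewrite mul1r.
Qed.

Lemma dilate_half_strip : half_strip_data 1 F.
Proof.
split; first exact: dilate_smirnov.
- by apply: aeW => x; rewrite /bdry_re dilate_boundary; exact: strip_map_Re.
- by apply: aeW => x; rewrite /bdry_im dilate_boundary; exact: strip_map_Im.
transitivity (\int[circ]_x (Im (F (expi x)))%:E)%E.
  by apply: eq_integral => x _; rewrite /bdry_im dilate_boundary.
by rewrite -(EFin_Rint dilate_Im_integrable) dilate_mean_Im.
Qed.

Lemma dilate_estimate (C : R) : Lp_estimate p C 1 F ->
  \int[circ]_x (`|Im (strip_map (radius_of a) (rho%:C * expi x))| `^ p) <= C * a.
Proof.
rewrite /Lp_estimate powR1 mulr1.
have -> : (\int[circ]_x (`|bdry_im F x| `^ p)%:E = \int[circ]_x (`|Im (F (expi x))| `^ p)%:E)%E.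
  by apply: eq_integral => x _; rewrite /bdry_im dilate_boundary.
have -> : (\int[circ]_x (bdry_re F x)%:E = \int[circ]_x (Re (F (expi x)))%:E)%E.
  by apply: eq_integral => x _; rewrite /bdry_re dilate_boundary.
rewrite -(EFin_Rint dilate_Re_integrable) dilate_mean_Re -EFinM -EFin_Rint ?lee_fin //.
apply: (circle_integrable (M := 1 `^ p)).
  by apply: meas_powR_abs => //; have /integrableP[/measurable_EFinP] := dilate_Im_integrable.
by move=> x; apply: powR_abs_bound => //; exact: strip_map_Im.
Qed.

End Dilate.

(** The conformal map itself is unbounded; its dilates satisfy [half_strip_data] with B = 1 and mean
    of u equal to a, and rho -> 1 passes the estimate on to the map, whose p-th mean is
    [strip_power]. *)
Lemma sharp_constant (C : R) :
  (forall (B : R) (F : R[i] -> R[i]), half_strip_data B F -> Lp_estimate p C B F) ->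
  A_const p <= C.
Proof.
move=> H; apply: (A_const_le p1) => a a0.
have rp n : 0 < rseq R n < 1 by rewrite rseq_lt1 subr_gt0 invf_lt1 // ltr1n.
have key n := dilate_estimate a0 (rp n) (H _ _ (dilate_half_strip a0 (rp n))).
have X0 := radius_of_gt0 a0.
have cI : \int[circ]_x (`|Im (strip_map (radius_of a) ((rseq R n)%:C * expi x))| `^ p) @[n --> \oo] -->
    strip_power p a.
  apply: (circ_bounded_cvg (M := 1 `^ p)).
  - move=> n; apply: meas_powR_abs => //; apply: meas_circle_Im => x.
    apply/cdiff_cont/strip_map_diff => //.
    by rewrite normc_circle ger0_norm ?rseq_ge0 // rseq_lt1.
  - exact: (meas_powR_abs p1 (meas_strip_map X0)).
  - by move=> n x; apply: powR_abs_bound => //; exact: strip_map_Im.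
  apply: aeW => x.
  exact: (cvg_comp _ _ (@strip_map_boundary R (radius_of a) x) (@cont_powR_abs R p (lt_trans ltr01 p1) (Im (strip_map (radius_of a) (expi x))))).
by apply: (ler_cvg_to cI (@cvg_cst _ _ _ _ _)); exact: nearW.
Qed.

End Sharpness.

Theorem theorem1 (R : realType) (p : R) (hp : 1 < p) :
  (forall (B : R) (F : R[i] -> R[i]),
      half_strip_data B F -> Lp_estimate p (A_const p) B F) /\
  (forall C : R, C < A_const p ->
      ~ (forall (B : R) (F : R[i] -> R[i]),
            half_strip_data B F -> Lp_estimate p C B F)).
Proof.
split=> [B F|C CA H]; first exact: half_strip_bound.
by have := sharp_constant hp H; rewrite leNgt CA.
Qed.
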